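(* Let $m\ge2$, $n=m(m-1)/2$, let $\mathbb{G}$ be the free step-two homogeneous Carnot group of $m$ generators $X_1,\dots,X_m$ with the Riemannian metric $g$ for which the Jacobian basis $(X_i)_{1\le i\le m},(\Gamma_{h,k})_{1\le k<h\le m}$ is orthonormal, let $\nabla=\nabla^g$ be its Levi-Civita connection, and let $\Delta=\mathrm{span}\{X_1,\dots,X_m\}$. Then the inclusions $\mathcal{H}^{\nabla}_{\Delta_R}\subset\mathrm{SE}(m+n)$ and $H^{\nabla}_{\Delta}\subset\mathrm{SO}(m+n)$ are strict if and only if $m\ge3$.
   Context: Let $N=m+n$ and $\mathcal{I}=\{(h,k):1\le k<h\le m\}$. $\mathbb{G}=(\mathbb{R}^{m+n},\star)$, with points $(v,\gamma)$, $v\in\mathbb{R}^m$, $\gamma=(\gamma_{h,k})_{(h,k)\in\mathcal{I}}$, and $(v,\gamma)\star(v',\gamma')=\big((v_i+v_i')_i,(\gamma_{h,k}+\gamma'_{h,k}+\frac12(v_hv'_k-v_kv'_h))_{(h,k)\in\mathcal{I}}\big)$. Jacobian basis: $X_h=\frac{\partial}{\partial v_h}+\frac12\sum_{h<i\le m}v_i\frac{\partial}{\partial\gamma_{i,h}}-\frac12\sum_{1\le j<h}v_j\frac{\partial}{\partial\gamma_{h,j}}$, $\Gamma_{h,k}=\frac{\partial}{\partial\gamma_{h,k}}$. $\Delta$-admissible curves are absolutely continuous (a.c.) curves a.e. tangent to $\Delta$. $(P^\nabla)_s^t(\gamma)$ is parallel transport along $\gamma$ from $\gamma(s)$ to $\gamma(t)$.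 $H^\nabla_\Delta|_x=\{(P^\nabla)_0^1(\gamma):\gamma:[0,1]\to\mathbb{G}\text{ a.c. }\Delta\text{-admissible loop based at }x\}\subset\mathrm{SO}(T_x\mathbb{G})$, and $H^\nabla_\Delta\subset\mathrm{SO}(m+n)$ is the corresponding subgroup (up to conjugation, independent of $x$). Let $Q=\{(x,\hat x;A):x\in\mathbb{G},\hat x\in\mathbb{R}^N,A:T_x\mathbb{G}\to\mathbb{R}^N\text{ an orientation-preserving linear isometry}\}$, $\pi_{Q,\mathbb{G}}(x,\hat x;A)=x$. For $q=(x,\hat x;A)$ and $X\in T_x\mathbb{G}$, $\mathscr{L}_R(X)|_q=\frac{d}{dt}\big|_0\big(\gamma(t),\hat x+tAX;A\circ(P^\nabla)_t^0(\gamma)\big)$ for any curve $\gamma$ with $\gamma(0)=x,\dot\gamma(0)=X$; $\Delta_R|_q=\mathscr{L}_R(\Delta|_x)|_q$; $\mathcal{O}_{\Delta_R}(q)$ is the set of endpoints of a.c. curves in $Q$ starting at $q$ and a.e. tangent to $\Delta_R$. $\mathrm{SE}(N)=\mathbb{R}^N\rtimes\mathrm{SO}(N)$ acts on $Q$ by $\mu((\hat y,C),(x,\hat x;A))=(x,C\hat x+\hat y;C\circ A)$, freely and transitively on fibers of $\pi_{Q,\mathbb{G}}$. $\mathcal{H}^\nabla_{\Delta_R|q}$ is the unique subgroup of $\mathrm{SE}(N)$ with $\mu(\mathcal{H}^\nabla_{\Delta_R|q}\times\{q\})=\mathcal{O}_{\Delta_R}(q)\cap\pi_{Q,\mathbb{G}}^{-1}(\pi_{Q,\mathbb{G}}(q))$;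 these are conjugate for different $q$, and $\mathcal{H}^\nabla_{\Delta_R}$ denotes this group up to conjugation. *)

(* Defs.v *)
From HB Require Import structures.
From mathcomp Require Import all_boot all_order all_algebra.
From mathcomp Require Import all_classical all_reals all_analysis.
From mathcomp Require Import ring lra.

Set Implicit Arguments.
Unset Strict Implicit.
Unset Printing Implicit Defensive.

Import Order.TTheory GRing.Theory Num.Theory.
Import numFieldNormedType.Exports.

Local Open Scope classical_set_scope.
Local Open Scope ring_scope.

(* The pairs in [s] are the end points of non-overlapping subintervals of
   [a, b]. *)
Definition abs_continuous (R : realType) (V : normedModType R) (a b : R)
    (c : R -> V) : Prop :=
  forall e : R, 0 < e -> exists2 d : R, 0 < d &
  forall s : seq (R * R),
    all (fun I => [&& a <= I.1, I.1 <= I.2 & I.2 <= b]) s ->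
    pairwise (fun I J => (I.2 <= J.1) || (J.2 <= I.1)) s ->
    \sum_(I <- s) (I.2 - I.1) < d ->
    \sum_(I <- s) `|c I.2 - c I.1| < e.

Definition ae_itv (R : realType) (a b : R) (P : R -> Prop) : Prop :=
  {ae @lebesgue_measure R, forall t : R, a <= t <= b -> P t}.

(*  The manifold is R^N with its global chart; points and tangent vectors are
    column vectors, a Riemannian metric is its matrix [g x] in the coordinate
    basis, and a connection is given by its Christoffel symbols:
    [conn x i k j] is Gamma^k_{ij}, that is, [conn x i] is the matrix of
    v |-> nabla_{d_i} v on fields v with constant coefficients. *)

Section Connection.
Context {R : realType} {N : nat}.
Implicit Types (g : 'cV[R]_N -> 'M[R]_N) (conn : 'cV[R]_N -> 'I_N -> 'M[R]_N).

Definition partial (f : 'cV[R]_N -> R) (i : 'I_N) (x : 'cV[R]_N) : R :=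
  'D_(delta_mx i 0) f x.

Definition torsion_free conn : Prop :=
  forall x i j k, conn x i k j = conn x j k i.

(* d_i <d_j, d_k> = <nabla_{d_i} d_j, d_k> + <d_j, nabla_{d_i} d_k> *)
Definition metric_compatible g conn : Prop :=
  forall x i j k, partial (fun y => g y j k) i x =
    \sum_l (conn x i l j * g x l k + g x j l * conn x i l k).

Definition levi_civita g conn : Prop :=
  torsion_free conn /\ metric_compatible g conn.

Definition conn_along conn (x v : 'cV[R]_N) : 'M[R]_N :=
  \sum_i v i 0 *: conn x i.

(* [V] is an absolutely continuous vector field along [c] on [a, b] whose
   covariant derivative along [c] vanishes almost everywhere. *)
Definition parallel_field conn (c : R -> 'cV[R]_N) (a b : R)
    (V : R -> 'cV[R]_N) : Prop :=
  abs_continuous a b V /\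
  ae_itv a b (fun t => exists dc dV : 'cV[R]_N,
    [/\ is_derive t (1 : R) c dc, is_derive t (1 : R) V dV &
        dV + conn_along conn (c t) dc *m V t = 0]).

(* [P] is the matrix of the parallel transport along [c] from [c s] to [c t];
   [t < s] is allowed. *)
Definition parallel_transport conn (c : R -> 'cV[R]_N) (s t : R)
    (P : 'M[R]_N) : Prop :=
  forall u : 'cV[R]_N, exists V : R -> 'cV[R]_N,
    [/\ parallel_field conn c (Num.min s t) (Num.max s t) V,
        V s = u & V t = P *m u].

Definition orthonormal_basis g (x : 'cV[R]_N) (E : 'M[R]_N) : Prop :=
  E^T *m g x *m E = 1%:M.

(* Existence of the Levi-Civita connection, by the Koszul formula *)
Definition christoffel g : 'cV[R]_N -> 'I_N -> 'M[R]_N := fun x i =>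
  invmx (g x) *m \matrix_(l, j) (2^-1 * (partial (fun y => g y j l) i x +
    partial (fun y => g y i l) j x - partial (fun y => g y i j) l x)).

Lemma christoffel_levi_civita g :
  (forall x, (g x)^T = g x) -> (forall x, g x \in unitmx) ->
  levi_civita g (christoffel g).
Proof.
move=> gT gU.
have gC x i j : g x i j = g x j i by rewrite -[in LHS]gT mxE.
have pC i j l x : partial (fun y => g y i j) l x = partial (fun y => g y j i) l x.
  by congr (partial _ l x); apply/funext => y.
split=> [x i j k|x i j k].
  rewrite !mxE; apply: eq_bigr => l _; congr (_ * _); rewrite !mxE.
  by rewrite (pC i j) [X in X - _]addrC.
have low a b : \sum_l christoffel g x i l a * g x l b =
    2^-1 * (partial (fun y => g y a b) i x + partial (fun y => g y i b) a x -
            partial (fun y => g y i a) b x).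
  under eq_bigr do rewrite mulrC gC.
  transitivity ((g x *m christoffel g x i) b a); first by rewrite mxE.
  by rewrite mulKVmx // !mxE.
rewrite big_split /= low; under [X in _ + X]eq_bigr do rewrite mulrC gC.
rewrite low (pC k j) -mulrDr.
set A := partial _ i x; set B := partial _ j x; set C := partial _ k x.
by field.
Qed.

End Connection.

(* (h, k) with k < h, the index set of the vertical coordinates; indices start from 0. *)
Definition vpair (m : nat) := {p : 'I_m * 'I_m | (p.2 < p.1)%N}.
Definition vdim (m : nat) : nat := ((m * (m - 1)) %/ 2)%N.

Lemma card_vpair (m : nat) : #|{: vpair m}| = vdim m.
Proof.
rewrite /vdim subn1 divn2 -bin2 -bin2_sum card_sig -sum1_card.
rewrite (eq_bigl (fun p : 'I_m * 'I_m => xpredT p.1 && (p.2 < p.1)%N)) //.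
rewrite -(pair_big_dep xpredT (fun h k : 'I_m => (k < h)%N) (fun _ _ => 1%N)) /=.
rewrite big_mkord; apply: eq_bigr => h _.
by rewrite (big_ord_narrow (ltnW (ltn_ord h)) (F := fun=> 1%N)) sum1_card card_ord.
Qed.

Section Carnot.
Context {R : realType} {m : nat}.
Local Notation pt := 'cV[R]_(m + vdim m).
Implicit Types (x y : pt) (h : 'I_m) (p : vpair m).

Definition vpair_idx p : 'I_(vdim m) := cast_ord (card_vpair m) (enum_rank p).
Definition idx_vpair (k : 'I_(vdim m)) : vpair m :=
  enum_val (cast_ord (esym (card_vpair m)) k).

(* A point is the column of the v_h followed by the gamma_{h,k}, the latter in
   the order given by [idx_vpair]. *)
Definition hcoord x h : R := x (lshift (vdim m) h) 0.
Definition vcoord x p : R := x (rshift m (vpair_idx p)) 0.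

Definition star x y : pt :=
  col_mx (\col_h (hcoord x h + hcoord y h))
         (\col_i let p := idx_vpair i in let: (h, k) := val p in
            vcoord x p + vcoord y p
            + 2^-1 * (hcoord x h * hcoord y k - hcoord x k * hcoord y h)).

Definition dh h : pt := delta_mx (lshift (vdim m) h) 0.
Definition dv p : pt := delta_mx (rshift m (vpair_idx p)) 0.

Definition X_field h x : pt :=
  dh h + 2^-1 *: (\sum_(p | (val p).2 == h) hcoord x (val p).1 *: dv p)
       - 2^-1 *: (\sum_(p | (val p).1 == h) hcoord x (val p).2 *: dv p).
Definition Gamma_field p x : pt := dv p.

(* Columns: X_1, ..., X_m, then the Gamma_{h,k}. *)
Definition frame x : 'M[R]_(m + vdim m) :=
  row_mx (\matrix_(i, h) X_field h x i 0)
         (\matrix_(i, k) Gamma_field (idx_vpair k) x i 0).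

(* The Riemannian metric for which the Jacobian basis is orthonormal; see
   [frame_orthonormal]. *)
Definition metric x : 'M[R]_(m + vdim m) :=
  (invmx (frame x))^T *m invmx (frame x).

Definition Delta x : set pt :=
  [set v | exists u : 'I_m -> R, v = \sum_h u h *: X_field h x].

Lemma idx_vpairK : cancel idx_vpair vpair_idx.
Proof. by move=> k; rewrite /vpair_idx enum_valK cast_ordKV. Qed.

Lemma vpair_idxK : cancel vpair_idx idx_vpair.
Proof. by move=> p; rewrite /idx_vpair cast_ordK enum_rankK. Qed.

Let X_hE h x i : X_field h x (lshift (vdim m) i) 0 = (i == h)%:R.
Proof.
rewrite !mxE !summxE !big1 ?mulr0 ?subr0 ?addr0.
- by rewrite eqxx andbT (inj_eq (@lshift_inj _ _)).
- by move=> p _; rewrite !mxE eq_lrshift mulr0.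
- by move=> p _; rewrite !mxE eq_lrshift mulr0.
Qed.

Let sum_dv (P : pred (vpair m)) (F : vpair m -> R) p :
  (\sum_(p | P p) F p *: dv p) (rshift m (vpair_idx p)) 0 = F p *+ P p.
Proof.
rewrite summxE (eq_bigr (fun p' => if p' == p then F p else 0)); last first.
  move=> p' _; rewrite !mxE eqxx andbT (inj_eq (@rshift_inj _ _)).
  rewrite (can_eq vpair_idxK) eq_sym.
  by case: eqP => [->|_]; rewrite ?mulr1 ?mulr0.
rewrite -big_mkcondr /=; case: (boolP (P p)) => Pp.
  by rewrite (big_pred1 p) // => p' /=; case: eqP => [->|]; rewrite ?Pp ?andbF.
by rewrite big1 // => p' /andP[Pp' /eqP e]; rewrite -e Pp' in Pp.
Qed.

Let X_vE h x p : X_field h x (rshift m (vpair_idx p)) 0 =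
  2^-1 * (hcoord x (val p).1 *+ ((val p).2 == h))
  - 2^-1 * (hcoord x (val p).2 *+ ((val p).1 == h)).
Proof.
rewrite /X_field; set S1 := \sum_(_ | _) _; set S2 := \sum_(_ | _) _.
rewrite !mxE eq_rlshift add0r.
by rewrite (sum_dv _ (fun p => hcoord x (val p).1)) (sum_dv _ (fun p => hcoord x (val p).2)).
Qed.

Lemma frame_l x i h : frame x i (lshift (vdim m) h) = X_field h x i 0.
Proof. by rewrite row_mxEl mxE. Qed.

Lemma frame_r x i k :
  frame x i (rshift m k) = Gamma_field (idx_vpair k) x i 0.
Proof. by rewrite row_mxEr mxE. Qed.

Let frameE x : frame x = block_mx 1%:M 0 (dlsubmx (frame x)) 1%:M.
Proof.
rewrite -[LHS]submxK; congr (block_mx _ _ _ _);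
  apply/matrixP => i j; rewrite mxE [LHS]mxE.
- by rewrite frame_l X_hE mxE.
- by rewrite frame_r !mxE eq_lrshift.
- by rewrite frame_r !mxE (inj_eq (@rshift_inj _ _)) idx_vpairK eqxx andbT.
Qed.

(* The columns of [frame x] are the derivatives at [0] of the left translation
   by [x] in the coordinate directions: the fields above are left-invariant. *)
Lemma starE x y : star x y = x + frame x *m y.
Proof.
apply/colP => i; rewrite [RHS]mxE.
have yE : y = col_mx (usubmx y) (dsubmx y) by rewrite vsubmxK.
rewrite [in RHS]frameE [in RHS]yE mul_block_col mul0mx addr0 !mul1mx.
case: (split_ordP i) => j ->.
  by rewrite /star !col_mxEu !mxE.
rewrite /star !col_mxEd -[j]idx_vpairK; set p := idx_vpair j.
rewrite !mxE vpair_idxK.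
under eq_bigr => h _.
  rewrite 2![X in X * _]mxE frame_l X_vE [X in _ * X]mxE mulrBl -!mulrA !mulrnAl.
  over.
rewrite big_split /= sumrN -!mulr_sumr.
under eq_bigr do rewrite eq_sym mulrb.
under [X in _ - _ * X]eq_bigr do rewrite eq_sym mulrb.
rewrite -!big_mkcond !big_pred1_eq.
case: (sval p) => h k /=; rewrite /vcoord /hcoord; ring.
Qed.

Lemma frame_unit x : frame x \in unitmx.
Proof.
by rewrite frameE unitmxE det_lblock !det1 mulr1 unitr1.
Qed.

Lemma frame_orthonormal x : orthonormal_basis metric x (frame x).
Proof.
rewrite /orthonormal_basis /metric trmx_inv !mulmxA mulmxV ?unitmx_tr ?frame_unit //.
by rewrite mul1mx mulVmx // frame_unit.
Qed.

(* [x |-> metric x] satisfies the hypotheses of [christoffel_levi_civita]. *)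
Lemma metric_sym x : (metric x)^T = metric x.
Proof. by rewrite /metric trmx_mul trmxK. Qed.

Lemma metric_unit x : metric x \in unitmx.
Proof. by rewrite unitmx_mul unitmx_tr unitmx_inv frame_unit. Qed.

End Carnot.

Definition SO (R : realType) (k : nat) : set 'M[R]_k :=
  [set C | C^T *m C = 1%:M /\ \det C = 1].
Arguments SO : clear implicits.

(* [(y, C)] is the motion [z |-> C z + y]. *)
Definition SE (R : realType) (k : nat) : set ('cV[R]_k * 'M[R]_k) :=
  [set a | SO R k a.2].
Arguments SE : clear implicits.

Section Holonomy.
Context {R : realType} {m : nat}.
Local Notation N := (m + vdim m)%N.
Local Notation pt := 'cV[R]_N.
Variable conn : pt -> 'I_N -> 'M[R]_N.

Definition admissible (c : R -> pt) : Prop :=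
  abs_continuous 0 1 c /\
  ae_itv 0 1 (fun t => exists2 dc : pt,
    is_derive t (1 : R) c dc & Delta (c t) dc).

Definition holonomy_at (x : pt) : set 'M[R]_N :=
  [set P | exists c : R -> pt,
    [/\ admissible c, c 0 = x, c 1 = x & parallel_transport conn c 0 1 P]].

(* The holonomy group in a basis [E] of the tangent space at [x]; [E] will be
   orthonormal, and changing [x] or [E] conjugates the result. *)
Definition holonomy (x : pt) (E : 'M[R]_N) : set 'M[R]_N :=
  [set invmx E *m P *m E | P in holonomy_at x].

(* Q is embedded in [config]; its tangent vectors are elements of [config]. *)
Definition config := (pt * pt * 'M[R]_N)%type.

(* A : T_x G -> R^N is an orientation-preserving linear isometry; the
   coordinate basis and [frame x] define the same orientation. *)
Definition Q : set config :=
  [set q | q.2^T *m q.2 = metric q.1.1 /\ 0 < \det q.2].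

(* [xi] is the lift of [X] at [q = (x, xh; A)]: the derivative at [0] of
   (c t, xh + t A X; A o P_t^0(c)) for a C^1 curve [c] with c(0) = x and
   c'(0) = X. *)
Definition rolling_lift (q : config) (X : pt) (xi : config) : Prop :=
  let: (x, xh, A) := q in
  exists (c : R -> pt) (P : R -> 'M[R]_N),
    [/\ (forall t : R, derivable c t 1) /\ continuous (derive1 c),
        c 0 = x /\ is_derive (0 : R) (1 : R) c X,
        forall t : R, parallel_transport conn c t 0 (P t) &
        is_derive (0 : R) (1 : R)
          (fun t => (c t, xh + t *: (A *m X), A *m P t) : config) xi].

Definition Delta_R (q : config) : set config :=
  [set xi | exists2 X, Delta q.1.1 X & rolling_lift q X xi].

Definition orbit_R (q : config) : set config :=
  [set q1 | exists c : R -> config,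
    [/\ abs_continuous 0 1 c,
        forall t : R, 0 <= t <= 1 -> Q (c t),
        ae_itv 0 1 (fun t => exists2 dc : config,
          is_derive t (1 : R) c dc & Delta_R (c t) dc),
        c 0 = q & c 1 = q1]].

Definition SE_act (a : pt * 'M[R]_N) (q : config) : config :=
  (q.1.1, a.2 *m q.1.2 + a.1, a.2 *m q.2).

Definition fiber (q : config) : set config :=
  [set q1 | Q q1 /\ q1.1.1 = q.1.1].

Definition holonomy_R (q : config) : set (pt * 'M[R]_N) :=
  [set a | SE R N a /\ orbit_R q (SE_act a q)].

(* [holonomy_R q] is the only subset of SE(N) whose orbit through [q] is the
   part of the rolling orbit of [q] above its base point. *)
Lemma holonomy_RP (q : config) (H : set (pt * 'M[R]_N)) :
  Q q -> H `<=` SE R N ->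
  [set SE_act a q | a in H] = orbit_R q `&` fiber q <-> H = holonomy_R q.
Proof.
case: q => -[x xh] A [/= AA dA] HSE.
have Au : A \in unitmx by rewrite unitmxE unitfE gt_eqF.
have orbQ q1 : orbit_R (x, xh, A) q1 -> Q q1.
  by case=> c [_ cQ _ _ <-]; apply: cQ; rewrite ler01 lexx.
have inj a b : SE_act a (x, xh, A) = SE_act b (x, xh, A) -> a = b.
  case: a b => [y C] [z D] [/= yz /(can_inj (mulmxK Au)) CD].
  by move: yz; rewrite CD => /addrI ->.
split=> [HE|->].
  apply/seteqP; split=> [a Ha|a [aSE aO]].
    by split; [exact: HSE|have : [set SE_act a (x, xh, A) | a in H] (SE_act a (x, xh, A))
      by [exists a]; rewrite HE => -[]].
  have : (orbit_R (x, xh, A) `&` fiber (x, xh, A)) (SE_act a (x, xh, A)).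
    by split=> //; split=> //; exact: orbQ.
  by rewrite -HE => -[b Hb /inj <-].
apply/seteqP; split=> [q1 [a [aSE aO] <-]|[[x1 y] B] [qO [qQ /= x1E]]].
  by split=> //; split=> //; exact: orbQ.
rewrite /= in x1E; rewrite {}x1E in qO qQ *.
case: qQ => /= BB dB.
have AdE : \det (B *m invmx A) = 1.
  have d0 : 0 < \det (B *m invmx A) by rewrite det_mulmx det_inv mulr_gt0 ?invr_gt0.
  have : \det B ^+ 2 = \det A ^+ 2.
    by rewrite !expr2 -{1}(det_tr B) -{1}(det_tr A) -!det_mulmx AA BB.
  move/eqP; rewrite eqf_sqr => /orP[/eqP E|/eqP E].
    by rewrite det_mulmx det_inv E mulfV // gt_eqF.
  by move: dB; rewrite E oppr_gt0 ltNge (ltW dA).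
exists (y - B *m invmx A *m xh, B *m invmx A); last first.
  by rewrite /SE_act /= addrC subrK mulmxKV.
split; last by rewrite /SE_act /= addrC subrK mulmxKV.
split=> //=.
rewrite trmx_mul -mulmxA (mulmxA B^T) BB -AA !mulmxA trmx_inv mulVmx ?unitmx_tr //.
by rewrite mul1mx mulmxV.
Qed.

End Holonomy.

Arguments config : clear implicits.

(* Main.v *)
From HB Require Import structures.
Require Import Defs.
From mathcomp Require Import all_boot all_order all_algebra.
From mathcomp Require Import all_classical all_reals all_analysis.
From mathcomp Require Import measurable_realfun.
From mathcomp Require Import ring lra.

Set Implicit Arguments.
Unset Strict Implicit.
Unset Printing Implicit Defensive.

Import Order.TTheory GRing.Theory Num.Theory.
Import numFieldNormedType.Exports.

Local Open Scope classical_set_scope.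
Local Open Scope ring_scope.

(** The proof works in the left-invariant orthonormal frame [frame].  There the
    Levi-Civita connection has constant coefficients: along a curve with velocity
    [frame c *m u] a parallel field with frame components [B] satisfies
    [B' = - conn_form u *m B], where [conn_form u] is skew and depends linearly on
    [u] ([conn_frame], from the Koszul formula).  For the same reason a rolling
    curve [(x, xh; A)] becomes, with [C = A *m frame x], a trajectory of
    the left-invariant control system
    [x' = frame x *m u, xh' = C *m u, C' = C *m conn_form u], [u] horizontal,
    on the product of the Carnot group and SE(N) ([rolling_lift_frame],
    [rolling_lift_line]).  Both holonomy groups are read off this system.

    Rank at least three.  Identify the vector (v, gamma) with the skew matrix
    [psi (v, gamma)] of size 1 + m whose first row is v and whose lower block is
    gamma; dimensions match because 1 + m choose 2 is m + n.  For horizontal [u]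
    the map [conn_form u] becomes, up to the factor - 1 / 2, the bracket with
    [psi u] ([psi_conn_form]).  Horizontal transport is therefore conjugation by
    SO(1 + m), and it preserves the cubic form
    [phi a b d = \tr (psi a *m psi b *m psi d)] ([phi_const]).  Changing the signs
    of two of the X_i is an element of SO(N) that does not preserve [phi] as soon
    as there is a third X_j ([SO_not_phi_preserving]), so neither holonomy group
    is everything.  Constancy of [phi] along absolutely continuous curves rests on
    [ac_deriv_bound], the mean value inequality for such curves.

    Rank two.  It suffices to reach every (0; y, C) with C in SO(3) from the
    identity.  Driving with a constant unit horizontal control e for time T gives
    (T e; T e, R) where R is the rotation of angle T / 2 about e, up to sense
    ([steers_segment]).  At T = 4 pi the rotation disappears.  A product of four
    such elements, arranged as a palindrome so that the vertical parts cancel,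
    gives (r e; r e, 1) for small r, and its powers give it for every real r
    ([reach_translation]).  Cancelling a
    segment by such an element leaves the pure rotations about horizontal axes
    ([reach_rot]), which generate SO(3) by Euler angles ([reach_SO3]).
    Conjugating (r e; r e, 1) by a half turn that reverses e, and undoing the
    motion of the base point, leaves a pure translation ([reach_displace]), and
    rotations carry it to all translations ([reach_full]). *)

(** * Matrix identities and orthogonal matrices *)

Section Matrices.
Context {R : realType}.

Lemma mulmx_ext (p q : nat) (A B : 'M[R]_(p, q)) :
  (forall w : 'cV_q, A *m w = B *m w) -> A = B.
Proof.
move=> H; apply/matrixP => i j.
have := H (delta_mx j 0) => /matrixP/(_ i 0); rewrite -!colE !mxE.
by [].
Qed.

(** The metric is [G^T *m G] with [G] the coframe; this moves the identity for
    d g along a direction from coordinates to the frame. *)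
Lemma gram_conj (k : nat) (c G F : 'M[R]_k) : G *m F = 1%:M ->
  F^T *m (c^T *m (G^T *m G) + (G^T *m G) *m c) *m F = (G *m c *m F)^T + G *m c *m F.
Proof.
move=> GF; have FG : F^T *m G^T = 1%:M by rewrite -trmx_mul GF trmx1.
rewrite mulmxDr mulmxDl !trmx_mul; congr (_ + _).
  by rewrite -!mulmxA GF mulmx1.
by rewrite !mulmxA FG mul1mx.
Qed.

(** The companion of [gram_conj] for the derivative of [G^T *m G]. *)
Lemma gram_conj_deriv (k : nat) (b G F : 'M[R]_k) : G *m F = 1%:M ->
  F^T *m (b^T *m G + G^T *m b) *m F = (b *m F)^T + b *m F.
Proof.
move=> GF; have FG : F^T *m G^T = 1%:M by rewrite -trmx_mul GF trmx1.
rewrite mulmxDr mulmxDl !trmx_mul; congr (_ + _).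
  by rewrite -!mulmxA GF mulmx1.
by rewrite !mulmxA FG mul1mx.
Qed.

Lemma mulmx_tr_ext n (A : 'M[R]_n) :
  (forall a b : 'cV_n, (A *m a)^T *m (A *m b) = a^T *m b) -> A^T *m A = 1%:M.
Proof.
move=> H; apply: mulmx_ext => b; rewrite mul1mx; apply: trmx_inj; apply: mulmx_ext => a.
by rewrite -[LHS]trmxK -[RHS]trmxK; congr trmx; rewrite !trmx_mul !trmxK -(H a b) trmx_mul !mulmxA.
Qed.

Lemma orthogonal_det n (A : 'M[R]_n) : A^T *m A = 1%:M -> \det A = 1 \/ \det A = -1.
Proof.
move=> /(congr1 determinant); rewrite det_mulmx det_tr det1 -expr2 => /eqP.
by rewrite sqrf_eq1 => /orP[] /eqP; [left|right].
Qed.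

Lemma SO_mul n (A B : 'M[R]_n) : SO R n A -> SO R n B -> SO R n (A *m B).
Proof.
move=> [AA dA] [BB dB]; split; last by rewrite det_mulmx dA dB mulr1.
by rewrite trmx_mul mulmxA -(mulmxA B^T) AA mulmx1.
Qed.

Lemma SO_tr n (A : 'M[R]_n) : SO R n A -> SO R n A^T.
Proof.
move=> [AA dA]; split; last by rewrite det_tr.
by rewrite trmxK; exact: mulmx1C.
Qed.

Lemma SO_conj n (O A : 'M[R]_n) : O^T *m O = 1%:M -> SO R n A -> SO R n (O^T *m A *m O).
Proof.
move=> OO [AA dA]; have OO' := mulmx1C OO; split.
  by rewrite !trmx_mul trmxK !mulmxA -(mulmxA _ O) OO' mulmx1 -(mulmxA _ A^T) AA mulmx1.
by rewrite !det_mulmx dA mulr1 -det_mulmx OO det1.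
Qed.

Lemma orth_conj_inj n (O A B : 'M[R]_n) : O^T *m O = 1%:M ->
  O^T *m A *m O = O^T *m B *m O -> A = B.
Proof.
move=> /mulmx1C OO /(congr1 (fun M => O *m M *m O^T)).
by rewrite !mulmxA OO !mul1mx -!mulmxA OO !mulmx1.
Qed.

Lemma orth_conj_act n (C S : 'M[R]_n) (w : 'cV[R]_n) : C^T *m C = 1%:M -> S^T = S ->
  (C *m S *m C^T *m C)^T *m (C *m w) = S *m w.
Proof.
move=> CC ST; rewrite -(mulmxA _ C^T) CC mulmx1 trmx_mul ST -mulmxA (mulmxA C^T).
by rewrite CC mul1mx.
Qed.

Lemma orth_conjK n (O S : 'M[R]_n) : O^T *m O = 1%:M -> O^T *m (O *m S *m O^T) *m O = S.
Proof. by move=> OO; rewrite !mulmxA OO mul1mx -mulmxA OO mulmx1. Qed.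

End Matrices.

(** * Derivatives of curves *)

Section Deriv.
Context {R : realType}.

(** The quantitative form of differentiability, which makes pairs, gluing and
    the estimates of parallel transport elementary. *)
Lemma is_deriveP (V : normedModType R) (f : R -> V) (t : R) (d : V) :
  is_derive t (1 : R) f d <->
  forall e, 0 < e -> exists2 r, 0 < r & forall h, `|h| < r ->
    `|f (t + h) - f t - h *: d| <= e * `|h|.
Proof.
have key : is_derive t (1 : R) f d <-> (h^-1 *: (f (h + t) - f t) @[h --> 0^'] --> d).
  have E : (fun h => h^-1 *: (f (h + t) - f t)) = (fun h => h^-1 *: (f (h *: (1 : R) + t) - f t)).
    by apply/funext => h; rewrite /GRing.scale /= mulr1.
  split.
    case=> dv <-; rewrite E; exact: dv.
  rewrite E => H; split; first by apply/cvg_ex; exists d.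
  exact: (cvg_lim _ H).
rewrite key; split.
  move=> /cvgrPdist_le H e e0; have := H e e0.
  rewrite near_withinE => /nbhs_ballP[r /= r0 Hr].
  exists r => // h hr; have [->|h0] := eqVneq h 0.
    by rewrite addr0 subrr scale0r subrr !normr0 mulr0.
  have := Hr h; rewrite /ball /= sub0r normrN => /(_ hr h0).
  rewrite -ler_pdivrMr ?normr_gt0 // mulrC -normfV -normrZ.
  by rewrite (scalerBr _ (_ - _)) scalerA mulVf // scale1r distrC (addrC t).
move=> H; apply/cvgrPdist_le => e e0; have [r r0 Hr] := H e e0.
rewrite near_withinE; apply/nbhs_ballP; exists r => //= h.
rewrite /ball /= sub0r normrN => hr h0.
have := Hr h hr; rewrite -ler_pdivrMr ?normr_gt0 // mulrC -normfV -normrZ.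
by rewrite (scalerBr _ (_ - _)) scalerA mulVf // scale1r distrC (addrC h).
Qed.

Lemma is_derive_unique (V : normedModType R) (f : R -> V) t (d d' : V) :
  is_derive t (1 : R) f d -> is_derive t (1 : R) f d' -> d = d'.
Proof. by move=> [_ <-] [_ <-]. Qed.

Lemma is_derive_near (V : normedModType R) (f g : R -> V) t (d : V) r : 0 < r ->
  (forall h, `|h| < r -> f (t + h) = g (t + h)) ->
  is_derive t (1 : R) f d -> is_derive t (1 : R) g d.
Proof.
move=> r0 fg /is_deriveP H; apply/is_deriveP => e /H[r' r'0 Hr].
exists (Num.min r r'); first by rewrite lt_min r0.
move=> h; rewrite lt_min => /andP[h1 h2].
have <- : f t = g t by have := fg 0; rewrite normr0 addr0 => ->.
by rewrite -fg //; exact: Hr.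
Qed.

Lemma is_derive_mx m n (M : R -> 'M[R]_(m, n)) t (D : 'M[R]_(m, n)) :
  is_derive t (1 : R) M D <->
  forall i j, is_derive t (1 : R) (fun s => M s i j) (D i j).
Proof.
split=> [[dM <-] i j|H].
  have /derivable_mxP H := dM.
  by split; [exact: H|rewrite derive_mx // mxE].
have dM : derivable M t 1 by apply/derivable_mxP => i j; have [] := H i j.
split => //; rewrite derive_mx //; apply/matrixP => i j; rewrite mxE.
by have [] := H i j.
Qed.

Lemma is_derive_pairP (U V : normedModType R) (f : R -> U) (g : R -> V) t (u : U) (v : V) :
  is_derive t (1 : R) (fun s => (f s, g s)) (u, v) <->
  is_derive t (1 : R) f u /\ is_derive t (1 : R) g v.
Proof.
rewrite !is_deriveP; split=> [H|[H1 H2] e e0].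
  split=> e e0; have [r r0 Hr] := H e e0; exists r => // h /Hr;
    by rewrite /= prod_normE /= ge_max => /andP[].
have [r r0 Hr] := H1 e e0; have [r' r'0 Hr'] := H2 e e0.
exists (Num.min r r'); first by rewrite lt_min r0.
move=> h; rewrite lt_min => /andP[h1 h2].
by rewrite /= prod_normE /= ge_max Hr ?Hr'.
Qed.

Lemma is_derive_mulmx m n p (A : R -> 'M[R]_(m, n)) (B : R -> 'M[R]_(n, p)) t dA dB :
  is_derive t (1 : R) A dA -> is_derive t (1 : R) B dB ->
  is_derive t (1 : R) (fun s => A s *m B s) (dA *m B t + A t *m dB).
Proof.
move=> /is_derive_mx HA /is_derive_mx HB; apply/is_derive_mx => i j.
have -> : (fun s => (A s *m B s) i j) = \sum_k ((fun s => A s i k) * (fun s => B s k j)).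
  by apply/funext => s; rewrite mxE fct_sumE.
apply: is_derive_eq.
rewrite !mxE -big_split /=; apply: eq_bigr => k _.
by rewrite /GRing.scale /= addrC [dA i k * _]mulrC.
Qed.

Lemma is_derive_trmx m n (A : R -> 'M[R]_(m, n)) t dA :
  is_derive t (1 : R) A dA -> is_derive t (1 : R) (fun s => (A s)^T) dA^T.
Proof.
move=> /is_derive_mx HA; apply/is_derive_mx => i j; rewrite mxE.
by have := HA j i; under [X in _ -> is_derive _ _ X _]eq_fun do rewrite mxE.
Qed.

Lemma is_derive_line (V : normedModType R) (f : R -> V) (a b t : R) d :
  is_derive (a * t + b) (1 : R) f d -> is_derive t (1 : R) (fun s => f (a * s + b)) (a *: d).
Proof.
have [->|a0] := eqVneq a 0.
  by move=> _; rewrite scale0r; under eq_fun do rewrite mul0r add0r; exact: is_derive_cst.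
move=> /is_deriveP H; apply/is_deriveP => e e0.
have [|r r0 Hr] := H (e / `|a|); first by rewrite divr_gt0 ?normr_gt0.
exists (r / `|a|); first by rewrite divr_gt0 ?normr_gt0.
move=> h; rewrite ltr_pdivlMr ?normr_gt0 // mulrC -normrM => /Hr.
rewrite normrM mulrA divfK ?normr_eq0 // scalerA [h * a]mulrC.
by rewrite mulrDr (addrAC (a * t)).
Qed.

Lemma is_derive_add (V : normedModType R) (f g : R -> V) t d d' :
  is_derive t (1 : R) f d -> is_derive t (1 : R) g d' ->
  is_derive t (1 : R) (fun s => f s + g s) (d + d').
Proof. exact: is_deriveD. Qed.

Lemma is_derive_scale (V : normedModType R) (f : R -> V) k t d :
  is_derive t (1 : R) f d -> is_derive t (1 : R) (fun s => k *: f s) (k *: d).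
Proof. exact: is_deriveZ. Qed.

Lemma is_derive_affine (V : normedModType R) (z v : V) (k r : R) :
  is_derive r (1 : R) (fun q => z + (k * q) *: v) (k *: v).
Proof.
apply/is_deriveP => d d0; exists 1 => // h _.
rewrite opprD addrACA subrr add0r -scalerBl scalerA -scalerBl.
have -> : k * (r + h) - k * r - h * k = 0 by ring.
by rewrite scale0r normr0 mulr_ge0 // ltW.
Qed.

Lemma is_derive_fst_snd (U V : normedModType R) (f : R -> U * V) t d :
  is_derive t (1 : R) f d ->
  is_derive t (1 : R) (fun s => (f s).1) d.1 /\ is_derive t (1 : R) (fun s => (f s).2) d.2.
Proof.
move=> H; apply/is_derive_pairP; rewrite -surjective_pairing.
have -> // : (fun s => ((f s).1, (f s).2)) = f.
by apply/funext => s; rewrite -surjective_pairing.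
Qed.

Lemma is_derive_fst (U V : normedModType R) (f : R -> U * V) t d :
  is_derive t (1 : R) f d -> is_derive t (1 : R) (fun s => (f s).1) d.1.
Proof. by case/is_derive_fst_snd. Qed.

Lemma is_derive_snd (U V : normedModType R) (f : R -> U * V) t d :
  is_derive t (1 : R) f d -> is_derive t (1 : R) (fun s => (f s).2) d.2.
Proof. by case/is_derive_fst_snd. Qed.

Lemma derive_along (V W : normedModType R) (f : V -> W) (x v : V) (d : W) :
  is_derive (0 : R) (1 : R) (fun h => f (x + h *: v)) d -> 'D_v f x = d.
Proof.
case=> _ <-; rewrite /derive.
set F := (X in lim (X @ _) = _); set G := (X in _ = lim (X @ _)).
suff -> : F = G by [].
apply/funext => h; rewrite /F /G /= addr0 scale0r addr0.
by rewrite {1}[h%:A]mulr1 [h *: v + x]addrC.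
Qed.

Lemma lipschitz_deriv (f df : R -> R) K : (forall x, is_derive x (1 : R) f (df x)) ->
  (forall x, `|df x| <= K) -> forall a b, `|f b - f a| <= K * `|b - a|.
Proof.
move=> fd dfK a b; wlog ab : a b / a <= b => [H|].
  have [|ba] := leP a b; first exact: H.
  by rewrite distrC [`|b - a|]distrC H // ltW.
have cf : {within `[a, b], continuous f}.
  apply: continuous_subspaceT => x; apply: differentiable_continuous.
  by apply/derivable1_diffP; have [] := fd x.
have [z _ ->] := MVT_segment ab (fun x _ => fd x) cf.
by rewrite normrM ler_wpM2r.
Qed.

End Deriv.

(** * Absolutely continuous curves are controlled by their derivative *)

Section AC.
Context {R : realType}.

(** A continuous induction (Cousin's lemma): the local step may be chosen
    depending on the point, as for a gauge. *)
Lemma interval_induction (a b : R) (S : R -> Prop) : a <= b -> S a ->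
  (forall x, a <= x <= b -> exists2 r, 0 < r &
     forall p q, a <= p <= x -> x <= q <= b -> x - r < p -> q < x + r -> S p -> S q) ->
  S b.
Proof.
move=> ab Sa H; pose E := [set t | a <= t <= b /\ S t].
have Ea : E a by rewrite /E /= lexx ab.
have supE : has_sup E by split; [exists a|exists b => t [/andP[]]].
have cab : a <= sup E <= b.
  by rewrite sup_upper_bound //= ge_sup //; [exists a|move=> t [/andP[]]].
have [r r0 Hr] := H _ cab.
have [p [/andP[ap pb] Sp] Ep] := sup_adherent r0 supE.
have pE : p <= sup E by apply: sup_upper_bound => //; split=> //; rewrite ap.
have [q [qE qb qr Hq]] : exists q, [/\ sup E <= q, q <= b, q < sup E + r &
    sup E < q \/ q = b].
  exists (Num.min b (sup E + r / 2)); rewrite le_min ge_min gt_min lexx /=.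
  have r2 : 0 < r / 2 by rewrite divr_gt0.
  rewrite (andP cab).2 lerDl ltW // ltrD2l ltr_pdivrMr // ltr_pMr // ltr1n orbT.
  split=> //; case: (ltP b (sup E + r / 2)) => [|_]; first by right.
  by left; rewrite ltrDl.
have Sq : S q by apply: (Hr p q) => //; [rewrite ap|rewrite qE].
case: Hq => [cq|<- //].
suff : q <= sup E by rewrite leNgt cq.
by apply: sup_upper_bound => //; split=> //; rewrite qb (le_trans (andP cab).1).
Qed.

Context {V : normedModType R}.

(** The mean value inequality when the derivative exists only almost everywhere.
    The exceptional null set is covered by an open set of small measure.  Going
    from [a] to [b] by [interval_induction], a step around a point where the
    derivative exists costs at most (K + e) times its length, and the steps around
    the other points are intervals inside the open set, so their total cost is
    small by absolute continuity. *)
Lemma ac_deriv_bound (a b K : R) (f : R -> V) : 0 <= K -> a <= b -> abs_continuous a b f ->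
  ae_itv a b (fun t => exists2 d, is_derive t (1 : R) f d & `|d| <= K) ->
  `|f b - f a| <= K * (b - a).
Proof.
move=> K0 ab acf [D [mD D0 sD]].
have [|ba] := leP (b - a) 0.
  rewrite subr_le0 => ba; have -> : a = b by apply/eqP; rewrite eq_le ab.
  by rewrite !subrr normr0 mulr0.
suff main e : 0 < e -> `|f b - f a| <= (K + e) * (b - a) + e.
  apply/ler_addgt0Pr => e e0.
  have c0 : 0 < b - a + 1 by rewrite addr_gt0.
  have := main (e / (b - a + 1)); rewrite divr_gt0 // => /(_ isT)/le_trans; apply.
  by rewrite mulrDl -addrA -[X in _ + (_ + X)]mulr1 -mulrDr divfK ?gt_eqF.
move=> e0; have [d d0 Hd] := acf e e0.
pose mu : {measure set (measurableTypeR R) -> \bar R} := @lebesgue_measure R.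
have {}D0 : mu D = 0%E := D0.
have [|U [oU DU Ud]] := lebesgue_regularity_outer mD _ d0; first by rewrite [X in (X < _)%E]D0 ltry.
have mU : measurable U by exact: measurable_realfun.open_measurable.
have muU : (mu U < d%:E)%E.
  rewrite (measureDI mu mU mD) [X in (_ + X)%E](_ : _ = 0%E) ?adde0 //.
  by apply/eqP; rewrite -measure_le0 -D0 measureIr.
(* [g t] is the measure of the part of [U] already passed: the budget for the
   intervals collected in [S]. *)
pose W t := U `&` `]a, t]%classic.
have mW t : measurable (W t) by apply: measurableI => //; exact: measurable_itv.
have muW t : (mu (W t) <= mu U)%E by apply: measureIl => //; exact: measurable_itv.
have finW t : mu (W t) \is a fin_num.
  by rewrite ge0_fin_numE // (le_lt_trans (muW t)) // (lt_trans muU) // ltry.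
pose g t := fine (mu (W t)).
have gd t : g t < d by rewrite -lte_fin fineK // (le_lt_trans (muW t)).
have gmono p q : p <= q -> g p <= g q.
  move=> pq; rewrite fine_le // le_measure ?inE //; try exact: mW.
  move=> x [Ux] xp; split=> //; move: xp; rewrite /= !in_itv /= => /andP[-> xp].
  exact: le_trans xp pq.
have gU p q : a <= p -> p <= q -> (forall x, p < x <= q -> U x) -> g p + (q - p) <= g q.
  move=> ap pq pqU; rewrite -lee_fin EFinD !fineK //.
  have -> : (q - p)%:E = mu `]p, q]%classic.
    apply: esym; apply: (etrans (lebesgue_measure_itv _)); rewrite /= lte_fin EFinB.
    by have [//|qp] := ltP p q; rewrite (le_anti (_ : p <= q <= p)) ?subee ?pq.
  rewrite -measureU; [|exact: mW|exact: measurable_itv|]; last first.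
    apply/seteqP; split=> // x [[_]] /=; rewrite !in_itv /= => /andP[_ xp] /andP[].
    by rewrite ltNge xp.
  apply: le_measure; rewrite ?inE; [|exact: mW|].
    by apply: measurableU; [exact: mW|exact: measurable_itv].
  move=> x [[Ux]|] /=; rewrite !in_itv /=; rewrite /W /= ?in_itv /=.
    by move=> /andP[-> xp]; split=> //; exact: le_trans xp pq.
  by move=> /andP[px xq]; split; [apply: pqU; rewrite px|rewrite (le_lt_trans ap px)].
have g0 : 0 <= g a by apply: fine_ge0.
pose S t := exists s : seq (R * R),
  [/\ all (fun I => [&& a <= I.1, I.1 <= I.2 & I.2 <= t]) s,
      pairwise (fun I J => (I.2 <= J.1) || (J.2 <= I.1)) s,
      \sum_(I <- s) (I.2 - I.1) <= g t &
      `|f t - f a| <= (K + e) * (t - a) + \sum_(I <- s) `|f I.2 - f I.1| ].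
suff [s [s1 s2 s3 s4]] : S b.
  apply: (le_trans s4); rewrite lerD2l ltW //; apply: Hd => //.
  exact: le_lt_trans s3 (gd b).
apply: (@interval_induction a b S) => //.
  by exists [::]; split=> //; rewrite ?big_nil // !subrr normr0 mulr0 addr0.
move=> x /andP[ax xb]; have [Ux|Ux] := pselect (U x).
  have /nbhs_ballP[r /= r0 Hr] := open_nbhs_nbhs (conj oU Ux).
  exists r => // p q /andP[ap px] /andP[xq qb] pr qr [s [s1 s2 s3 s4]].
  have pq : p <= q by exact: le_trans px xq.
  exists ((p, q) :: s); split.
  - rewrite /= ap pq lexx /=; apply: sub_all s1 => I /and3P[-> -> /le_trans] /=; exact.
  - rewrite /= s2 andbT; apply: sub_all s1 => I /and3P[_ _ ->]; exact: orbT.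
  - rewrite big_cons /= addrC; apply: le_trans (gU _ _ ap pq _); first by rewrite lerD2r.
    move=> y /andP[py yq]; apply: Hr; rewrite /ball /= ltr_distlC.
    by rewrite (lt_trans pr py) (le_lt_trans yq qr).
  - rewrite big_cons /= addrCA; have -> : f q - f a = f q - f p + (f p - f a) by rewrite subrKA.
    apply: (le_trans (ler_normD _ _)); rewrite lerD2l; apply: (le_trans s4).
    by rewrite lerD2r ler_wpM2l ?lerD2r // addr_ge0 // ltW.
have [df /is_deriveP/(_ e e0)[r r0 Hr] dfK] : exists2 df, is_derive x (1 : R) f df & `|df| <= K.
  by apply: contra_notP Ux => nP; apply: DU; apply: sD => /= H; apply: nP; apply: H; rewrite ax.
exists r => // p q /andP[ap px] /andP[xq qb] pr qr [s [s1 s2 s3 s4]].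
have pq : p <= q by exact: le_trans px xq.
exists s; split=> //.
- by apply: sub_all s1 => I /and3P[-> -> /le_trans] /=; exact.
- exact: le_trans s3 (gmono _ _ pq).
have -> : f q - f a = f q - f p + (f p - f a) by rewrite subrKA.
apply: (le_trans (ler_normD _ _)).
suff fqp : `|f q - f p| <= (K + e) * (q - p).
  apply: (le_trans (lerD fqp s4)); rewrite addrA lerD2r -mulrDr.
  by rewrite subrKA.
have Hq : `|f q - f x - (q - x) *: df| <= e * (q - x).
  have := Hr (q - x); rewrite subrKC ger0_norm ?subr_ge0 //; apply.
  by rewrite ltrBlDl.
have Hp : `|f p - f x - (p - x) *: df| <= e * (x - p).
  have := Hr (p - x); rewrite subrKC ler0_norm ?subr_le0 // opprB; apply.
  by rewrite ltrBlDr -ltrBlDl.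
have -> : f q - f p = (f q - f x - (q - x) *: df) - (f p - f x - (p - x) *: df) + (q - p) *: df.
  have -> : (q - p) *: df = (q - x) *: df - (p - x) *: df.
    by rewrite -scalerBl opprB subrKA.
  by rewrite opprB -[RHS]addrA [X in _ = _ + X]addrC !subrKA opprB subrKA.
apply: (le_trans (ler_normD _ _)); apply: (le_trans (lerD (ler_normB _ _) (lexx _))).
apply: (le_trans (lerD (lerD Hq Hp) (lexx _))).
rewrite normrZ ger0_norm ?subr_ge0 // -mulrDr subrKA [leRHS]mulrDl [leLHS]addrC lerD2r [leLHS]mulrC.
by rewrite ler_wpM2r // subr_ge0.
Qed.

End AC.

(** * Absolute continuity is preserved by the usual operations *)

Section AC2.
Context {R : realType}.

Lemma ac_id (a b : R) : abs_continuous a b (id : R -> R).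
Proof.
move=> e e0; exists e => // s Hs _; rewrite big_seq [in X in _ -> X]big_seq.
congr (_ < _); apply: eq_bigr => I Is; rewrite ger0_norm // subr_ge0.
by have /and3P[] := allP Hs _ Is.
Qed.

(** The source of the closure properties below: a curve is absolutely continuous
    when its increments are dominated by those of absolutely continuous curves. *)
Lemma ac_dominated (U V W : normedModType R) (a b K : R) (f : R -> U) (g : R -> V) (h : R -> W) :
  abs_continuous a b g -> abs_continuous a b h ->
  (forall s t, a <= s -> s <= t -> t <= b ->
     `|f t - f s| <= K * (`|g t - g s| + `|h t - h s|)) ->
  abs_continuous a b f.
Proof.
move=> acg ach H e e0.
pose L := Num.max K 1; have L0 : 0 < L by rewrite lt_max ltr01 orbT.
have e2 : 0 < e / (L * 2) by rewrite divr_gt0 // mulr_gt0.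
have [d d0 Hd] := acg _ e2; have [d' d'0 Hd'] := ach _ e2.
exists (Num.min d d'); first by rewrite lt_min d0.
move=> s s1 s2; rewrite lt_min => /andP[sd sd'].
have -> : e = L * (e / (L * 2) + e / (L * 2)).
  by field; rewrite gt_eqF.
have key : L * (\sum_(I <- s) `|g I.2 - g I.1| + \sum_(I <- s) `|h I.2 - h I.1|) <
    L * (e / (L * 2) + e / (L * 2)).
  by rewrite ltr_pM2l //; apply: ltrD; [exact: Hd|exact: Hd'].
apply: le_lt_trans key.
rewrite -big_split /= mulr_sumr big_seq [leRHS]big_seq; apply: ler_sum => I Is.
have /and3P[H1 H2 H3] := allP s1 _ Is.
apply: le_trans (H _ _ H1 H2 H3) _.
by rewrite ler_wpM2r ?addr_ge0 // /L le_max lexx.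
Qed.

Lemma ac_dominated1 (U V : normedModType R) (a b K : R) (f : R -> U) (g : R -> V) :
  abs_continuous a b g ->
  (forall s t, a <= s -> s <= t -> t <= b -> `|f t - f s| <= K * `|g t - g s|) ->
  abs_continuous a b f.
Proof.
move=> acg H; apply: (ac_dominated (K := K) acg (fun e e0 => _) (h := fun=> (0 : R))) => [e e0|s t as_ st tb].
  by exists 1 => // s _ _ _; rewrite big1 // => I _; rewrite subrr normr0.
by rewrite subrr normr0 addr0; exact: H.
Qed.

Lemma ac_lipschitz (U : normedModType R) (a b K : R) (f : R -> U) :
  (forall s t, a <= s -> s <= t -> t <= b -> `|f t - f s| <= K * (t - s)) ->
  abs_continuous a b f.
Proof.
move=> H; apply: (ac_dominated1 (K := K) (@ac_id a b)) => s t as_ st tb.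
by rewrite ger0_norm ?subr_ge0 //; exact: H.
Qed.

Lemma ac_itv (U : normedModType R) (a b a' b' : R) (f : R -> U) :
  a <= a' -> b' <= b -> abs_continuous a b f -> abs_continuous a' b' f.
Proof.
move=> aa bb acf e /acf[d d0 Hd]; exists d => // s s1; apply: Hd.
apply: sub_all s1 => I /and3P[H1 -> H2]; rewrite (le_trans aa H1).
exact: le_trans H2 bb.
Qed.

(** Finitely many steps of length at most [d / 2] cover the interval, and each
    changes the curve by at most 1. *)
Lemma ac_bounded (U : normedModType R) (a b : R) (f : R -> U) :
  abs_continuous a b f ->
  exists2 K, 0 <= K & forall t, a <= t <= b -> `|f t| <= K.
Proof.
move=> acf; have [d d0 Hd] := acf 1 ltr01.
have step s t : a <= s -> s <= t -> t <= b -> t - s < d -> `|f t - f s| <= 1.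
  move=> as_ st tb std; have := Hd [:: (s, t)].
  by rewrite /= as_ st tb !big_seq1 /= => /(_ isT isT std)/ltW.
pose r := d / 2; have r0 : 0 < r by rewrite divr_gt0.
have rd : r < d by rewrite ltr_pdivrMr // ltr_pMr // ltr1n.
have main n : forall t, a <= t <= b -> t <= a + r * n%:R -> `|f t| <= `|f a| + n%:R.
  elim: n => [|n IH] t /andP[at_ tb].
    rewrite mulr0 !addr0 => ta; suff -> : t = a by [].
    by apply/eqP; rewrite eq_le ta.
  move=> tn; pose s := Num.max a (t - r).
  have [sa st] : a <= s /\ s <= t by rewrite /s le_max lexx ge_max at_ gerBl (ltW r0).
  have Hs : `|f s| <= `|f a| + n%:R.
    apply: IH; first by rewrite sa (le_trans st tb).
    have rn : 0 <= r * n%:R by rewrite mulr_ge0 // ltW.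
    rewrite /s ge_max lerDl rn /= lerBlDr -addrA.
    by apply: (le_trans tn); rewrite -natr1 mulrDr mulr1.
  have := step s t sa st tb; rewrite ltrBlDr -ltrBlDl.
  have -> : t - d < s by rewrite /s lt_max ler_ltD ?ltrN2 // orbT.
  move=> /(_ isT) ts; rewrite -natr1 addrA -[f t](subrK (f s)) addrC.
  apply: le_trans (ler_normD _ _) _; exact: lerD.
exists (`|f a| + (Num.bound `|(b - a) / r|)%:R) => [|t tab].
  by rewrite addr_ge0.
apply: main => //; apply: le_trans (andP tab).2 _.
rewrite -lerBlDl mulrC -ler_pdivrMr //; apply: ltW.
exact: le_lt_trans (ler_norm _) (archi_boundP (normr_ge0 _)).
Qed.

Lemma ac_lin (U V : normedModType R) (a b K : R) (f : R -> U) (L : {linear U -> V}) :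
  (forall x, `|L x| <= K * `|x|) -> abs_continuous a b f ->
  abs_continuous a b (fun t => L (f t)).
Proof.
by move=> LK acf; apply: (ac_dominated1 (K := K) acf) => s t _ _ _; rewrite -linearB.
Qed.

Lemma ac_pair (U V : normedModType R) (a b : R) (f : R -> U) (g : R -> V) :
  abs_continuous a b f -> abs_continuous a b g ->
  abs_continuous a b (fun t => (f t, g t)).
Proof.
move=> acf acg; apply: (ac_dominated (K := 1) acf acg) => s t _ _ _.
by rewrite mul1r prod_normE /= ge_max lerDl lerDr !normr_ge0.
Qed.

Lemma ac_fst (U V : normedModType R) (a b : R) (f : R -> U * V) :
  abs_continuous a b f -> abs_continuous a b (fun t => (f t).1).
Proof.
move=> acf; apply: (ac_dominated1 (K := 1) acf) => s t _ _ _.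
by rewrite mul1r prod_normE /= le_max lexx.
Qed.

Lemma ac_snd (U V : normedModType R) (a b : R) (f : R -> U * V) :
  abs_continuous a b f -> abs_continuous a b (fun t => (f t).2).
Proof.
move=> acf; apply: (ac_dominated1 (K := 1) acf) => s t _ _ _.
by rewrite mul1r prod_normE /= le_max lexx orbT.
Qed.

Lemma ac_add (U : normedModType R) (a b : R) (f g : R -> U) :
  abs_continuous a b f -> abs_continuous a b g ->
  abs_continuous a b (fun t => f t + g t).
Proof.
move=> acf acg; apply: (ac_dominated (K := 1) acf acg) => s t _ _ _.
by rewrite mul1r opprD addrACA ler_normD.
Qed.

Lemma ac_cst (U : normedModType R) (a b : R) (x : U) :
  abs_continuous a b (fun=> x).
Proof.
by apply: (ac_lipschitz (K := 0)) => s t _ _ _; rewrite subrr normr0 mul0r.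
Qed.

Lemma mx_norm_entry m n (A : 'M[R]_(m, n)) i j : `|A i j| <= `|A|.
Proof.
by rewrite [leRHS]/Num.norm /= mx_normrE (le_bigmax _ (fun ij : 'I_m * 'I_n => `|A ij.1 ij.2|) (i, j)).
Qed.

Lemma mx_norm_le m n (A : 'M[R]_(m, n)) K : 0 <= K ->
  (forall i j, `|A i j| <= K) -> `|A| <= K.
Proof.
move=> K0 H; rewrite /Num.norm /= mx_normrE; apply/bigmax_leP; split=> // ij _; exact: H.
Qed.

Lemma mx_norm_mul m n p (A : 'M[R]_(m, n)) (B : 'M[R]_(n, p)) :
  `|A *m B| <= n%:R * (`|A| * `|B|).
Proof.
apply: mx_norm_le => [|i j]; first by rewrite !mulr_ge0.
rewrite mxE; apply: le_trans (ler_norm_sum _ _ _) _.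
have -> : n%:R * (`|A| * `|B|) = \sum_(k < n) (`|A| * `|B|).
  by rewrite sumr_const card_ord mulr_natl.
by apply: ler_sum => k _; rewrite normrM ler_pM // mx_norm_entry.
Qed.

Lemma mx_norm_tr m n (A : 'M[R]_(m, n)) : `|A^T| <= `|A|.
Proof. by apply: mx_norm_le => // i j; rewrite mxE mx_norm_entry. Qed.

Lemma ac_mulmx m n p (a b : R) (A : R -> 'M[R]_(m, n)) (B : R -> 'M[R]_(n, p)) :
  abs_continuous a b A -> abs_continuous a b B ->
  abs_continuous a b (fun t => A t *m B t).
Proof.
move=> acA acB; have [K K0 HK] := ac_bounded acA; have [L L0 HL] := ac_bounded acB.
apply: (ac_dominated (K := n%:R * (K + L)) acA acB) => s t as_ st tb.
have -> : A t *m B t - A s *m B s = A t *m (B t - B s) + (A t - A s) *m B s.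
  by rewrite mulmxBr mulmxBl subrKA.
apply: le_trans (ler_normD _ _) _.
apply: le_trans (lerD (mx_norm_mul _ _) (mx_norm_mul _ _)) _.
rewrite -mulrDr -mulrA ler_wpM2l //.
have At : `|A t| <= K by rewrite HK // tb (le_trans as_ st).
have Bs : `|B s| <= L by rewrite HL // as_ (le_trans st tb).
have a0 := normr_ge0 (A t - A s); have b0 := normr_ge0 (B t - B s).
apply: le_trans (lerD (ler_wpM2r b0 At) (ler_wpM2l a0 Bs)) _.
by move: `|A t - A s| `|B t - B s| a0 b0 => u v u0 v0; nra.
Qed.

Lemma ac_trmx m n (a b : R) (A : R -> 'M[R]_(m, n)) :
  abs_continuous a b A -> abs_continuous a b (fun t => (A t)^T).
Proof.
move=> acA; apply: (ac_dominated1 (K := 1) acA) => s t _ _ _.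
by rewrite mul1r -linearB mx_norm_tr.
Qed.

Lemma ac_entry m n (a b : R) (A : R -> 'M[R]_(m, n)) i j :
  abs_continuous a b A -> abs_continuous a b (fun t => A t i j).
Proof.
move=> acA; apply: (ac_dominated1 (K := 1) acA) => s t _ _ _.
by have := mx_norm_entry (A t - A s) i j; rewrite !mxE mul1r.
Qed.

Lemma ac_sum (V : normedModType R) (I : Type) (r : seq I) (a b : R) (F : I -> R -> V) :
  (forall i, abs_continuous a b (F i)) -> abs_continuous a b (fun t => \sum_(i <- r) F i t).
Proof.
move=> HF; elim: r => [|i r IH].
  by under eq_fun do rewrite big_nil; exact: ac_cst.
by under eq_fun do rewrite big_cons; exact: (ac_add (HF i) IH).
Qed.

Lemma ac_mx m n (a b : R) (A : R -> 'M[R]_(m, n)) :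
  (forall i j, abs_continuous a b (fun t => A t i j)) -> abs_continuous a b A.
Proof.
move=> acA; have acS : abs_continuous a b (fun t => \sum_i \sum_j A t i j *: delta_mx i j).
  apply: (ac_sum _ (F := fun i t => \sum_j A t i j *: delta_mx i j)) => i.
  apply: (ac_sum _ (F := fun j t => A t i j *: delta_mx i j)) => j.
  apply: (ac_dominated1 (K := `|(delta_mx i j : 'M[R]_(m, n))|) (acA i j)) => s t _ _ _.
  by rewrite -scalerBl normrZ mulrC.
by rewrite (_ : A = fun t => \sum_i \sum_j A t i j *: delta_mx i j) //; apply/funext => t; exact: matrix_sum_delta.
Qed.

Lemma linear_bound m n (V : normedModType R) (L : {linear 'M[R]_(m, n) -> V}) :
  exists2 K, 0 <= K & forall x, `|L x| <= K * `|x|.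
Proof.
exists (\sum_i \sum_j `|L (delta_mx i j)|).
  by apply: sumr_ge0 => i _; apply: sumr_ge0.
move=> x; rewrite {1}(matrix_sum_delta x) linear_sum mulr_suml.
apply: le_trans (ler_norm_sum _ _ _) _; apply: ler_sum => i _.
rewrite linear_sum mulr_suml; apply: le_trans (ler_norm_sum _ _ _) _; apply: ler_sum => j _.
by rewrite linearZ normrZ mulrC ler_wpM2l // mx_norm_entry.
Qed.

Lemma is_derive_lin m n (V : normedModType R) (L : {linear 'M[R]_(m, n) -> V})
    (c : R -> 'M[R]_(m, n)) t d :
  is_derive t (1 : R) c d -> is_derive t (1 : R) (fun s => L (c s)) (L d).
Proof.
have [K K0 HK] := linear_bound L => /is_deriveP H; apply/is_deriveP => e e0.
have K1 : 0 < K + 1 by rewrite ltr_wpDl.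
have [|r r0 Hr] := H (e / (K + 1)); first by rewrite divr_gt0.
exists r => // h /Hr Hh; rewrite -!linearB -linearZ -linearB.
apply: le_trans (HK _) _; apply: le_trans (ler_wpM2l K0 Hh) _.
rewrite mulrA ler_wpM2r // mulrCA ler_piMr ?(ltW e0) //.
by rewrite ler_pdivrMr // mul1r lerDl.
Qed.

Lemma ac_linmx m n (V : normedModType R) (L : {linear 'M[R]_(m, n) -> V})
    (a b : R) (c : R -> 'M[R]_(m, n)) :
  abs_continuous a b c -> abs_continuous a b (fun s => L (c s)).
Proof. have [K _ HK] := linear_bound L; exact: ac_lin HK. Qed.

Lemma ae_itv_in (a b : R) (P Q : R -> Prop) : (forall t, a <= t <= b -> P t -> Q t) ->
  ae_itv a b P -> ae_itv a b Q.
Proof.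
move=> PQ [D [mD D0 sD]]; exists D; split=> // t /= nQ; apply: sD => /= H.
by apply: nQ => tab; apply: PQ => //; exact: H.
Qed.

Lemma ae_itvS (a b : R) (P Q : R -> Prop) : (forall t, P t -> Q t) ->
  ae_itv a b P -> ae_itv a b Q.
Proof. by move=> PQ; apply: ae_itv_in => t _; exact: PQ. Qed.

Lemma ae_itvI (a b : R) (P Q : R -> Prop) :
  ae_itv a b P -> ae_itv a b Q -> ae_itv a b (fun t => P t /\ Q t).
Proof.
move=> HP HQ; apply: negligibleS (negligibleU HP HQ) => t /= nPQ.
apply: contrapT => /not_orP[/contrapT Pt /contrapT Qt].
by apply: nPQ => tab; split; [exact: Pt|exact: Qt].
Qed.

Lemma ae_itv_list (a b : R) (s : seq R) (P : R -> Prop) :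
  (forall t, a <= t <= b -> t \notin s -> P t) -> ae_itv a b P.
Proof.
move=> H; exists [set` s]; split.
- by apply: countable_measurable; [move=> x; exact: measurable_set1|]; apply: finite_set_countable; exact: finite_seq.
- by apply: countable_lebesgue_measure0; apply: finite_set_countable; exact: finite_seq.
- move=> t /= nP; apply: contra_notT nP => ts tab; exact: H.
Qed.

Lemma ac_scale (V : normedModType R) (a b k : R) (f : R -> V) :
  abs_continuous a b f -> abs_continuous a b (fun t => k *: f t).
Proof.
move=> acf; apply: (ac_dominated1 (K := `|k|) acf) => s t _ _ _.
by rewrite -scalerBr normrZ.
Qed.

(** The form of the fundamental theorem by which every invariant is propagated. *)
Lemma ac_const (V : normedModType R) (a b : R) (f : R -> V) : a <= b ->
  abs_continuous a b f -> ae_itv a b (fun t => is_derive t (1 : R) f 0) -> f b = f a.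
Proof.
move=> ab acf H; apply/eqP; rewrite -subr_eq0 -normr_le0.
rewrite -(mul0r (b - a)); apply: ac_deriv_bound => //.
by apply: ae_itvS H => t H; exists 0 => //; rewrite normr0.
Qed.

Lemma ac_globally_lipschitz (V : normedModType R) (K : R) (c : R -> V) (p q : R) :
  (forall t t', `|c t' - c t| <= K * `|t' - t|) -> abs_continuous p q c.
Proof.
move=> H; apply: (ac_lipschitz (K := K)) => s t _ st _.
by apply: le_trans (H _ _) _; rewrite ger0_norm ?subr_ge0.
Qed.

Lemma ac_mul (a b : R) (f g : R -> R) : abs_continuous a b f -> abs_continuous a b g ->
  abs_continuous a b (fun t => f t * g t).
Proof.
move=> acf acg.
have ac1 (h : R -> R) : abs_continuous a b h -> abs_continuous a b (fun t => (const_mx (h t) : 'M[R]_1)).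
  by move=> ach; apply: ac_mx => i j; under eq_fun do rewrite mxE.
have := @ac_entry _ _ a b _ 0 0 (ac_mulmx (ac1 _ acf) (ac1 _ acg)).
by under eq_fun do rewrite mxE big_ord1 !mxE.
Qed.

Lemma ac_prod (I : Type) (r : seq I) (a b : R) (F : I -> R -> R) :
  (forall i, abs_continuous a b (F i)) -> abs_continuous a b (fun t => \prod_(i <- r) F i t).
Proof.
move=> HF; elim: r => [|i r IH].
  by under eq_fun do rewrite big_nil; exact: ac_cst.
by under eq_fun do rewrite big_cons; exact: (ac_mul (HF i) IH).
Qed.

Lemma ac_det n (a b : R) (A : R -> 'M[R]_n) : abs_continuous a b A ->
  abs_continuous a b (fun t => \det (A t)).
Proof.
move=> acA; apply: ac_sum => s; apply: ac_mul; first exact: ac_cst.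
by apply: ac_prod => i; exact: ac_entry.
Qed.

(** The determinant is an absolutely continuous function with values 1 and -1,
    hence constant. *)
Lemma ac_orthogonal_det n (a b : R) (A : R -> 'M[R]_n) : a <= b -> abs_continuous a b A ->
  (forall t, a <= t <= b -> (A t)^T *m A t = 1%:M) -> \det (A a) = 1 -> \det (A b) = 1.
Proof.
move=> ab /ac_det acd oA da; have [d d0 Hd] := acd 1 ltr01.
apply: (@interval_induction R a b (fun t => \det (A t) = 1)) => // x xab.
exists (d / 2); first by rewrite divr_gt0.
move=> p q /andP[ap px] /andP[xq qb] pr qr pdet.
have pq := le_trans px xq; have := Hd [:: (p, q)].
rewrite /= ap pq qb !big_seq1 /= => /(_ isT isT).
have -> : q - p < d by lra.
move=> /(_ isT); rewrite pdet.
have [|//|->] := orthogonal_det (A := A q); first by apply: oA; rewrite (le_trans ap pq).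
by rewrite ltr_norml; lra.
Qed.

Lemma cvg_mulmx (T : Type) (F : set_system T) (FF : Filter F) (m n p : nat)
    (A : T -> 'M[R]_(m, n)) (B : T -> 'M[R]_(n, p)) (A0 : 'M[R]_(m, n)) (B0 : 'M[R]_(n, p)) :
  A @ F --> A0 -> B @ F --> B0 -> (fun s => A s *m B s) @ F --> A0 *m B0.
Proof.
move=> cA cB; apply/cvgrPdist_le => e e0.
pose K : R := n%:R * (`|A0| + `|B0| + 1) + 1.
have K0 : 0 < K by rewrite ltr_wpDl // mulr_ge0 // !addr_ge0.
pose d := Num.min 1 (e / K); have d0 : 0 < d by rewrite lt_min ltr01 divr_gt0.
have d1 : d <= 1 by rewrite ge_min lexx.
have dK : d * K <= e by rewrite -ler_pdivlMr // ge_min lexx orbT.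
near=> s.
have As : `|A0 - A s| <= d by near: s; exact: cvgr_dist_le cA _ d0.
have Bs : `|B0 - B s| <= d by near: s; exact: cvgr_dist_le cB _ d0.
have -> : A0 *m B0 - A s *m B s = (A0 - A s) *m B0 + A s *m (B0 - B s).
  by rewrite mulmxBr mulmxBl subrKA.
have nA : `|A s| <= `|A0| + 1.
  rewrite -[A s](subKr A0); apply: le_trans (ler_normB _ _) _.
  by rewrite lerD2l (le_trans As).
apply: le_trans dK; apply: le_trans (ler_normD _ _) _.
apply: le_trans (lerD (mx_norm_mul _ _) (mx_norm_mul _ _)) _.
apply: le_trans (_ : n%:R * (d * `|B0|) + n%:R * ((`|A0| + 1) * d) <= _).
  apply: lerD; rewrite ler_wpM2l //; first exact: ler_wpM2r.
  by apply: ler_pM => //.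
have : 0 <= n%:R * d by rewrite mulr_ge0 // ltW.
rewrite /K; move: (n%:R : R) (`|A0|) (`|B0|) => u v w ud; nra.
Unshelve. all: by end_near. Qed.

Lemma cvg_lin (T : Type) (F : set_system T) (FF : Filter F) (m n : nat) (V : normedModType R)
    (L : {linear 'M[R]_(m, n) -> V}) (c : T -> 'M[R]_(m, n)) (l : 'M[R]_(m, n)) :
  c @ F --> l -> (fun s => L (c s)) @ F --> L l.
Proof.
move=> cl; apply/cvgrPdist_le => e e0; have [K K0 HK] := linear_bound L.
have K1 : 0 < K + 1 by rewrite ltr_wpDl.
near=> s.
have Hs : `|l - c s| <= e / (K + 1) by near: s; apply: cvgr_dist_le cl _ _; rewrite divr_gt0.
rewrite -linearB; apply: le_trans (HK _) _; apply: le_trans (ler_wpM2l K0 Hs) _.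
by rewrite mulrCA ler_piMr ?(ltW e0) // ler_pdivrMr // mul1r lerDl.
Unshelve. all: by end_near. Qed.

Lemma ac_C1 (m n : nat) (c : R -> 'M[R]_(m, n)) (a b : R) :
  (forall t : R, derivable c t 1) -> continuous (derive1 c) -> abs_continuous a b c.
Proof.
move=> dc cc; have [ab|ba] := leP a b; last first.
  apply: (ac_lipschitz (K := 0)) => s t as_ st tb.
  by have := le_lt_trans (le_trans as_ (le_trans st tb)) ba; rewrite ltxx.
have cn : {within `[a, b], continuous (fun t => `|derive1 c t|)}.
  apply: continuous_subspaceT => t; apply: (@continuous_comp _ _ _ (derive1 c) (fun x => `|x|)).
    exact: cc.
  exact: norm_continuous.
have [u uab Hu] := EVT_max ab cn; set K := `|_| in Hu.
apply: (ac_lipschitz (K := K)) => s t as_ st tb.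
have K0 : 0 <= K by exact: normr_ge0.
apply: mx_norm_le => [|i j]; first by rewrite mulr_ge0 // subr_ge0.
have dij x : is_derive x (1 : R) (fun y => c y i j) (derive1 c x i j).
  apply: (is_derive_mx _ _ _).1; rewrite derive1E; exact: derivableP.
have cij : {within `[s, t], continuous (fun y => c y i j)}.
  apply: continuous_subspaceT => x; apply: differentiable_continuous.
  by apply/derivable1_diffP; have [] := dij x.
have [z zst E] := MVT_segment st (fun x _ => dij x) cij.
rewrite !mxE E normrM [`|t - s|]ger0_norm ?subr_ge0 // ler_wpM2r ?subr_ge0 //.
apply: le_trans (mx_norm_entry _ _ _) _; apply: Hu.
move: zst; rewrite !in_itv /= => /andP[sz zt].
by rewrite (le_trans as_ sz) (le_trans zt tb).
Qed.

End AC2.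

(** * The Levi-Civita connection in the left-invariant frame *)

Section Algebra.
Context {R : realType} {m : nat}.
Local Notation N := (m + vdim m)%N.
Local Notation pt := 'cV[R]_N.
Implicit Types (x y u v w a b : pt).

(** [bracket u *m w] is the Lie bracket of the left-invariant fields with frame
    components [u] and [w]. *)
Definition bracket u : 'M[R]_N :=
  block_mx 0 0
    (\matrix_(i, j) let: (h, k) := val (idx_vpair i) in
       hcoord u h * (j == k)%:R - hcoord u k * (j == h)%:R) 0.

Lemma bracket_linear : linear bracket.
Proof.
move=> r u v; rewrite /bracket scale_block_mx add_block_mx !scaler0 !addr0.
congr block_mx; apply/matrixP => i j; rewrite !mxE.
by case: (val _) => h k; rewrite /hcoord !mxE; ring.
Qed.
HB.instance Definition _ := GRing.isLinear.Build R pt 'M[R]_N _ bracket bracket_linear.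

Lemma bracketE u w i : (bracket u *m w) (rshift m i) 0 =
  let: (h, k) := val (idx_vpair i) in hcoord u h * hcoord w k - hcoord u k * hcoord w h.
Proof.
rewrite -[w]vsubmxK mul_block_col !mul0mx !addr0 col_mxEd mxE.
under eq_bigr do rewrite mxE.
case: (val _) => h k; rewrite /hcoord !col_mxEu.
under eq_bigr do rewrite mulrBl -!mulrA.
rewrite big_split sumrN /= -!mulr_sumr.
have sumE l : \sum_j ((j == l)%:R * usubmx w j 0) = usubmx w l 0.
  rewrite (bigD1 l) //= eqxx mul1r big1 ?addr0 // => j /negPf ->.
  by rewrite mul0r.
by rewrite !sumE !mxE.
Qed.

Lemma hcoord_bracket u w h : hcoord (bracket u *m w) h = 0.
Proof. by rewrite /hcoord -[w]vsubmxK mul_block_col !mul0mx addr0 col_mxEu mxE. Qed.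

Lemma bracket_bracket u v : bracket u *m bracket v = 0.
Proof. rewrite mulmx_block !mul0mx !mulmx0 !addr0; exact: block_mx0. Qed.

Lemma bracket_hcoord u v : (forall h, hcoord u h = hcoord v h) -> bracket u = bracket v.
Proof.
move=> uv; congr block_mx; apply/matrixP => i j; rewrite !mxE.
by case: (val _) => h k; rewrite !uv.
Qed.

Lemma bracket_vert u w : bracket (bracket u *m w) = 0.
Proof.
rewrite -(linear0 bracket); apply: bracket_hcoord => h.
by rewrite hcoord_bracket /hcoord mxE.
Qed.

Lemma bracketC u w : bracket u *m w = - (bracket w *m u).
Proof.
apply/colP => i; rewrite [RHS]mxE; case: (split_ordP i) => j ->.
  by have := hcoord_bracket u w j; have := hcoord_bracket w u j; rewrite /hcoord => -> ->; rewrite oppr0.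
by rewrite !bracketE; case: (val _) => h k; ring.
Qed.

Lemma frameE x : frame x = 1%:M + 2^-1 *: bracket x.
Proof.
apply: mulmx_ext => w; apply: (addrI x); rewrite -starE mulmxDl mul1mx -scalemxAl.
apply/colP => i; rewrite [RHS]mxE [X in _ = _ + X]mxE [X in _ = _ + (_ + X)]mxE.
case: (split_ordP i) => j ->.
  by rewrite /star col_mxEu mxE; have := hcoord_bracket x w j; rewrite /hcoord => ->; rewrite mulr0 addr0.
rewrite /star col_mxEd mxE bracketE -[X in _ = _ + (w (rshift m X) 0 + _)]idx_vpairK.
rewrite -[X in _ = x (rshift m X) 0 + _]idx_vpairK.
by case: (val _) => h k; rewrite addrA.
Qed.

(** The inverse of the frame, since [bracket x] has square zero. *)
Definition coframe x : 'M[R]_N := 1%:M - 2^-1 *: bracket x.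

Lemma coframeK x : coframe x *m frame x = 1%:M.
Proof.
rewrite frameE mulmxBl mul1mx mulmxDr mulmx1 -scalemxAl -scalemxAr bracket_bracket !scaler0 addr0.
by rewrite addrK.
Qed.

Lemma frameK x : frame x *m coframe x = 1%:M.
Proof. exact: mulmx1C (coframeK x). Qed.

Lemma invmx_frame x : invmx (frame x) = coframe x.
Proof. by rewrite -[LHS]mul1mx -(coframeK x) mulmxK // frame_unit. Qed.

Lemma metricE x : metric x = (coframe x)^T *m coframe x.
Proof. by rewrite /metric invmx_frame. Qed.

Lemma bracket_frame x u : bracket (frame x *m u) = bracket u.
Proof.
by rewrite frameE mulmxDl mul1mx -scalemxAl linearD linearZ /= bracket_vert scaler0 addr0.
Qed.

Lemma bracket_mul_frame x u : bracket u *m frame x = bracket u.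
Proof. by rewrite frameE mulmxDr mulmx1 -scalemxAr bracket_bracket scaler0 addr0. Qed.

Lemma coframe_mul_bracket x u : coframe x *m bracket u = bracket u.
Proof. by rewrite mulmxBl mul1mx -scalemxAl bracket_bracket scaler0 subr0. Qed.

Lemma det_frame x : \det (frame x) = 1.
Proof.
by rewrite frameE /bracket scalar_mx_block scale_block_mx add_block_mx !scaler0 !addr0
  det_lblock !det1 mulr1.
Qed.

Lemma det_coframe x : \det (coframe x) = 1.
Proof. by rewrite -invmx_frame det_inv det_frame invr1. Qed.

(** The Koszul formula in the frame: 2 <conn_form u a, b> =
    <[u, a], b> - <[u, b], a> - <[a, b], u>. *)
Definition conn_form u : 'M[R]_N :=
  2^-1 *: (bracket u - (bracket u)^T - \matrix_(i, j) (u^T *m bracket (delta_mx j 0)) 0 i).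

Definition horizontal u := forall p, vcoord u p = 0.

Lemma conn_form_linear : linear conn_form.
Proof.
move=> r u v; rewrite /conn_form !linearP /=; apply/matrixP => i j; rewrite !mxE.
rewrite (_ : \sum_j0 _ = r * (u^T *m bracket (delta_mx j 0)) 0 i + (v^T *m bracket (delta_mx j 0)) 0 i).
  by rewrite !mxE; ring.
by rewrite !mxE mulr_sumr -big_split /=; apply: eq_bigr => k _; rewrite !mxE; ring.
Qed.
HB.instance Definition _ := GRing.isLinear.Build R pt 'M[R]_N _ conn_form conn_form_linear.

Lemma conn_form_tr u : (conn_form u)^T = - conn_form u.
Proof.
have E i j : (u^T *m bracket (delta_mx j 0)) 0 i = - (u^T *m bracket (delta_mx i 0)) 0 j.
  have key k l : (u^T *m bracket (delta_mx k 0)) 0 l = (u^T *m (bracket (delta_mx k 0) *m (delta_mx l 0 : pt))) 0 0.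
    by rewrite mulmxA -colE [RHS]mxE.
  by rewrite !key bracketC mulmxN mxE.
have EO i j : conn_form u i j = 2^-1 * (bracket u i j - bracket u j i - (u^T *m bracket (delta_mx j 0)) 0 i).
  by rewrite /conn_form !mxE.
by apply/matrixP => i j; rewrite [LHS]mxE [RHS]mxE !EO E; ring.
Qed.

(** Brackets are vertical, hence orthogonal to horizontal vectors. *)
Lemma tr_bracket_hor u w : horizontal u -> u^T *m bracket w = 0.
Proof.
move=> hu; have -> : u = col_mx (usubmx u) 0.
  rewrite -[LHS]vsubmxK; congr col_mx; apply/colP => i; rewrite !mxE.
  by have := hu (idx_vpair i); rewrite /vcoord idx_vpairK.
by rewrite tr_col_mx mul_row_block trmx0 !mul0mx !mulmx0 !addr0 row_mx0.
Qed.

Lemma conn_form_hor u : horizontal u -> conn_form u = 2^-1 *: (bracket u - (bracket u)^T).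
Proof.
move=> hu; rewrite /conn_form; congr (_ *: _); rewrite -[RHS]subr0; congr (_ - _).
by apply/matrixP => i j; rewrite mxE tr_bracket_hor // !mxE.
Qed.

Lemma is_derive_metric x v : is_derive (0 : R) (1 : R) (fun h => metric (x + h *: v))
  (- 2^-1 *: ((bracket v)^T *m coframe x + (coframe x)^T *m bracket v)).
Proof.
have cfE h : coframe (x + h *: v) = coframe x - (2^-1 * h) *: bracket v.
  have bE : bracket (x + h *: v) = bracket x + h *: bracket v by rewrite linearD linearZ.
    by rewrite /coframe bE scalerDr opprD addrA scalerA.
have dcf : is_derive (0 : R) (1 : R) (fun h => coframe (x + h *: v)) (- 2^-1 *: bracket v).
  apply/is_deriveP => e e0; exists 1 => // h _.
  rewrite !cfE !add0r mulr0 scale0r subr0 [coframe x - _]addrC addrK.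
  rewrite scaleNr scalerN opprK scalerA.
  by rewrite [h * _]mulrC addNr normr0 mulr_ge0 // ltW.
have -> : (fun h => metric (x + h *: v)) = fun h => (coframe (x + h *: v))^T *m coframe (x + h *: v).
  by apply/funext => h; rewrite metricE.
apply: (is_derive_eq (is_derive_mulmx (is_derive_trmx dcf) dcf)).
by rewrite scale0r addr0 linearZ /= scalerDr -scalemxAl -scalemxAr.
Qed.

Definition trilinear (A : pt -> 'M[R]_N) u a b : R := (b^T *m (A u *m a)) 0 0.

(** The correction [2^-1 *: bracket u] is the derivative of the frame in the
    direction [frame x *m u].  Adding it to the connection gives a map which is skew by
    compatibility with the metric and whose alternation is the bracket by
    vanishing of the torsion; these two properties determine it. *)
Lemma conn_frame conn x u : levi_civita metric conn ->
  conn_along conn x (frame x *m u) *m frame x = frame x *m conn_form u - 2^-1 *: bracket u.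
Proof.
move=> [tf mc].
(* [Om] is the connection together with the derivative of the frame. *)
pose Om u := coframe x *m conn_along conn x (frame x *m u) *m frame x + 2^-1 *: bracket u.
suff <- : Om u = conn_form u.
  rewrite /Om mulmxDr !mulmxA frameK mul1mx -scalemxAr.
  have -> : frame x *m bracket u = bracket u by rewrite -[in LHS](coframe_mul_bracket x u) mulmxA frameK mul1mx.
  by rewrite addrK.
have skew v : (Om v)^T = - Om v.
  pose c := conn_along conn x (frame x *m v).
  have cE : c^T *m metric x + metric x *m c =
      - 2^-1 *: ((bracket v)^T *m coframe x + (coframe x)^T *m bracket v).
    rewrite -[in RHS](bracket_frame x v); set w := frame x *m v in c *.
    have dE i : (conn x i)^T *m metric x + metric x *m conn x i =
        - 2^-1 *: ((bracket (delta_mx i 0))^T *m coframe x + (coframe x)^T *m bracket (delta_mx i 0)).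
      apply/matrixP => j k; have := mc x i j k.
      have D := (is_derive_mx _ _ _).1 (is_derive_metric x (delta_mx i 0)) j k.
      have -> : partial (fun y => metric y j k) i x = _ := derive_along (f := fun y => metric y j k) D.
      move=> ->; rewrite big_split /=; rewrite [LHS]mxE; congr (_ + _); rewrite mxE //.
      by apply: eq_bigr => l _; rewrite mxE.
    have wE : w = \sum_j w j 0 *: delta_mx j 0.
      by rewrite {1}(matrix_sum_delta w); apply: eq_bigr => j _; rewrite big_ord1.
    rewrite [in RHS]wE /c /conn_along !linear_sum /= !mulmx_suml ?mulmx_sumr -!big_split /=.
    rewrite ?scaler_sumr; apply: eq_bigr => i _.
    rewrite !linearZ /= -!scalemxAl ?linearZ /= -!scalerDr dE.
    by rewrite !scalerA mulrC.
  have bE : (Om v)^T + Om v = 0.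
    have := congr1 (fun M => (frame x)^T *m M *m frame x) cE.
    rewrite /= metricE (gram_conj c (coframeK x)) -scalemxAr -scalemxAl (gram_conj_deriv _ (coframeK x)).
    rewrite bracket_mul_frame => H.
    have OE : Om v = coframe x *m c *m frame x + 2^-1 *: bracket v by [].
    rewrite OE linearD linearZ /= addrACA H -scalerDr -scalerDl addNr scale0r //.
  by rewrite -[LHS](addrK (Om v)) bE sub0r.
have tors v w : Om v *m w - Om w *m v = bracket v *m w.
  have sym (a b : pt) : conn_along conn x a *m b = conn_along conn x b *m a.
    apply/colP => k; rewrite /conn_along !mulmx_suml !summxE.
    under eq_bigr do rewrite -scalemxAl 2!mxE mulr_sumr.
    under [RHS]eq_bigr do rewrite -scalemxAl 2!mxE mulr_sumr.
    rewrite exchange_big /=; apply: eq_bigr => i _; apply: eq_bigr => j _.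
    by rewrite tf; ring.
  rewrite /Om !mulmxDl -!mulmxA (sym (frame x *m v)) opprD addrACA subrr add0r.
  rewrite -!scalemxAl [bracket w *m v]bracketC scalerN opprK -mulr2n -scaler_nat scalerA.
  by rewrite divff ?scale1r // pnatr_eq0.
pose S := trilinear Om; pose T := trilinear bracket.
(* The usual permutation of arguments in the Koszul formula. *)
have SN v a b : S v a b = - S v b a.
  have t (X : 'M[R]_1) : X 0 0 = X^T 0 0 by rewrite mxE.
  rewrite /S /trilinear [LHS]t.
  by rewrite !trmx_mul trmxK skew mulmxN mulNmx mulmxA mxE.
have TN v a b : T v a b = - T a v b.
  by rewrite /T /trilinear bracketC mulmxN mxE.
have ST v w b : S v w b - S w v b = T v w b.
  rewrite /S /T /trilinear -tors mulmxBr [RHS]mxE.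
  by congr (_ + _); rewrite [RHS]mxE.
have omE v a b : trilinear conn_form v a b = 2^-1 * (T v a b - T a b v + T b v a).
  rewrite [T b v a]TN /T /trilinear.
  have -> : conn_form v *m a = 2^-1 *: (bracket v *m a - (bracket v)^T *m a - (bracket a)^T *m v).
    rewrite /conn_form -scalemxAl !mulmxBl; congr (_ *: (_ - _)).
    have aE : a = \sum_j a j 0 *: delta_mx j 0.
      by rewrite {1}(matrix_sum_delta a); apply: eq_bigr => j _; rewrite big_ord1.
    rewrite -[RHS]trmxK trmx_mul trmxK; apply/colP => i.
    rewrite [LHS]mxE [RHS]mxE [in RHS]aE linear_sum mulmx_sumr summxE.
    apply: eq_bigr => j _; rewrite linearZ /= -scalemxAr [RHS]mxE mulrC; congr (_ * _).
    by rewrite mxE.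
  have t (X : 'M[R]_1) : X 0 0 = X^T 0 0 by rewrite mxE.
  have sub (A B : 'M[R]_1) : (A - B) 0 0 = A 0 0 - B 0 0 by rewrite !mxE.
  rewrite -scalemxAr mxE; congr (_ * _); rewrite !mulmxBr !sub.
  rewrite [X in _ - X - _]t [X in _ - _ - X]t !trmx_mul !trmxK -!mulmxA; ring.
have SE a b : S u a b = trilinear conn_form u a b.
  rewrite omE.
  have := ST u a b; have := ST a b u; have := ST b u a.
  by have := SN u a b; have := SN a b u; have := SN b u a; lra.
apply/matrixP => i j; have := SE (delta_mx j 0) (delta_mx i 0).
rewrite /S /trilinear -!colE trmx_delta -!rowE !mxE; exact.
Qed.
End Algebra.

(** * Parallel transport in the frame *)

Section Transport.
Context {R : realType} {m : nat}.
Local Notation N := (m + vdim m)%N.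
Local Notation pt := 'cV[R]_N.
Implicit Types (x y u v w : pt) (c B : R -> pt).

Lemma is_derive_coframe c t dc : is_derive t (1 : R) c dc ->
  is_derive t (1 : R) (fun s => coframe (c s)) (- (2^-1 *: bracket dc)).
Proof.
move=> dcP; have bP := is_derive_scale (- 2^-1) (is_derive_lin bracket dcP).
have := is_derive_add (is_derive_cst (1%:M : 'M[R]_N) t (1 : R)) bP.
rewrite add0r scaleNr; congr is_derive; apply/funext => s.
by rewrite scaleNr.
Qed.

Lemma is_derive_frame c t dc : is_derive t (1 : R) c dc ->
  is_derive t (1 : R) (fun s => frame (c s)) (2^-1 *: bracket dc).
Proof.
move=> dcP; have bP := is_derive_scale 2^-1 (is_derive_lin bracket dcP).
have := is_derive_add (is_derive_cst (1%:M : 'M[R]_N) t (1 : R)) bP.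
by rewrite add0r; congr is_derive; apply/funext => s; rewrite frameE.
Qed.

Lemma ac_frame c a b : abs_continuous a b c -> abs_continuous a b (fun s => frame (c s)).
Proof.
move=> acc; have -> : (fun s => frame (c s)) = (fun s => 1%:M + 2^-1 *: bracket (c s)).
  by apply/funext => s; rewrite frameE.
by apply: ac_add; [exact: ac_cst|apply: ac_scale; exact: ac_linmx].
Qed.

Lemma ac_coframe c a b : abs_continuous a b c -> abs_continuous a b (fun s => coframe (c s)).
Proof.
move=> acc; have -> : (fun s => coframe (c s)) = (fun s => 1%:M + (- 2^-1) *: bracket (c s)).
  by apply/funext => s; rewrite scaleNr.
by apply: ac_add; [exact: ac_cst|apply: ac_scale; exact: ac_linmx].
Qed.

(** Parallel fields along [c], described by their components in the frame. *)
Definition frame_parallel c (a b : R) B : Prop :=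
  abs_continuous a b B /\
  ae_itv a b (fun t => exists2 dc, is_derive t (1 : R) c dc &
    is_derive t (1 : R) B (- (conn_form (coframe (c t) *m dc) *m B t))).

Lemma conn_along_frame conn x v : levi_civita metric conn ->
  conn_along conn x v *m frame x = frame x *m conn_form (coframe x *m v) - 2^-1 *: bracket v.
Proof.
move=> lc; have vE : v = frame x *m (coframe x *m v) by rewrite mulmxA frameK mul1mx.
by rewrite [in LHS]vE conn_frame // [in RHS]vE bracket_frame -vE.
Qed.

Lemma parallel_to_frame conn c a b V : levi_civita metric conn ->
  abs_continuous a b c -> parallel_field conn c a b V ->
  frame_parallel c a b (fun t => coframe (c t) *m V t).
Proof.
move=> lc acc [acV aeV]; split; first by apply: ac_mulmx => //; exact: ac_coframe.
apply: ae_itvS aeV => t [dc [dV [dcP dVP E]]]; exists dc => //.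
apply: (is_derive_eq (is_derive_mulmx (is_derive_coframe dcP) dVP)).
have -> : dV = - (conn_along conn (c t) dc *m V t) by apply/eqP; rewrite -addr_eq0 E.
have VE : V t = frame (c t) *m (coframe (c t) *m V t) by rewrite mulmxA frameK mul1mx.
move: (coframe (c t) *m V t) VE => W ->.
have A1 : conn_along conn (c t) dc *m (frame (c t) *m W) =
    frame (c t) *m (conn_form (coframe (c t) *m dc) *m W) - 2^-1 *: (bracket dc *m W).
  by rewrite mulmxA conn_along_frame // mulmxBl scalemxAl mulmxA.
have A2 : bracket dc *m (frame (c t) *m W) = bracket dc *m W by rewrite mulmxA bracket_mul_frame.
have A3 (Y : pt) : coframe (c t) *m (frame (c t) *m Y) = Y by rewrite mulmxA coframeK mul1mx.
have A4 : coframe (c t) *m (bracket dc *m W) = bracket dc *m W by rewrite mulmxA coframe_mul_bracket.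
rewrite A1 mulmxN (mulmxBr (coframe (c t))) A3 -scalemxAr A4 mulNmx -scalemxAl A2.
by rewrite opprB addrA addNr add0r.
Qed.

Lemma parallel_of_frame conn c a b B : levi_civita metric conn ->
  abs_continuous a b c -> frame_parallel c a b B ->
  parallel_field conn c a b (fun t => frame (c t) *m B t).
Proof.
move=> lc acc [acV aeV]; split; first by apply: ac_mulmx => //; exact: ac_frame.
apply: ae_itvS aeV => t [dc dcP dBP]; eexists dc, _; split=> //.
  exact: is_derive_mulmx (is_derive_frame dcP) dBP.
have A1 : conn_along conn (c t) dc *m (frame (c t) *m B t) =
    frame (c t) *m (conn_form (coframe (c t) *m dc) *m B t) - 2^-1 *: (bracket dc *m B t).
  by rewrite mulmxA conn_along_frame // mulmxBl scalemxAl mulmxA.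
by rewrite /= A1 mulmxN -scalemxAl subrKA subrr.
Qed.

Lemma frame_parallel_itv c a b a' b' B : a <= a' -> b' <= b ->
  frame_parallel c a b B -> frame_parallel c a' b' B.
Proof.
move=> aa bb [acB [D [mD D0 sD]]]; split; first exact: ac_itv acB.
exists D; split=> // t /= nP; apply: sD => /= H; apply: nP => /andP[at_ tb].
by apply: H; rewrite (le_trans aa at_) (le_trans tb bb).
Qed.

(** [conn_form] is skew, so transport is an isometry. *)
Lemma frame_parallel_dot c a b B1 B2 : a <= b ->
  frame_parallel c a b B1 -> frame_parallel c a b B2 ->
  (B1 b)^T *m B2 b = (B1 a)^T *m B2 a.
Proof.
move=> ab [ac1 ae1] [ac2 ae2].
apply: (ac_const (f := fun t => (B1 t)^T *m B2 t) ab).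
  by apply: ac_mulmx => //; exact: ac_trmx.
apply: ae_itvS (ae_itvI ae1 ae2) => t [[d1 d1P B1P] [d2 d2P B2P]].
rewrite -(is_derive_unique d1P d2P) in B2P.
apply: (is_derive_eq (is_derive_mulmx (is_derive_trmx B1P) B2P)).
rewrite linearN /= trmx_mul conn_form_tr mulmxN opprK mulmxN -mulmxA subrr //.
Qed.

Lemma frame_parallel_dot_in c a b B s t :
  frame_parallel c a b B -> a <= s <= b -> a <= t <= b ->
  (B s)^T *m B s = (B t)^T *m B t.
Proof.
move=> pB; wlog st : s t / s <= t => [H|/andP[as_ sb] /andP[at_ tb]].
  have [st|ts] := leP s t; first exact: H.
  by move=> ? ?; apply/esym; apply: H => //; exact: ltW.
have pB' := frame_parallel_itv as_ tb pB.
by rewrite (frame_parallel_dot st pB' pB').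
Qed.

(** The distribution is the image under the frame of the horizontal vectors. *)
Lemma DeltaP x v : Delta x v <-> exists2 u, horizontal u & v = frame x *m u.
Proof.
(* the first [m] columns of the frame are the [X_field h] *)
have E (f : 'I_m -> R) : \sum_h f h *: X_field h x = frame x *m col_mx (\col_h f h) 0.
  apply/colP => i; rewrite summxE mxE big_split_ord /= [X in _ + X]big1 ?addr0.
    by apply: eq_bigr => h _; rewrite mxE frame_l col_mxEu mxE mulrC.
  by move=> k _; rewrite col_mxEd [X in _ * X]mxE mulr0.
split=> [[f ->]|[u hu ->]].
  by exists (col_mx (\col_h f h) 0) => // p; rewrite /vcoord col_mxEd mxE.
exists (fun h => hcoord u h); rewrite E; congr (_ *m _).
rewrite -[LHS]vsubmxK; congr col_mx; apply/colP => i; rewrite !mxE //.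
by have := hu (idx_vpair i); rewrite /vcoord idx_vpairK.
Qed.

End Transport.

(** * An invariant of horizontal parallel transport *)

Section Psi.
Context {R : realType} {m : nat}.
Local Notation N := (m + vdim m)%N.
Local Notation pt := 'cV[R]_N.
Implicit Types (x y u v w a b : pt) (c B : R -> pt).

(** The vertical part, as an element of so(m). *)
Definition vert_mx a : 'M[R]_m :=
  \sum_p vcoord a p *: (delta_mx (val p).1 (val p).2 - delta_mx (val p).2 (val p).1).

(** The identification of the Lie algebra of the group, as a Euclidean space,
    with so(1 + m): the horizontal part is the first row. *)
Definition psi a : 'M[R]_(1 + m) :=
  block_mx 0 (usubmx a)^T (- usubmx a) (vert_mx a).

Lemma vert_mx_linear : linear vert_mx.
Proof.
move=> r a b; rewrite /vert_mx scaler_sumr -big_split /=; apply: eq_bigr => p _.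
by rewrite /vcoord !mxE scalerDl scalerA.
Qed.
HB.instance Definition _ := GRing.isLinear.Build R pt 'M[R]_m _ vert_mx vert_mx_linear.

Lemma psi_linear : linear psi.
Proof.
move=> r a b; rewrite /psi !linearP /= scale_block_mx add_block_mx scaler0 addr0.
by congr block_mx; rewrite scalerN opprD.
Qed.
HB.instance Definition _ := GRing.isLinear.Build R pt 'M[R]_(1 + m) _ psi psi_linear.

Lemma vert_mx_tr a : (vert_mx a)^T = - vert_mx a.
Proof.
rewrite /vert_mx linear_sum -sumrN /=; apply: eq_bigr => p _.
by rewrite linearZ linearB /= !trmx_delta -scalerN opprB.
Qed.

(** The pairs k < h parametrize the entries below the diagonal of a skew matrix. *)
Lemma skew_sum_vpair (F : vpair m -> R) (G : 'I_m -> 'I_m -> R) :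
  (forall p, F p = G (val p).1 (val p).2) ->
  (forall h k, G h k = - G k h) ->
  \sum_p F p *: (delta_mx (val p).1 (val p).2 - delta_mx (val p).2 (val p).1) =
  \matrix_(h, k) G h k.
Proof.
move=> FG GN; apply/matrixP => i j; rewrite summxE mxE.
have G0 h : G h h = 0.
  by apply/eqP; rewrite -[_ == 0](mulrn_eq0 _ 2) /= mulr2n {1}GN addNr.
have [ji|ij] := ltnP j i.
  rewrite (bigD1 (exist _ (i, j) ji : vpair m)) //= big1 => [|p pij]; rewrite !mxE.
    by rewrite FG /= !eqxx (gtn_eqF ji : (i == j) = false) subr0 mulr1 addr0.
  have -> : (i == (val p).1) && (j == (val p).2) = false.
    apply: contra_neqF pij => /andP[/eqP e1 /eqP e2].
    by apply/val_inj; rewrite /= e1 e2 -surjective_pairing.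
  have -> : (i == (val p).2) && (j == (val p).1) = false.
    apply/negP => /andP[/eqP e1 /eqP e2]; have := valP p; rewrite /= -e1 -e2.
    by rewrite ltnNge ltnW.
  by rewrite subr0 mulr0.
move: ij; rewrite leq_eqVlt => /orP[/eqP/val_inj <-|ij].
  rewrite G0 big1 // => p _; rewrite !mxE.
  by rewrite [(i == (val p).2) && _]andbC subrr mulr0.
rewrite (bigD1 (exist _ (j, i) ij : vpair m)) //= big1 => [|p pij]; rewrite !mxE.
  by rewrite FG /= !eqxx (gtn_eqF ij : (j == i) = false) andbF sub0r mulrN1 addr0 -GN.
have -> : (i == (val p).2) && (j == (val p).1) = false.
  apply: contra_neqF pij => /andP[/eqP e1 /eqP e2].
  by apply/val_inj; rewrite /= e1 e2 -surjective_pairing.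
have -> : (i == (val p).1) && (j == (val p).2) = false.
  apply/negP => /andP[/eqP e1 /eqP e2]; have := valP p; rewrite /= -e1 -e2.
  by rewrite ltnNge ltnW.
by rewrite subr0 mulr0.
Qed.

Lemma vert_mx_bracket u w : vert_mx (bracket u *m w) =
  usubmx u *m (usubmx w)^T - usubmx w *m (usubmx u)^T.
Proof.
rewrite /vert_mx (skew_sum_vpair (G := fun h k => hcoord u h * hcoord w k - hcoord u k * hcoord w h)).
- by apply/matrixP => h k; rewrite !mxE !big_ord1 !mxE /hcoord; ring.
- by move=> p; rewrite /vcoord bracketE vpair_idxK; case: (val p).
- by move=> h k; ring.
Qed.

Lemma tr_bracketE u a : (bracket u)^T *m a = col_mx (- (vert_mx a *m usubmx u)) 0.
Proof.
rewrite /bracket tr_block_mx !trmx0 -[a in LHS]vsubmxK mul_block_col !mul0mx add0r addr0.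
congr col_mx; apply/colP => j.
rewrite [LHS]mxE (reindex (@vpair_idx m)) /=; last first.
  exact: (onW_bij _ (Bijective (@vpair_idxK m) (@idx_vpairK m))).
rewrite [RHS]mxE /vert_mx mulmx_suml summxE -sumrN; apply: eq_bigr => p _.
rewrite 2![X in X * _]mxE vpair_idxK -scalemxAl [in RHS]mxE.
have -> : ((delta_mx (val p).1 (val p).2 - delta_mx (val p).2 (val p).1) *m usubmx u) j 0 =
    (j == (val p).1)%:R * hcoord u (val p).2 - (j == (val p).2)%:R * hcoord u (val p).1.
  rewrite mulmxBl mxE [X in _ + X]mxE; congr (_ - _); rewrite mxE.
    rewrite (bigD1 (val p).2) //= big1 => [|k /negPf kp]; rewrite !mxE ?kp ?andbF ?mul0r //.
    by rewrite eqxx andbT addr0 /hcoord.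
  rewrite (bigD1 (val p).1) //= big1 => [|k /negPf kp]; rewrite !mxE ?kp ?andbF ?mul0r //.
  by rewrite eqxx andbT addr0 /hcoord.
rewrite mxE /vcoord; case: p => -[h k] hk /=.
by ring.
Qed.

Lemma vert_mx_hor u : horizontal u -> vert_mx u = 0.
Proof. by move=> hu; rewrite /vert_mx big1 // => p _; rewrite hu scale0r. Qed.

Lemma vert_mx_dv (p : vpair m) : vert_mx (dv p : pt) =
  delta_mx (val p).1 (val p).2 - delta_mx (val p).2 (val p).1.
Proof.
rewrite /vert_mx (bigD1 p) //= big1 => [|p' /negPf pp].
  by rewrite /vcoord mxE !eqxx scale1r addr0.
rewrite /vcoord mxE eqxx andbT (inj_eq (@rshift_inj _ _)) (can_eq (@vpair_idxK m)) pp.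
by rewrite scale0r.
Qed.

Lemma dh_hor h : horizontal (dh h : pt).
Proof. by move=> p; rewrite /vcoord mxE eq_rlshift. Qed.

(** Infinitesimal horizontal transport is an inner derivation of so(1 + m). *)
Lemma psi_conn_form u a : horizontal u ->
  psi (conn_form u *m a) = - 2^-1 *: (psi u *m psi a - psi a *m psi u).
Proof.
move=> hu; rewrite conn_form_hor // -scalemxAl linearZ /= scaleNr -scalerN; congr (_ *: _).
rewrite mulmxBl tr_bracketE; set b := bracket u *m a - _.
have bu : usubmx b = vert_mx a *m usubmx u.
  rewrite linearB /= col_mxKu opprK -[RHS]add0r; congr (_ + _).
  by apply/colP => i; rewrite mxE; have := hcoord_bracket u a i; rewrite /hcoord => ->; rewrite mxE.
have bv : vert_mx b = usubmx u *m (usubmx a)^T - usubmx a *m (usubmx u)^T.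
  rewrite linearB /= vert_mx_bracket vert_mx_hor ?subr0 // => p.
  by rewrite /vcoord col_mxEd mxE.
rewrite /psi bu bv (vert_mx_hor hu) !mulmx_block !mul0mx !mulmx0 !add0r !addr0.
rewrite opp_block_mx add_block_mx opp_block_mx; congr block_mx.
- rewrite !mulmxN opprK opprD opprK; apply/eqP; rewrite eq_sym subr_eq0; apply/eqP.
  by apply/matrixP => i j; rewrite !ord1 !mxE; apply: eq_bigr => k _; rewrite !mxE mulrC.
- by rewrite trmx_mul vert_mx_tr mulmxN subr0.
- by rewrite mulmxN opprK add0r.
- by rewrite !mulNmx opprK opprD opprK.
Qed.

(** An ad-invariant cubic form of so(1 + m): the Killing form paired with the
    bracket, up to a factor. *)
Definition phi a b d : R := \tr (psi a *m psi b *m psi d).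

(** [psi] of a parallel field evolves by commutators with [psi u], and the trace
    of a commutator is zero. *)
Lemma phi_const c t0 t1 B1 B2 B3 : t0 <= t1 ->
  ae_itv t0 t1 (fun t => exists2 dc, is_derive t (1 : R) c dc & Delta (c t) dc) ->
  frame_parallel c t0 t1 B1 -> frame_parallel c t0 t1 B2 -> frame_parallel c t0 t1 B3 ->
  phi (B1 t1) (B2 t1) (B3 t1) = phi (B1 t0) (B2 t0) (B3 t0).
Proof.
move=> t01 aeh [ac1 ae1] [ac2 ae2] [ac3 ae3].
apply: (ac_const (f := fun t => phi (B1 t) (B2 t) (B3 t)) t01).
  by apply: (ac_linmx (@mxtrace R (1 + m))); do 2?apply: ac_mulmx; exact: (ac_linmx psi).
apply: ae_itvS (ae_itvI aeh (ae_itvI ae1 (ae_itvI ae2 ae3))) => t.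
move=> [[dc dcP /DeltaP[u hu dcE]] [[d1 d1P H1] [[d2 d2P H2] [d3 d3P H3]]]].
rewrite (is_derive_unique d1P dcP) dcE mulmxA coframeK mul1mx in H1.
rewrite (is_derive_unique d2P dcP) dcE mulmxA coframeK mul1mx in H2.
rewrite (is_derive_unique d3P dcP) dcE mulmxA coframeK mul1mx in H3.
have key B : is_derive t (1 : R) B (- (conn_form u *m B t)) ->
    is_derive t (1 : R) (fun s => psi (B s)) (2^-1 *: (psi u *m psi (B t) - psi (B t) *m psi u)).
  move=> H; apply: (is_derive_eq (is_derive_lin psi H)).
  by rewrite linearN /= psi_conn_form // scaleNr opprK.
have H := is_derive_mulmx (is_derive_mulmx (key _ H1) (key _ H2)) (key _ H3).
apply: (is_derive_eq (is_derive_lin (@mxtrace R (1 + m)) H)).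
move: (psi u) (psi (B1 t)) (psi (B2 t)) (psi (B3 t)) => U X Y Z.
rewrite (_ : _ + _ = 2^-1 *: (U *m (X *m Y *m Z) - X *m Y *m Z *m U)).
  by rewrite linearZ linearB /= mxtrace_mulC subrr scaler0.
rewrite -!scalemxAl -!scalemxAr -!scalerDr -scalemxAl -scalerDr; congr (_ *: _).
rewrite !mulmxBl !mulmxBr !mulmxDl !mulNmx !mulmxA.
by rewrite subrKA subrKA.
Qed.

End Psi.

(** * The rolling lift in the frame *)

Section Rolling.
Context {R : realType}.

Context {m : nat}.
Local Notation N := (m + vdim m)%N.
Local Notation pt := 'cV[R]_N.

(** Two vectors with equal Euclidean norms have comparable maximum norms; the
    constant is not sharp. *)
Lemma sqr_entry_dot (w v : pt) i : w^T *m w = v^T *m v -> `|w i 0| <= N%:R * `|v| + `|v|.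
Proof.
move=> /matrixP/(_ 0 0); rewrite !mxE => E.
have wi : w i 0 ^+ 2 <= \sum_j v j 0 ^+ 2.
  rewrite (_ : \sum_j v j 0 ^+ 2 = \sum_j w j 0 ^+ 2); last first.
    transitivity (\sum_j w^T 0 j * w j 0); first by rewrite E; apply: eq_bigr => j _; rewrite mxE.
    by apply: eq_bigr => j _; rewrite mxE.
  by rewrite (bigD1 i) //= lerDl sumr_ge0 // => j _; exact: sqr_ge0.
have vi : \sum_j v j 0 ^+ 2 <= N%:R * `|v| ^+ 2.
  have -> : N%:R * `|v| ^+ 2 = \sum_(j < N) `|v| ^+ 2 by rewrite sumr_const card_ord mulr_natl.
  by apply: ler_sum => j _; rewrite -real_normK ?num_real // lerXn2r ?nnegrE ?mx_norm_entry.
have n0 := normr_ge0 v; have N0 : 0 <= N%:R :> R by [].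
rewrite -(ler_pXn2r (n := 2)) ?nnegrE // ?addr_ge0 ?mulr_ge0 //.
rewrite real_normK ?num_real //; apply: le_trans wi _; apply: le_trans vi _.
move: (N%:R : R) N0 => k k0; have := mulr_ge0 k0 (sqr_ge0 `|v|); have := mulr_ge0 (mulr_ge0 k0 k0) (sqr_ge0 `|v|); have := sqr_ge0 `|v|; nra.
Qed.

Lemma norm_mulmx_sub n (A A0 : 'M[R]_n) (b w : 'cV[R]_n) :
  `|- (A *m b) + (1 : R) *: (A0 *m w)| <= n%:R * (`|A - A0| * `|b|) + n%:R * (`|A0| * `|b - w|).
Proof.
have -> : - (A *m b) + (1 : R) *: (A0 *m w) = - ((A - A0) *m b) - A0 *m (b - w).
  by rewrite scale1r mulmxBl mulmxBr !opprB [RHS]addrC subrKA addrC.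
apply: le_trans (ler_normB _ _) _; rewrite normrN.
exact: le_trans (lerD (mx_norm_mul _ _) (mx_norm_mul _ _)) _.
Qed.

(** In the frame, the field transported from [c t] back to [c 0] has constant
    Euclidean norm, hence is bounded uniformly in [t].  Then it varies by O(t), and
    replacing its derivative by the constant [- conn_form (coframe x *m X) *m w]
    costs o(t), because the velocity of [c] is continuous. *)
Lemma transport_derive conn (c : R -> pt) (P : R -> 'M[R]_N) x X :
  levi_civita metric conn ->
  (forall t : R, derivable c t 1) -> continuous (derive1 c) ->
  c 0 = x -> is_derive (0 : R) (1 : R) c X ->
  (forall t : R, parallel_transport conn c t 0 (P t)) ->
  is_derive (0 : R) (1 : R) (fun t => coframe x *m P t *m frame (c t))
    (conn_form (coframe x *m X)).
Proof.
move=> lc dc cc c0 cX tP; pose Om s := conn_form (coframe (c s) *m derive1 c s).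
pose Phi t := coframe x *m P t *m frame (c t).
have P0 : P 0 = 1%:M.
  apply: mulmx_ext => u; have [V [_ V0 V1]] := tP 0 u.
  by rewrite mul1mx -V1.
have Phi0 : Phi 0 = 1%:M by rewrite /Phi c0 P0 mulmx1 coframeK.
have Om0 : Om 0 = conn_form (coframe x *m X).
  by rewrite /Om c0 derive1E; have [_ ->] := cX.
rewrite -Om0.
have cOm : Om s @[s --> (0 : R)] --> Om 0.
  apply: cvg_lin; apply: cvg_mulmx; last exact: cc.
  have -> : (fun s => coframe (c s)) = (fun s => 1%:M - 2^-1 *: bracket (c s)) by [].
  apply: cvgB; first exact: cvg_cst.
  apply: cvgZ; first exact: cvg_cst.
  apply: cvg_lin; apply: differentiable_continuous.
  by apply/derivable1_diffP; exact: dc.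
suff H (w : pt) : is_derive (0 : R) (1 : R) (fun t => Phi t *m w) (Om 0 *m w).
  apply/is_derive_mx => i j; have := (is_derive_mx _ _ _).1 (H (delta_mx j 0)) i 0.
  rewrite -colE mxE; congr is_derive; apply/funext => t.
  by rewrite -colE mxE.
apply/is_deriveP => e e0.
pose M := N%:R * `|w| + `|w| + 1.
have M0 : 0 < M by rewrite ltr_wpDl // addr_ge0 // mulr_ge0.
pose L := N%:R * ((`|Om 0| + 1) * M).
have N0 : 0 <= N%:R :> R by [].
have L0 : 0 <= L by rewrite mulr_ge0 // mulr_ge0 ?addr_ge0 // ltW.
(* [M] bounds the transported field, [L] is its Lipschitz constant; [e1] and [r2]
   make the two error terms at most [e / 2] each. *)
pose e1 := Num.min 1 (e / (2 * (N%:R * M + 1))).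
have e10 : 0 < e1.
  by rewrite lt_min ltr01 divr_gt0 // mulr_gt0 // ltr_wpDl // mulr_ge0 // ltW.
pose r2 := e / (2 * (N%:R * (`|Om 0| * L) + 1)).
have NL0 : 0 <= N%:R * (`|Om 0| * L) := mulr_ge0 N0 (mulr_ge0 (normr_ge0 _) L0).
have r20 : 0 < r2 by rewrite divr_gt0 // mulr_gt0 // ltr_wpDl.
have /nbhs_ballP[r1 /= r10 Hr1] : \forall s \near (0 : R), `|Om 0 - Om s| <= e1.
  exact: cvgr_dist_le cOm _ e10.
exists (Num.min r1 r2); first by rewrite lt_min r10.
move=> t; rewrite lt_min => /andP[tr1 tr2]; rewrite add0r Phi0 mul1mx.
set a := Num.min t 0; set b := Num.max t 0.
have ab : a <= b by rewrite ge_min le_max lexx.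
have bat : b - a = `|t|.
  rewrite /a /b; case: (leP t 0) => t0; first by rewrite sub0r ler0_norm.
  by rewrite subr0 gtr0_norm.
have tab : a <= t <= b by rewrite ge_min le_max lexx.
have oab : a <= 0 <= b by rewrite ge_min le_max lexx !orbT.
have [V [pV Vt V0]] := tP t (frame (c t) *m w).
have acc : abs_continuous a b c by exact: ac_C1.
have pB := parallel_to_frame lc acc pV.
set B := (fun s => _) in pB.
have Bt : B t = w by rewrite /B Vt mulmxA coframeK mul1mx.
have B0 : B 0 = Phi t *m w by rewrite /B V0 c0 /Phi !mulmxA.
have BM s : a <= s <= b -> `|B s| <= M.
  move=> sab; apply: mx_norm_le => [|i j]; first exact: ltW.
  rewrite ord1; have := frame_parallel_dot_in pB sab tab; rewrite Bt => /(sqr_entry_dot i).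
  by move=> /le_trans; apply; rewrite lerDl.
have tbnd s : a <= s <= b -> `|s| <= `|t|.
  by rewrite /a /b ler_norml => /andP[]; case: (leP t 0) => t0 H1 H2;
    rewrite ?(ler0_norm t0) ?(gtr0_norm t0); apply/andP; split; lra.
have OmE s : a <= s <= b -> `|Om s - Om 0| <= e1.
  by move=> sab; rewrite distrC; apply: Hr1; rewrite /ball /= sub0r normrN (le_lt_trans (tbnd _ sab)).
have OmL s : a <= s <= b -> `|Om s| <= `|Om 0| + 1.
  move=> sab; rewrite -(subrK (Om 0) (Om s)) addrC; apply: le_trans (ler_normD _ _) _.
  by rewrite lerD2l (le_trans (OmE _ sab)) // ge_min lexx.
have aeB : ae_itv a b (fun s => is_derive s (1 : R) B (- (Om s *m B s))).
  apply: ae_itvS pB.2 => s [ds dsP]; congr is_derive.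
  by rewrite /Om derive1E; have [_ ->] := dsP.
have BL s : a <= s <= b -> `|B s - w| <= L * `|t|.
  move=> sab; rewrite -Bt.
  have wl u v : a <= u -> u <= v -> v <= b -> `|B v - B u| <= L * `|t|.
    move=> au uv vb; apply: (@le_trans _ _ (L * (v - u))); last first.
      by rewrite ler_wpM2l // -bat lerB.
    apply: ac_deriv_bound => //; first exact: ac_itv pB.1.
    have [D [mD D0 sD]] := aeB; exists D; split=> // y /= nP; apply: sD => /= H.
    apply: nP => /andP[uy yv]; have yab : a <= y <= b by rewrite (le_trans au uy) (le_trans yv vb).
    exists (- (Om y *m B y)); first exact: H.
    rewrite normrN; apply: le_trans (mx_norm_mul _ _) _.
    by rewrite ler_wpM2l // ler_pM // ?OmL // BM.
  have [st|ts] := leP s t.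
    by rewrite distrC; apply: wl => //; [exact: (andP sab).1|exact: (andP tab).2].
  by apply: wl; [exact: (andP tab).1|exact: ltW|exact: (andP sab).2].
(* The expected first order term is subtracted: the derivative of [f] is small. *)
pose f s := B s + s *: (Om 0 *m w).
have acf : abs_continuous a b f.
  apply: ac_add; first exact: pB.1.
  apply: (ac_dominated1 (K := `|Om 0 *m w|) (@ac_id _ a b)) => u v _ _ _.
  by rewrite -scalerBl normrZ mulrC.
have fab : `|f b - f a| <= e * (b - a).
  apply: ac_deriv_bound => //; first exact: ltW.
  apply: ae_itv_in aeB => s sab dB; exists (- (Om s *m B s) + (1 : R) *: (Om 0 *m w)).
    apply: is_derive_add => //; apply/is_deriveP => e' e'0; exists 1 => // h _.
    by rewrite scalerDl [s *: _ + _]addrC addrK scale1r subrr normr0 mulr_ge0 // ltW.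
  apply: le_trans (norm_mulmx_sub _ _ _ _) _.
  have h1 : N%:R * (`|Om s - Om 0| * `|B s|) <= e / 2.
    apply: (@le_trans _ _ (N%:R * (e1 * M))).
      by rewrite ler_wpM2l // ler_pM // ?OmE // BM.
    apply: (@le_trans _ _ (e1 * (N%:R * M + 1))); first by rewrite [leRHS]mulrDr mulr1 [leLHS]mulrCA lerDl ltW.
    rewrite -ler_pdivlMr; last by rewrite ltr_wpDl // mulr_ge0 // ltW.
    by rewrite -mulrA -invfM; rewrite ge_min lexx orbT.
  have h2 : N%:R * (`|Om 0| * `|B s - w|) <= e / 2.
    apply: (@le_trans _ _ (N%:R * (`|Om 0| * (L * r2)))).
      rewrite ler_wpM2l // ler_wpM2l //; apply: le_trans (BL _ sab) _.
      by rewrite ler_wpM2l // ltW.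
    apply: (@le_trans _ _ (r2 * (N%:R * (`|Om 0| * L) + 1))).
      by rewrite [leRHS]mulrDr mulr1 [leLHS]mulrA [leLHS]mulrA [leLHS]mulrC -(mulrA N%:R) lerDl ltW.
    rewrite -ler_pdivlMr; last by rewrite ltr_wpDl.
    by rewrite -mulrA -invfM.
  by apply: le_trans (lerD h1 h2) _; rewrite -splitr.
rewrite -bat; apply: le_trans fab; rewrite le_eqVlt; apply/orP; left; apply/eqP.
have E : Phi t *m w - w - t *: (Om 0 *m w) = f 0 - f t.
  by rewrite /f B0 Bt scale0r addr0 opprD addrA.
rewrite E /a /b; case: (leP t 0) => t0 //.
by rewrite distrC.
Qed.

(** The lift is thus independent of the auxiliary curve. *)
Lemma rolling_lift_frame conn (q : config R m) X xi : levi_civita metric conn ->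
  rolling_lift conn q X xi ->
  [/\ xi.1.1 = X, xi.1.2 = q.2 *m X &
      xi.2 *m frame q.1.1 + q.2 *m (2^-1 *: bracket X) =
      q.2 *m frame q.1.1 *m conn_form (coframe q.1.1 *m X)].
Proof.
case: q => -[x xh] A lc; case: xi => -[xi1 xi2] xi3 [c [P [[dc cc] [c0 cX] tP]]].
move=> /is_derive_pairP[/is_derive_pairP[D1 D2] D3] /=.
have P0 : P 0 = 1%:M.
  apply: mulmx_ext => u; have [V [_ V0 V1]] := tP 0 u.
  by rewrite mul1mx -V1.
split; first exact: is_derive_unique D1 cX.
  apply: is_derive_unique D2 _; apply/is_deriveP => e e0; exists 1 => // h _.
  by rewrite add0r scale0r addr0 [xh + _]addrC addrK subrr normr0 mulr_ge0 // ltW.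
have T := is_derive_mulmx (is_derive_cst (A *m frame x) (0 : R) (1 : R)) (transport_derive lc dc cc c0 cX tP).
rewrite mul0mx add0r in T; apply: is_derive_unique _ T.
have := is_derive_mulmx D3 (is_derive_frame cX); rewrite c0 P0 mulmx1.
congr is_derive; apply/funext => t.
by rewrite !mulmxA -(mulmxA A (frame x)) frameK mulmx1.
Qed.

End Rolling.

(** * Strictness in rank at least three *)

Section Necessary.
Context {R : realType}.

Context {m : nat}.
Local Notation N := (m + vdim m)%N.
Local Notation pt := 'cV[R]_N.
Implicit Types (x y u v w a b : pt) (c B : R -> pt).

Definition phi_preserving (S : 'M[R]_N) : Prop :=
  forall a b d, phi (S *m a) (S *m b) (S *m d) = phi a b d.

(** The determinant is controlled by following the whole fundamental matrix of
    the transport equation from the identity. *)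
Lemma holonomy_at_frame conn x P : levi_civita metric conn -> holonomy_at conn x P ->
  SO R N (coframe x *m P *m frame x) /\ phi_preserving (coframe x *m P *m frame x).
Proof.
move=> lc [c [[acc ad] c0 c1 tP]]; set Pf := coframe x *m P *m frame x.
have aeh : ae_itv 0 1 (fun t => exists2 dc, is_derive t (1 : R) c dc & Delta (c t) dc) by [].
have field w : exists B, [/\ frame_parallel c 0 1 B, B 0 = w & B 1 = Pf *m w].
  have [V [pV V0 V1]] := tP (frame x *m w).
  rewrite min_l ?max_r ?ler01 // in pV.
  exists (fun t => coframe (c t) *m V t); split; first exact: parallel_to_frame pV.
    by rewrite c0 V0 mulmxA coframeK mul1mx.
  by rewrite c1 V1 !mulmxA.
have oP : Pf^T *m Pf = 1%:M.
  apply: mulmx_tr_ext => a b; have [B1 [p1 B10 B11]] := field a; have [B2 [p2 B20 B21]] := field b.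
  by rewrite -B11 -B21 -B10 -B20; apply: frame_parallel_dot p1 p2.
split; last first.
  move=> a b d; have [B1 [p1 B10 B11]] := field a; have [B2 [p2 B20 B21]] := field b.
  have [B3 [p3 B30 B31]] := field d.
  by rewrite -B11 -B21 -B31 -B10 -B20 -B30; apply: phi_const aeh p1 p2 p3.
split=> //; have [F HF] := fin_all_exists (fun j : 'I_N => field (delta_mx j 0)).
pose W t := \matrix_(i, j) F j t i 0.
have WE t j : W t *m delta_mx j 0 = F j t.
  by apply/colP => i; rewrite -colE !mxE.
have W0 : W 0 = 1%:M.
  by apply/matrixP => i j; have [_ E _] := HF j; rewrite !mxE E mxE eqxx andbT.
have W1 : W 1 = Pf.
  by apply/matrixP => i j; have [_ _ E] := HF j; rewrite mxE E -colE mxE.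
rewrite -W1; apply: (@ac_orthogonal_det R N 0 1 W) => //.
- apply: ac_mx => i j; have [[acF _] _ _] := HF j.
  by under eq_fun do rewrite mxE; exact: ac_entry.
- move=> t /andP[t0 t1]; apply/matrixP => i j.
  have [pi Ei _] := HF i; have [pj Ej _] := HF j.
  have := frame_parallel_dot t0 (frame_parallel_itv (lexx 0) t1 pi) (frame_parallel_itv (lexx 0) t1 pj).
  have rc (G : 'M[R]_N) : (delta_mx (0 : 'I_1) i *m (G *m delta_mx j (0 : 'I_1))) 0 0 = G i j.
    by rewrite -colE -rowE !mxE.
  move=> /(congr1 (fun M : 'M[R]_1 => M 0 0)); rewrite Ei Ej -!WE trmx_mul trmx_delta.
  by have := rc 1%:M; rewrite mul1mx -mulmxA (mulmxA (W t)^T) rc => ->.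
- by rewrite W0 det1.
Qed.

(** The rows of [A *m frame x] are parallel along the projection of a rolling
    curve. *)
Lemma orbit_field conn (q q1 : config R m) : levi_civita metric conn -> orbit_R conn q q1 ->
  exists2 c, ae_itv 0 1 (fun t => exists2 dc, is_derive t (1 : R) c dc & Delta (c t) dc) &
  forall w : pt, exists B, [/\ frame_parallel c 0 1 B,
    B 0 = (q.2 *m frame q.1.1)^T *m w & B 1 = (q1.2 *m frame q1.1.1)^T *m w].
Proof.
move=> lc [c [acc _ aec c0 c1]]; exists (fun t => (c t).1.1).
  apply: ae_itvS aec => t [dc dcP [X hX rl]]; exists dc.1.1; last first.
    by have [-> _ _] := rolling_lift_frame lc rl.
  exact: is_derive_fst (is_derive_fst dcP).
move=> w; exists (fun t => ((c t).2 *m frame (c t).1.1)^T *m w).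
rewrite c0 c1; split=> //; split.
  apply: ac_mulmx; last exact: ac_cst.
  apply: ac_trmx; apply: ac_mulmx; first exact: ac_snd.
  by apply: ac_frame; do 2!apply: ac_fst.
apply: ae_itvS aec => t [dc dcP [X hX rl]]; exists dc.1.1.
  exact: is_derive_fst (is_derive_fst dcP).
have [XE _ E] := rolling_lift_frame lc rl.
have D := is_derive_mulmx (is_derive_snd dcP) (is_derive_frame (is_derive_fst (is_derive_fst dcP))).
apply: (is_derive_eq (is_derive_mulmx (is_derive_trmx D) (is_derive_cst w t (1 : R)))).
rewrite mulmx0 addr0 XE E trmx_mul conn_form_tr mulNmx mulNmx -mulmxA //.
Qed.

Lemma orbit_phi conn (q q1 : config R m) : levi_civita metric conn -> orbit_R conn q q1 ->
  forall a b d,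
  phi ((q1.2 *m frame q1.1.1)^T *m a) ((q1.2 *m frame q1.1.1)^T *m b) ((q1.2 *m frame q1.1.1)^T *m d) =
  phi ((q.2 *m frame q.1.1)^T *m a) ((q.2 *m frame q.1.1)^T *m b) ((q.2 *m frame q.1.1)^T *m d).
Proof.
move=> lc O a b d; have [c aeh field] := orbit_field lc O.
have [B1 [p1 B10 B11]] := field a; have [B2 [p2 B20 B21]] := field b.
have [B3 [p3 B30 B31]] := field d.
by rewrite -B11 -B21 -B31 -B10 -B20 -B30; apply: phi_const aeh p1 p2 p3.
Qed.

(** Changing the signs of X_0 and X_1 changes the sign of
    [phi X_0 X_2 Gamma_{2,0}], which is not zero. *)
Lemma SO_not_phi_preserving : (3 <= m)%N -> exists S : 'M[R]_N,
  [/\ S^T = S, SO R N S & ~ phi_preserving S].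
Proof.
move=> m3; pose h0 := Ordinal (ltn_trans (isT : (0 < 2)%N) m3).
pose h1 := Ordinal (ltn_trans (isT : (1 < 2)%N) m3); pose h2 := Ordinal m3.
pose i0 : 'I_N := lshift (vdim m) h0; pose i1 : 'I_N := lshift (vdim m) h1.
pose e := \row_(j < N) (if (j == i0) || (j == i1) then -1 else 1 : R).
have SS : (diag_mx e)^T *m diag_mx e = 1%:M.
  rewrite tr_diag_mx mulmx_diag -diag_const_mx; congr diag_mx; apply/rowP => j; rewrite !mxE.
  by case: ifP => _; rewrite ?mulrNN mulr1.
exists (diag_mx e); split; first by rewrite tr_diag_mx.
  split=> //; rewrite det_diag (bigD1 i0) //= (bigD1 i1) //= big1 => [|j /andP[/negPf j0 /negPf j1]].
    by rewrite !mxE !eqxx orbT mulr1 mulrNN mulr1.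
  by rewrite mxE j0 j1.
have p20 : ((h2, h0).2 < (h2, h0).1)%N by [].
pose p : vpair m := exist _ (h2, h0) p20.
move=> /(_ (dh h0) (dh h2) (dv p)).
have dS i : diag_mx e *m delta_mx i (0 : 'I_1) = e 0 i *: delta_mx i (0 : 'I_1).
  apply/colP => j; rewrite mul_diag_mx !mxE eqxx andbT.
  by have [->|] := eqVneq j i; rewrite ?mulr0.
rewrite /dh /dv !dS.
have -> : e 0 (lshift (vdim m) h0) = -1 by rewrite mxE eqxx.
have -> : e 0 (lshift (vdim m) h2) = 1 by rewrite mxE !(inj_eq (@lshift_inj _ _)).
have -> : e 0 (rshift m (vpair_idx p)) = 1 by rewrite mxE !eq_rlshift.
rewrite !scale1r -/(dh h0) -/(dh h2) -/(dv p).
have -> : phi ((-1 : R) *: dh h0) (dh h2) (dv p) = - phi (dh h0) (dh h2) (dv p).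
  by rewrite /phi linearZ /= -!scalemxAl linearZ /= mulN1r.
suff -> : phi (dh h0) (dh h2) (dv p) = -1 :> R by rewrite opprK; lra.
have uh h : usubmx (dh h : pt) = delta_mx h 0.
  by apply/colP => i; rewrite !mxE (inj_eq (@lshift_inj _ _)).
have uv : usubmx (dv p : pt) = 0 by apply/colP => i; rewrite !mxE eq_lrshift.
rewrite /phi /psi !(vert_mx_hor (@dh_hor R m _)) !uh uv vert_mx_dv /= !mulmx_block !trmx0 oppr0.
rewrite !(mulmx0, mul0mx, addr0, add0r) mxtrace_block linear0 add0r.
rewrite mulNmx mulNmx linearN /= -mulmxA mxtrace_mulC trmx_delta -!mulmxA -colE -rowE.
rewrite /mxtrace big_ord1 !mxE !eqxx.
by rewrite /= subr0.
Qed.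

(** The passage from the basis [E] to the left-invariant frame is orthogonal. *)
Lemma orthonormal_change x (E : 'M[R]_N) : orthonormal_basis metric x E ->
  (coframe x *m E)^T *m (coframe x *m E) = 1%:M.
Proof. by rewrite /orthonormal_basis metricE trmx_mul !mulmxA. Qed.

Lemma holonomyE conn x (E : 'M[R]_N) S : orthonormal_basis metric x E ->
  holonomy conn x E S <->
  exists2 P, holonomy_at conn x P &
    S = (coframe x *m E)^T *m (coframe x *m P *m frame x) *m (coframe x *m E).
Proof.
move=> oE; have OO := orthonormal_change oE; set O := coframe x *m E in OO *.
have EE : E = frame x *m O by rewrite mulmxA frameK mul1mx.
have Ou : O \in unitmx by have [] := mulmx1_unit OO.
have IO : invmx O = O^T by rewrite -[LHS]mul1mx -OO mulmxK.
have IE : invmx E = O^T *m coframe x.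
  have Eu : E \in unitmx by rewrite EE unitmx_mul frame_unit Ou.
  have : (O^T *m coframe x) *m E = 1%:M by rewrite -mulmxA.
  by move=> H; rewrite -[LHS]mul1mx -H mulmxK.
have eq P : invmx E *m P *m E = O^T *m (coframe x *m P *m frame x) *m O.
  by rewrite IE EE !mulmxA.
by split=> [[P hP <-]|[P hP ->]]; exists P.
Qed.

Lemma holonomy_SO conn x (E : 'M[R]_N) : levi_civita metric conn ->
  orthonormal_basis metric x E -> holonomy conn x E `<=` SO R N.
Proof.
move=> lc oE S /(holonomyE _ _ oE)[P hP ->].
exact: SO_conj (orthonormal_change oE) (holonomy_at_frame lc hP).1.
Qed.

Lemma holonomy_proper conn x (E : 'M[R]_N) : levi_civita metric conn -> (3 <= m)%N ->
  orthonormal_basis metric x E -> exists2 S, SO R N S & ~ holonomy conn x E S.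
Proof.
move=> lc m3 oE; have [S [ST SS nS]] := SO_not_phi_preserving m3.
have OO := orthonormal_change oE.
exists ((coframe x *m E)^T *m S *m (coframe x *m E)); first exact: SO_conj.
move=> /(holonomyE _ _ oE)[P hP] /(orth_conj_inj OO) SE.
by apply: nS; rewrite SE; exact: (holonomy_at_frame lc hP).2.
Qed.

(** The frame turns isometries to the Euclidean space into elements of SO(N). *)
Lemma Q_frame (q : config R m) : Q q -> SO R N (q.2 *m frame q.1.1).
Proof.
case: q => -[x xh] A [/= AA dA]; have AF : (A *m frame x)^T *m (A *m frame x) = 1%:M.
  by rewrite trmx_mul -mulmxA (mulmxA A^T) AA -[RHS](frame_orthonormal x) !mulmxA.
split=> //; have [//|E] := orthogonal_det AF.
by move: dA; rewrite -[\det A]mulr1 -(det_frame x) -det_mulmx E; lra.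
Qed.

Lemma holonomy_R_proper conn (q : config R m) : levi_civita metric conn -> (3 <= m)%N ->
  Q q -> exists2 a, SE R N a & ~ holonomy_R conn q a.
Proof.
move=> lc m3 Qq; have [S [ST SS nS]] := SO_not_phi_preserving m3.
have CS := Q_frame Qq; set C := q.2 *m frame q.1.1 in CS.
have CC := CS.1; have CC' := mulmx1C CC.
exists (0, C *m S *m C^T).
  by apply: SO_mul; [exact: SO_mul|exact: SO_tr].
move=> [_ O]; apply: nS => a b d; have := orbit_phi lc O (C *m a) (C *m b) (C *m d).
have E w : ((SE_act (0, C *m S *m C^T) q).2 *m frame (SE_act (0, C *m S *m C^T) q).1.1)^T *m (C *m w) = S *m w.
  by rewrite /= -(mulmxA _ q.2); exact: orth_conj_act.
by rewrite !E !(mulmxA _ C) CC !mul1mx.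
Qed.

End Necessary.

(** * One-parameter groups of rotations *)

Section Rot.
Context {R : realType} {n : nat}.
Variable J : 'M[R]_n.
Hypothesis J3 : J *m J *m J = - J.

(** Rodrigues' formula for the exponential of [t *: J]. *)
Definition rot (t : R) : 'M[R]_n := 1%:M + sin t *: J + (1 - cos t) *: (J *m J).

Lemma rot0 : rot 0 = 1%:M.
Proof. by rewrite /rot sin0 cos0 subrr !scale0r !addr0. Qed.

Lemma rot_mul_gen t : rot t *m J = cos t *: J + sin t *: (J *m J).
Proof.
rewrite /rot !mulmxDl mul1mx -!scalemxAl J3 scalerN scalerBl scale1r.
by rewrite opprB [J + _]addrC -addrA subrKC addrC.
Qed.

Lemma mul_gen_rot t : J *m rot t = rot t *m J.
Proof. by rewrite /rot !mulmxDl !mulmxDr mul1mx mulmx1 -!scalemxAl -!scalemxAr mulmxA. Qed.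

Lemma rotD s t : rot (s + t) = rot s *m rot t.
Proof.
have -> : rot s *m rot t = rot s + sin t *: (rot s *m J) + (1 - cos t) *: (rot s *m J *m J).
  by rewrite {2}/rot !mulmxDr mulmx1 -!scalemxAr mulmxA.
rewrite rot_mul_gen mulmxDl -!scalemxAl J3 /rot sinD cosD.
apply/matrixP => i j; rewrite !mxE.
move: (\sum_j0 _) (J i j) ((i == j)%:R : R) => a b d; ring.
Qed.

Lemma is_derive_rot t : is_derive t (1 : R) rot (rot t *m J).
Proof.
apply/is_derive_mx => i j; rewrite rot_mul_gen !mxE.
set a := \sum_j0 _.
have -> : (fun s => rot s i j) = (fun s => ((i == j)%:R + sin s * J i j) + (1 - cos s) * a).
  by apply/funext => s; rewrite !mxE.
have D1 : is_derive t (1 : R) (fun s => sin s * J i j) (cos t * J i j).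
  apply: (is_derive_eq (is_deriveM (is_derive_sin t) (is_derive_cst (J i j) t (1 : R)))).
  by rewrite scaler0 add0r /GRing.scale /= mulrC.
have D2 : is_derive t (1 : R) (fun s => (1 - cos s) * a) (sin t * a).
  apply: (is_derive_eq (is_deriveM (is_deriveB (is_derive_cst (1 : R) t (1 : R)) (is_derive_cos t)) (is_derive_cst a t (1 : R)))).
  by rewrite scaler0 add0r /GRing.scale /= sub0r opprK mulrC.
apply: (is_derive_eq (is_derive_add (is_derive_add (is_derive_cst _ t (1 : R)) D1) D2)).
by rewrite add0r.
Qed.

Lemma rot_lipschitz s t : `|rot t - rot s| <= (`|J| + `|J *m J|) * `|t - s|.
Proof.
have sl : `|sin t - sin s| <= `|t - s|.
  rewrite -[leRHS]mul1r; apply: (lipschitz_deriv (fun x => is_derive_sin x)) => x.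
  by rewrite ler_norml cos_geN1 cos_le1.
have cl : `|cos t - cos s| <= `|t - s|.
  rewrite -[leRHS]mul1r; apply: (lipschitz_deriv (fun x => is_derive_cos x)) => x.
  by rewrite normrN ler_norml sin_geN1 sin_le1.
have -> : rot t - rot s = (sin t - sin s) *: J - (cos t - cos s) *: (J *m J).
  by rewrite /rot; apply/matrixP => i j; rewrite !mxE; ring.
apply: le_trans (ler_normB _ _) _; rewrite !normrZ mulrDl.
by apply: lerD; rewrite mulrC ler_wpM2l.
Qed.

Hypothesis JT : J^T = - J.

Lemma rot_tr t : (rot t)^T = rot (- t).
Proof.
rewrite /rot !linearD /= !linearZ /= trmx1 trmx_mul JT mulNmx mulmxN opprK sinN cosN.
by rewrite scalerN scaleNr.
Qed.

Lemma rotNK t : rot (- t) *m rot t = 1%:M.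
Proof. by rewrite -rotD addNr rot0. Qed.

(** A rotation is the square of the rotation by half the angle, so its
    determinant is positive. *)
Lemma rot_SO t : SO R n (rot t).
Proof.
have O s : (rot s)^T *m rot s = 1%:M by rewrite rot_tr rotNK.
split=> //; rewrite [t]splitr rotD det_mulmx.
by have [->|->] := orthogonal_det (O (t / 2)); rewrite ?mulr1 // mulrNN mulr1.
Qed.

End Rot.

Section Steer.
Context {R : realType} {m : nat}.
Local Notation N := (m + vdim m)%N.
Local Notation pt := 'cV[R]_N.
Implicit Types (x y u v w a b e : pt) (c : R -> config R m) (s g : config R m).

Definition unit_horizontal e := horizontal e /\ e^T *m e = 1%:M.

(** The infinitesimal rotation produced by rolling in the direction [e]; the
    factor 2 normalizes it, see [rot_gen3]. *)
Definition rot_gen e : 'M[R]_N := 2 *: conn_form e.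

Lemma rot_genT e : (rot_gen e)^T = - rot_gen e.
Proof. by rewrite linearZ /= conn_form_tr scalerN. Qed.

Lemma rot_genE e a : horizontal e ->
  rot_gen e *m a = bracket e *m a + col_mx (vert_mx a *m usubmx e) 0.
Proof.
move=> he; rewrite /rot_gen conn_form_hor // scalerA divff ?pnatr_eq0 // scale1r mulmxBl tr_bracketE.
by rewrite opp_col_mx opprK oppr0.
Qed.

Lemma hor_col e : horizontal e -> e = col_mx (usubmx e) 0.
Proof.
move=> he; rewrite -[LHS]vsubmxK; congr col_mx; apply/colP => i; rewrite !mxE.
by have := he (idx_vpair i); rewrite /vcoord idx_vpairK.
Qed.

Lemma hor_dot e a : horizontal e -> e^T *m a = (usubmx e)^T *m usubmx a.
Proof.
move=> he; rewrite {1}(hor_col he) -[a in LHS]vsubmxK tr_col_mx mul_row_col trmx0 mul0mx.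
by rewrite addr0.
Qed.

Lemma usubmx_bracket u a : usubmx (bracket u *m a) = 0.
Proof.
by apply/colP => i; rewrite mxE; have := hcoord_bracket u a i; rewrite /hcoord => ->; rewrite mxE.
Qed.

Lemma bracket_usub u a b : usubmx a = usubmx b -> bracket u *m a = bracket u *m b.
Proof.
move=> E; rewrite bracketC [RHS]bracketC; congr (- (_ *m _)); apply: bracket_hcoord => h.
by have := congr1 (fun M : 'cV_m => M h 0) E; rewrite !mxE.
Qed.

Lemma vert_mx_col0 (v : 'cV[R]_m) : vert_mx (col_mx v 0) = 0.
Proof. by apply: vert_mx_hor => p; rewrite /vcoord col_mxEd mxE. Qed.

Lemma usubmx_rot_gen e a : horizontal e -> usubmx (rot_gen e *m a) = vert_mx a *m usubmx e.
Proof. by move=> he; rewrite rot_genE // linearD /= usubmx_bracket add0r col_mxKu. Qed.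

Lemma vert_mx_rot_gen e a : horizontal e -> vert_mx (rot_gen e *m a) =
  usubmx e *m (usubmx a)^T - usubmx a *m (usubmx e)^T.
Proof. by move=> he; rewrite rot_genE // linearD /= vert_mx_col0 addr0 vert_mx_bracket. Qed.

Lemma bracket_self u : bracket u *m u = 0.
Proof.
apply/colP => i; rewrite [RHS]mxE; case: (split_ordP i) => j ->.
  by have := hcoord_bracket u u j; rewrite /hcoord => ->.
by rewrite bracketE; case: (val _) => h k; rewrite mulrC subrr.
Qed.

(** Under [psi] this is the bracket with a rank two element of so(1 + m), whose
    eigenvalues are 0, i and -i. *)
Lemma rot_gen3 e : unit_horizontal e -> rot_gen e *m rot_gen e *m rot_gen e = - rot_gen e.
Proof.
move=> [he ee]; apply: mulmx_ext => a; rewrite -!mulmxA mulNmx.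
have ue : (usubmx e)^T *m usubmx e = 1%:M by rewrite -hor_dot.
set h := usubmx e in ue; set v := usubmx a; set G := vert_mx a.
have u2 : usubmx (rot_gen e *m (rot_gen e *m a)) = usubmx ((v^T *m h) 0 0 *: e - a).
  rewrite usubmx_rot_gen // vert_mx_rot_gen // linearB linearZ /= -/h -/v mulmxBl -!mulmxA ue mulmx1.
  by rewrite {1}[v^T *m h]mx11_scalar mul_mx_scalar.
have v2 : vert_mx (rot_gen e *m (rot_gen e *m a)) *m h = - (G *m h).
  rewrite vert_mx_rot_gen // usubmx_rot_gen // -/h -/G mulmxBl -!mulmxA ue mulmx1.
  have q0 : h^T *m (G *m h) = 0.
    have qT : (h^T *m (G *m h))^T = - (h^T *m (G *m h)).
      by rewrite !trmx_mul trmxK vert_mx_tr mulmxN mulNmx mulmxA.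
    move: (h^T *m (G *m h)) qT => q /matrixP/(_ 0 0); rewrite mxE [RHS]mxE => E.
    by apply/matrixP => i j; rewrite !ord1 mxE; lra.
  have -> : (G *m h)^T *m h = 0 by rewrite -[LHS]trmxK trmx_mul trmxK q0 trmx0.
  by rewrite mulmx0 sub0r.
rewrite [LHS]rot_genE // v2 (bracket_usub _ u2) mulmxBr -scalemxAr.
by rewrite bracket_self scaler0 sub0r rot_genE // opprD opp_col_mx oppr0.
Qed.

End Steer.

(** * Steering the rolling system *)

Section Steers.
Context {R : realType} {m : nat}.
Local Notation N := (m + vdim m)%N.
Local Notation pt := 'cV[R]_N.
Implicit Types (x y u v w a b e : pt) (c : R -> config R m) (s g : config R m).

(** Curves that stop before time 0 and after time 1 are concatenated by mere
    addition, which is why the time is the whole line; the list [L] holds the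
    corners. *)
Definition steers s0 s1 := exists c (K : R) (L : seq R),
  [/\ (forall t t', `|c t' - c t| <= K * `|t' - t|),
      (forall t, t <= 0 -> c t = s0) /\ (forall t, 1 <= t -> c t = s1),
      (forall t, SO R N (c t).2) &
      (forall t, t \notin L -> exists2 u, horizontal u &
         is_derive t (1 : R) c
           (frame (c t).1.1 *m u, (c t).2 *m u, (c t).2 *m conn_form u))].

Lemma horizontal0 : horizontal (0 : pt).
Proof. by move=> p; rewrite /vcoord mxE. Qed.

Lemma horizontalZ (k : R) u : horizontal u -> horizontal (k *: u).
Proof. by move=> hu p; have := hu p; rewrite /vcoord mxE => ->; rewrite mulr0. Qed.

Lemma horizontalD u v : horizontal u -> horizontal v -> horizontal (u + v).
Proof. by move=> hu hv p; have := hu p; have := hv p; rewrite /vcoord mxE => -> ->; rewrite addr0. Qed.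

Lemma pairZ (U V : lmodType R) (k : R) (u : U) (v : V) : k *: (u, v) = (k *: u, k *: v).
Proof. by []. Qed.

(** Since the first curve is at rest when the second one moves and conversely, the
    concatenation is [c1 (2 t) + c2 (2 t - 1) - s1]. *)
Lemma steers_trans s0 s1 s2 : steers s0 s1 -> steers s1 s2 -> steers s0 s2.
Proof.
move=> [c1 [K1 [L1 [lip1 [c10 c11] so1 d1]]]] [c2 [K2 [L2 [lip2 [c20 c21] so2 d2]]]].
pose c (t : R) := c1 (2 * t + 0) + (c2 (2 * t + -1) - s1).
have cl t : t <= 1 / 2 -> c t = c1 (2 * t + 0).
  by move=> ht; rewrite /c c20 ?subrr ?addr0 //; lra.
have cr t : 1 / 2 <= t -> c t = c2 (2 * t + -1).
  by move=> ht; rewrite /c c11 ?subrKC //; lra.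
have K0 : 0 <= K1 by have := lip1 0 1; rewrite subr0 normr1 mulr1; apply: le_trans.
have K0' : 0 <= K2 by have := lip2 0 1; rewrite subr0 normr1 mulr1; apply: le_trans.
exists c, ((K1 + K2) * 2), (1 / 2 :: [seq t / 2 | t <- L1] ++ [seq (t + 1) / 2 | t <- L2]).
split.
- move=> t t'; have -> : c t' - c t = (c1 (2 * t' + 0) - c1 (2 * t + 0)) + (c2 (2 * t' + -1) - c2 (2 * t + -1)).
    rewrite /c opprD addrACA; congr (_ + _).
    by rewrite opprB subrKA.
  apply: le_trans (ler_normD _ _) _.
  apply: le_trans (lerD (lip1 _ _) (lip2 _ _)) _.
  have -> : 2 * t' + 0 - (2 * t + 0) = 2 * (t' - t) by ring.
  have -> : 2 * t' + -1 - (2 * t + -1) = 2 * (t' - t) by ring.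
  by rewrite -mulrDl normrM ger0_norm // mulrA.
- split=> t ht; first by rewrite cl ?c10 //; lra.
  by rewrite cr ?c21 //; lra.
- by move=> t; have [ht|/ltW ht] := leP t (1 / 2); rewrite ?(cl _ ht) ?(cr _ ht).
- move=> t; rewrite inE mem_cat !negb_or => /and3P[t2 tL1 tL2].
  have [ht|ht] := ltP t (1 / 2).
    have [|u hu du] := d1 (2 * t + 0).
      by apply: contra tL1 => H; apply/mapP; exists (2 * t + 0) => //; lra.
    exists (2 *: u); first exact: horizontalZ.
    rewrite (cl _ (ltW ht)); apply: (is_derive_near (r := 1 / 2 - t) _ _ (is_derive_eq (is_derive_line du) _)).
    + by rewrite subr_gt0.
    + by move=> h; rewrite ltr_norml => /andP[_ hh]; rewrite cl //; lra.
    + by rewrite !pairZ [conn_form (2 *: u)]linearZ /= -!scalemxAr.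
  have {ht t2}ht : 1 / 2 < t by rewrite lt_neqAle eq_sym t2.
  have [|u hu du] := d2 (2 * t + -1).
    by apply: contra tL2 => H; apply/mapP; exists (2 * t + -1) => //; lra.
  exists (2 *: u); first exact: horizontalZ.
  rewrite (cr _ (ltW ht)); apply: (is_derive_near (r := t - 1 / 2) _ _ (is_derive_eq (is_derive_line du) _)).
  + by rewrite subr_gt0.
  + by move=> h; rewrite ltr_norml => /andP[hh _]; rewrite cr //; lra.
  + by rewrite !pairZ [conn_form (2 *: u)]linearZ /= -!scalemxAr.
Qed.

(** The product of the Carnot group and the group of rigid motions. *)
Definition state_mul s g : config R m := (star s.1.1 g.1.1, s.1.2 + s.2 *m g.1.2, s.2 *m g.2).

(** By left invariance, an element reached from the identity can be reached by
    right multiplication from any state. *)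
Definition reach g := forall s, SO R N s.2 -> steers s (state_mul s g).

Lemma bracket_star x y : bracket (star x y) = bracket x + bracket y.
Proof. by rewrite starE linearD /= bracket_frame. Qed.

Lemma star_bracket x y : star x y = x + y + 2^-1 *: (bracket x *m y).
Proof. by rewrite starE frameE mulmxDl mul1mx -scalemxAl addrA. Qed.

Lemma starA x y z : star (star x y) z = star x (star y z).
Proof.
rewrite [LHS]star_bracket bracket_star [RHS]star_bracket !star_bracket !mulmxDl !mulmxDr -!scalemxAr mulmxA bracket_bracket mul0mx.
rewrite !scaler0 addr0 !scalerDr; apply/colP => i; rewrite !mxE; ring.
Qed.

Lemma state_mulA s g h : state_mul (state_mul s g) h = state_mul s (state_mul g h).
Proof. by rewrite /state_mul /= starA mulmxDr !mulmxA addrA. Qed.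

Lemma steers_SO s0 s1 : steers s0 s1 -> SO R N s1.2.
Proof. by move=> [c [K [L [_ [_ c1] so _]]]]; rewrite -(c1 1). Qed.

Lemma reach_mul g h : reach g -> reach h -> reach (state_mul g h).
Proof.
move=> rg rh s ss; have H := rg s ss; apply: (steers_trans H).
by rewrite -state_mulA; apply: rh; exact: steers_SO H.
Qed.

Definition clamp (t : R) := Num.max 0 (Num.min 1 t).

Lemma clamp_lipschitz t t' : `|clamp t' - clamp t| <= `|t' - t|.
Proof.
wlog tt : t t' / t <= t' => [H|].
  have [tt|/ltW tt] := leP t t'; first exact: H.
  by rewrite distrC [leRHS]distrC H.
rewrite [leRHS]ger0_norm ?subr_ge0 // /clamp.
by case: (leP 1 t) => h1; case: (leP 1 t') => h2; rewrite ?(max_r ler01);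
  case: (leP 0 t) => h3; case: (leP 0 t') => h4; rewrite ler_norml;
  apply/andP; split; lra.
Qed.

Lemma conn_form_rot_gen (k : R) e : conn_form (k *: e) = (k / 2) *: rot_gen e.
Proof. by rewrite /rot_gen linearZ /= scalerA divfK // pnatr_eq0. Qed.

Lemma rot_gen_self e : horizontal e -> rot_gen e *m e = 0.
Proof. by move=> he; rewrite rot_genE // bracket_self vert_mx_hor // mul0mx add0r col_mx0. Qed.

Lemma frame_line x e t : frame (x + t *: (frame x *m e)) *m e = frame x *m e.
Proof.
rewrite frameE linearD linearZ /= bracket_frame mulmxDl mul1mx -scalemxAl mulmxDl -scalemxAl.
by rewrite bracket_self scaler0 addr0 frameE mulmxDl mul1mx -scalemxAl.
Qed.

Lemma rot_kernel n (J : 'M[R]_n) (v : 'cV[R]_n) t : J *m v = 0 -> rot J t *m v = v.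
Proof.
move=> Jv; rewrite /rot !mulmxDl mul1mx -!scalemxAl -mulmxA Jv mulmx0.
by rewrite !scaler0 !addr0.
Qed.

Lemma rot_fix e t : horizontal e -> rot (rot_gen e) t *m e = e.
Proof. by move=> he; apply: rot_kernel; exact: rot_gen_self. Qed.

Lemma is_derive_rot_line n (J C : 'M[R]_n) (k r : R) : J *m J *m J = - J ->
  is_derive r (1 : R) (fun q => C *m rot J (k * q)) (k *: (C *m rot J (k * r) *m J)).
Proof.
move=> J3; have D := is_derive_line (a := k) (b := 0) (is_derive_rot J3 (k * r + 0)).
have {}D : is_derive r (1 : R) (fun q => rot J (k * q)) (k *: (rot J (k * r) *m J)).
  by rewrite addr0 in D; congr is_derive: D; apply/funext => q; rewrite addr0.
apply: (is_derive_eq (is_derive_mulmx (is_derive_cst C r (1 : R)) D)).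
by rewrite mul0mx add0r -scalemxAr mulmxA.
Qed.

Lemma scalemx_frame_line x e t T : frame (x + t *: (frame x *m e)) *m (T *: e) = T *: (frame x *m e).
Proof. by rewrite -scalemxAr frame_line. Qed.

Lemma mulmx_rot_fix (C : 'M[R]_N) e t T : horizontal e ->
  C *m rot (rot_gen e) t *m (T *: e) = T *: (C *m e).
Proof. by move=> he; rewrite -scalemxAr -mulmxA rot_fix. Qed.

Lemma mulmx_conn_form (C : 'M[R]_N) e T : C *m conn_form (T *: e) = (T / 2) *: (C *m rot_gen e).
Proof. by rewrite conn_form_rot_gen scalemxAr. Qed.

(** A constant control: [e] is fixed by the rotation it generates, so the curve
    is a one-parameter subgroup. *)
Lemma steers_segment (T : R) e s : unit_horizontal e -> SO R N s.2 ->
  steers s (state_mul s (T *: e, T *: e, rot (rot_gen e) (T / 2))).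
Proof.
move=> ue ss; have [he ee] := ue; have J3 := rot_gen3 ue; have JT := rot_genT e.
case: s ss => -[x y] C /= ss.
(* the one-parameter subgroup, before its time is clamped to [0, 1] *)
pose g (r : R) : config R m :=
  (x + (T * r) *: (frame x *m e), y + (T * r) *: (C *m e), C *m rot (rot_gen e) (T / 2 * r)).
have dg r : is_derive r (1 : R) g
    (frame (g r).1.1 *m (T *: e), (g r).2 *m (T *: e), (g r).2 *m conn_form (T *: e)).
  have d1 : is_derive r (1 : R) (fun q => x + (T * q) *: (frame x *m e)) (frame (x + (T * r) *: (frame x *m e)) *m (T *: e)).
    by rewrite scalemx_frame_line; exact: is_derive_affine.
  have d2 : is_derive r (1 : R) (fun q => y + (T * q) *: (C *m e)) (C *m rot (rot_gen e) (T / 2 * r) *m (T *: e)).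
    by rewrite mulmx_rot_fix //; exact: is_derive_affine.
  have d3 : is_derive r (1 : R) (fun q => C *m rot (rot_gen e) (T / 2 * q)) (C *m rot (rot_gen e) (T / 2 * r) *m conn_form (T *: e)).
    by rewrite mulmx_conn_form; exact: is_derive_rot_line.
  apply/is_derive_pairP; split; last exact: d3.
  by apply/is_derive_pairP; split; [exact: d1|exact: d2].
pose K := `|T| * `|frame x *m e| + `|T| * `|C *m e| +
  N%:R * (`|C| * ((`|rot_gen e| + `|rot_gen e *m rot_gen e|) * `|T / 2|)).
have K1 : 0 <= `|T| * `|frame x *m e| by rewrite mulr_ge0.
have K2 : 0 <= `|T| * `|C *m e| by rewrite mulr_ge0.
have K3 : 0 <= N%:R * (`|C| * ((`|rot_gen e| + `|rot_gen e *m rot_gen e|) * `|T / 2|)).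
  by rewrite !mulr_ge0 // addr_ge0.
have lg r r' : `|g r' - g r| <= K * `|r' - r|.
  have r0 := normr_ge0 (r' - r).
  rewrite !prod_normE /= !ge_max -!andbA; apply/and3P; split.
  - rewrite opprD addrACA subrr add0r -scalerBl -mulrBr normrZ normrM mulrAC.
    by rewrite ler_wpM2r // /K; lra.
  - rewrite opprD addrACA subrr add0r -scalerBl -mulrBr normrZ normrM mulrAC.
    by rewrite ler_wpM2r // /K; lra.
  - rewrite -mulmxBr; apply: le_trans (mx_norm_mul _ _) _.
    have rl : `|rot (rot_gen e) (T / 2 * r') - rot (rot_gen e) (T / 2 * r)| <=
        (`|rot_gen e| + `|rot_gen e *m rot_gen e|) * `|T / 2| * `|r' - r|.
      by apply: le_trans (rot_lipschitz _ _ _) _; rewrite -(mulrBr (T / 2)) (normrM (T / 2)) mulrA.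
    apply: (@le_trans _ _ (N%:R * (`|C| * ((`|rot_gen e| + `|rot_gen e *m rot_gen e|) * `|T / 2|)) * `|r' - r|)).
      by rewrite -(mulrA N%:R) -(mulrA `|C|) ler_wpM2l // ler_wpM2l.
    by rewrite ler_wpM2r // /K; lra.
have K0 : 0 <= K by exact: addr_ge0 (addr_ge0 K1 K2) K3.
have g0 : g 0 = (x, y, C) by rewrite /g !mulr0 !scale0r !addr0 rot0 mulmx1.
have g1 : g 1 = state_mul (x, y, C) (T *: e, T *: e, rot (rot_gen e) (T / 2)).
  by rewrite /g /state_mul /= !mulr1 starE -!scalemxAr.
have cl0 t : t <= 0 -> clamp t = 0.
  by move=> t0; rewrite /clamp min_r ?max_l // (le_trans t0).
have cl1 t : 1 <= t -> clamp t = 1.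
  by move=> t1; rewrite /clamp min_l // max_r.
have cl t : 0 <= t <= 1 -> clamp t = t.
  by move=> /andP[t0 t1]; rewrite /clamp min_r // max_r.
exists (fun t => g (clamp t)), K, [:: 0; 1]; split.
- move=> t t'; apply: le_trans (lg _ _) _.
  by rewrite ler_wpM2l // clamp_lipschitz.
- by split=> t ht; [rewrite cl0 ?g0|rewrite cl1 ?g1].
- by move=> t; apply: SO_mul => //; exact: rot_SO.
- move=> t; rewrite !inE negb_or => /andP[t0 t1].
  (* outside [0, 1] the curve is at rest, with zero control *)
  have Z (A B C' : 'M[R]_N) : (A *m 0, B *m 0, C' *m conn_form 0) = 0 :> config R m.
    by rewrite (linear0 conn_form) !mulmx0.
  have [tn|tp] := ltP t 0.
    exists 0; first exact: horizontal0.
    rewrite Z; apply: (is_derive_near (r := - t) _ _ (is_derive_cst (g 0) t (1 : R))).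
      by rewrite oppr_gt0.
    by move=> h; rewrite ltr_norml => /andP[_ hh]; rewrite cl0 //; lra.
  have [t1'|tn1] := ltP 1 t.
    exists 0; first exact: horizontal0.
    rewrite Z; apply: (is_derive_near (r := t - 1) _ _ (is_derive_cst (g 1) t (1 : R))).
      by rewrite subr_gt0.
    by move=> h; rewrite ltr_norml => /andP[hh _]; rewrite cl1 //; lra.
  exists (T *: e); first exact: horizontalZ.
  have t0' : 0 < t by rewrite lt_neqAle eq_sym t0.
  have t1' : t < 1 by rewrite lt_neqAle t1.
  rewrite cl ?tp //; apply: (is_derive_near (r := Num.min t (1 - t)) _ _ (dg t)).
    by rewrite lt_min t0' subr_gt0.
  move=> h; rewrite lt_min !ltr_norml => /andP[/andP[h1 h2] /andP[h3 h4]].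
  by rewrite cl //; apply/andP; split; lra.
Qed.

End Steers.

(** * Elements reached by the rolling system *)

Section Sufficient.
Context {R : realType} {m : nat}.
Local Notation N := (m + vdim m)%N.
Local Notation pt := 'cV[R]_N.
Implicit Types (x y u v w a b e f : pt) (c : R -> config R m) (s g : config R m).

Lemma reach_segment (T : R) e : unit_horizontal e -> reach (T *: e, T *: e, rot (rot_gen e) (T / 2)).
Proof. by move=> ue s; exact: steers_segment. Qed.

Lemma rot2pi n (J : 'M[R]_n) : rot J (pi *+ 2) = 1%:M.
Proof. by rewrite /rot sin2pi cos2pi subrr !scale0r !addr0. Qed.

Lemma reach_unit e : unit_horizontal e -> reach ((pi *+ 4) *: e, (pi *+ 4) *: e, 1%:M).
Proof.
move=> ue; have := reach_segment (pi *+ 4) ue; rewrite (_ : pi *+ 4 / 2 = pi *+ 2) ?rot2pi //.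
by rewrite -mulr_natr -[in RHS]mulr_natr; field.
Qed.

Lemma state_mul1 x y x' y' : state_mul (x, y, 1%:M) (x', y', 1%:M) = (star x x', y + y', 1%:M) :> config R m.
Proof. by rewrite /state_mul /= !mul1mx. Qed.

(** Unit vectors of the plane spanned by [e] and [f]. *)
Lemma unit_horizontal_comb (c s : R) e f : unit_horizontal e -> unit_horizontal f -> e^T *m f = 0 ->
  c ^+ 2 + s ^+ 2 = 1 -> unit_horizontal (c *: e + s *: f).
Proof.
move=> [he ee] [hf ff] ef cs; split.
  by apply: horizontalD; exact: horizontalZ.
have fe : f^T *m e = 0 by rewrite -[LHS]trmxK trmx_mul trmxK ef trmx0.
rewrite [(_ + _)^T]linearD /= ![(_ *: _)^T]linearZ /= mulmxDl !mulmxDr -!scalemxAl -!scalemxAr ee ff ef fe.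
by rewrite !scaler0 addr0 add0r !scalerA -scalerDl -!expr2 cs scale1r.
Qed.

(** The vertical contributions of the two halves are opposite. *)
Lemma star_palindrome a b : star (star a b) (star b a) = a + b + (b + a).
Proof.
have P1 : (bracket a + bracket b) *m (b + a) = 0.
  by rewrite mulmxDl !mulmxDr !bracket_self addr0 add0r [bracket b *m a]bracketC subrr.
have P2 : (bracket a + bracket b) *m (bracket a *m b) = 0.
  by rewrite mulmxA mulmxDl !bracket_bracket addr0 mul0mx.
rewrite [LHS]star_bracket bracket_star !star_bracket [bracket b *m a]bracketC.
rewrite mulmxDr P1 -scalemxAr mulmxN P2 oppr0 scaler0 addr0 scaler0 addr0.
by rewrite scalerN addrACA subrr addr0.
Qed.

(** [r *: e] is half the sum of two unit vectors placed symmetrically with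
    respect to [e]; each is followed for time 4 pi, when the rotation is trivial, and
    the palindrome removes the vertical part. *)
Lemma reach_short_translation (r : R) e f : unit_horizontal e -> unit_horizontal f -> e^T *m f = 0 ->
  `|r| <= 1 -> reach ((pi *+ 16 * r) *: e, (pi *+ 16 * r) *: e, 1%:M).
Proof.
move=> ue uf ef r1; pose s := Num.sqrt (1 - r ^+ 2).
have s2 : s ^+ 2 = 1 - r ^+ 2.
  rewrite sqr_sqrtr // subr_ge0 -real_normK ?num_real // expr_le1 //.
have u1 : unit_horizontal (r *: e + s *: f) by apply: unit_horizontal_comb => //; rewrite s2 subrKC.
have u2 : unit_horizontal (r *: e + (- s) *: f) by apply: unit_horizontal_comb => //; rewrite sqrrN s2 subrKC.
set a := (pi *+ 4) *: (r *: e + s *: f); set b := (pi *+ 4) *: (r *: e + (- s) *: f).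
have H := reach_mul (reach_mul (reach_unit u1) (reach_unit u2)) (reach_mul (reach_unit u2) (reach_unit u1)).
rewrite !state_mul1 -/a -/b in H.
have E : a + b + (b + a) = (pi *+ 16 * r) *: e.
  by rewrite /a /b; apply/colP => i; rewrite !mxE; ring.
by rewrite star_palindrome E in H.
Qed.

Lemma reach_translation_mulrn k (r : R) e : reach (r *: e, r *: e, 1%:M) ->
  reach ((r *+ k.+1) *: e, (r *+ k.+1) *: e, 1%:M).
Proof.
move=> H; elim: k => [|k IH]; first by rewrite !mulr1n.
have := reach_mul IH H; rewrite state_mul1 star_bracket [bracket (_ *: e)]linearZ /= -scalemxAl -scalemxAr.
by rewrite bracket_self !scaler0 addr0 -!scalerDl -mulrSr.
Qed.

Lemma reach_translation (r : R) e f : unit_horizontal e -> unit_horizontal f -> e^T *m f = 0 ->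
  reach (r *: e, r *: e, 1%:M).
Proof.
move=> ue uf ef; pose k := Num.bound `|r / (pi *+ 16)|.
have p16 : 0 < pi *+ 16 :> R by rewrite mulrn_wgt0 // pi_gt0.
(* [pi *+ 16 * r'] is at most [pi *+ 16]; it is repeated [k.+1] times *)
pose r' := r / (pi *+ 16) / k.+1%:R.
have k0 : 0 < k.+1%:R :> R by rewrite ltr0n.
have r1 : `|r'| <= 1.
  rewrite normrM normfV [`|k.+1%:R|]gtr0_norm // ler_pdivrMr // mul1r.
  apply: ltW; apply: lt_trans (archi_boundP (normr_ge0 _)) _.
  by rewrite ltr_nat.
have := reach_translation_mulrn k (reach_short_translation ue uf ef r1).
have -> : (pi *+ 16 * r') *+ k.+1 = r; last by [].
by rewrite -mulr_natr -mulrA divfK ?gt_eqF // mulrCA divff ?mulr1 // gt_eqF.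
Qed.

(** The segment along [e] is undone by a translation that does not rotate. *)
Lemma reach_rot (t : R) e f : unit_horizontal e -> unit_horizontal f -> e^T *m f = 0 ->
  reach (0, 0, rot (rot_gen e) t).
Proof.
move=> ue uf ef; have he := ue.1.
have := reach_mul (reach_segment (2 * t) ue) (reach_translation (- (2 * t)) ue uf ef).
have -> : 2 * t / 2 = t by field.
rewrite /state_mul /= mulmx1 -(scalemxAr (- (2 * t)) _ e) rot_fix //.
have -> : star ((2 * t) *: e) (- (2 * t) *: e) = 0.
  rewrite star_bracket [bracket (_ *: e)]linearZ /= -scalemxAl -scalemxAr bracket_self !scaler0 addr0.
  by rewrite -scalerDl subrr scale0r.
by rewrite -scalerDl subrr scale0r.
Qed.

(** Translations form a normal subgroup. *)
Lemma reach_conj (C : 'M[R]_N) y : reach (0, 0, C) -> reach (0, 0, C^T) -> SO R N C ->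
  reach (0, y, 1%:M) -> reach (0, C *m y, 1%:M).
Proof.
move=> rC rCT [CC _] ry; have := reach_mul (reach_mul rC ry) rCT.
rewrite /state_mul /= !starE !mulmx0 !addr0 add0r mulmx1.
by rewrite (mulmx1C CC).
Qed.

(** Going along [- r / 2] after turning by [C], turning back and then going along
    [r / 2] returns to the base point; in the Euclidean space the two displacements add
    up, since [C] reverses [e]. *)
Lemma reach_displace (C : 'M[R]_N) (r : R) e f : unit_horizontal e -> unit_horizontal f -> e^T *m f = 0 ->
  reach (0, 0, C) -> reach (0, 0, C^T) -> SO R N C -> C *m e = - e ->
  reach (0, r *: e, 1%:M).
Proof.
move=> ue uf ef rC rCT [CC _] Ce.
have T q := reach_translation q ue uf ef.
have := reach_mul (reach_mul (reach_mul rC (T (- (r / 2)))) rCT) (T (r / 2)).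
rewrite /state_mul /= !mulmx1 (mulmx1C CC) !mulmx0 !addr0 !add0r mul1mx.
rewrite -(scalemxAr (- (r / 2)) C e) Ce scalerN scaleNr opprK -scalerDl -splitr.
have -> : star (star (star 0 (- (r / 2 *: e))) 0) ((r / 2) *: e) = 0 :> pt.
  rewrite !star_bracket [bracket 0]linear0 mul0mx !mulmx0 !scaler0 !addr0 add0r addNr add0r.
  rewrite -scaleNr [bracket (_ *: e)]linearZ /= -scalemxAl -scalemxAr bracket_self.
  by rewrite !scaler0.
by [].
Qed.

Lemma reach_translationD y y' : reach (0, y, 1%:M) -> reach (0, y', 1%:M) -> reach (0, y + y', 1%:M).
Proof.
by move=> H H'; have := reach_mul H H'; rewrite state_mul1 starE mulmx0 addr0.
Qed.

Lemma reach_rotated y (C : 'M[R]_N) : reach (0, y, 1%:M) -> reach (0, 0, C) -> reach (0, y, C).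
Proof.
by move=> H H'; have := reach_mul H H'; rewrite /state_mul /= !mul1mx starE mulmx0 !addr0.
Qed.

Lemma reach_rotM (C D : 'M[R]_N) : reach (0, 0, C) -> reach (0, 0, D) -> reach (0, 0, C *m D).
Proof.
by move=> H H'; have := reach_mul H H'; rewrite /state_mul /= starE !mulmx0 !addr0.
Qed.

Lemma steers_fiber x y0 y1 (C0 C1 : 'M[R]_N) :
  (forall y C, SO R N C -> reach (0, y, C)) -> SO R N C0 -> SO R N C1 ->
  steers (x, y0, C0) (x, y1, C1).
Proof.
move=> H s0 s1; have CC := mulmx1C s0.1.
have := H (C0^T *m (y1 - y0)) (C0^T *m C1) (SO_mul (SO_tr s0) s1) (x, y0, C0) s0.
by rewrite /state_mul /= starE mulmx0 addr0 !mulmxA CC !mul1mx subrKC.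
Qed.

(** [C^T *m C0] carries the frame components of a parallel field. *)
Lemma steers_holonomy conn x y0 y1 (C0 C1 : 'M[R]_N) : levi_civita metric conn ->
  steers (x, y0, C0) (x, y1, C1) ->
  holonomy_at conn x (frame x *m (C1^T *m C0) *m coframe x).
Proof.
move=> lc [c [K [L [lip [c0 c1] so dc]]]].
have acc : abs_continuous 0 1 c by exact: ac_globally_lipschitz lip.
have acx : abs_continuous 0 1 (fun t => (c t).1.1) by do 2!apply: ac_fst.
exists (fun t => (c t).1.1); split.
- split=> //; apply: (ae_itv_list (s := L)) => t _ tL; have [u hu du] := dc t tL.
  by exists (frame (c t).1.1 *m u); [exact: is_derive_fst (is_derive_fst du)|apply/DeltaP; exists u].
- by rewrite c0.
- by rewrite c1.
- move=> v; exists (fun t => frame (c t).1.1 *m ((c t).2^T *m (C0 *m (coframe x *m v)))).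
  rewrite min_l ?max_r ?ler01 // c0 // c1 //=; split.
  + apply: parallel_of_frame => //; split.
      by apply: ac_mulmx; [apply: ac_trmx; exact: ac_snd|exact: ac_cst].
    apply: (ae_itv_list (s := L)) => t _ tL; have [u hu du] := dc t tL.
    exists (frame (c t).1.1 *m u); first exact: is_derive_fst (is_derive_fst du).
    rewrite (mulmxA (coframe (c t).1.1)) coframeK mul1mx.
    apply: (is_derive_eq (is_derive_mulmx (is_derive_trmx (is_derive_snd du)) (is_derive_cst _ t (1 : R)))).
    by rewrite mulmx0 addr0 trmx_mul conn_form_tr mulNmx mulNmx -mulmxA.
  + have := so 0; rewrite c0 // => -[CC _].
    by rewrite (mulmxA C0^T) CC mul1mx mulmxA frameK mul1mx.
  + by rewrite !mulmxA.
Qed.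

End Sufficient.

(** * From steering to holonomy *)

Section Lift.
Context {R : realType} {m : nat}.
Local Notation N := (m + vdim m)%N.
Local Notation pt := 'cV[R]_N.
Implicit Types (x y u v w a b e f : pt).

Lemma frame_parallel_line x (T : R) e w (t p q : R) : unit_horizontal e ->
  frame_parallel (fun s => x + (T * s) *: (frame x *m e)) p q
    (fun s => rot (rot_gen e) (- (T / 2) * s + T / 2 * t) *m w).
Proof.
move=> ue; have J3 := rot_gen3 ue; have he := ue.1; split.
  apply: ac_mulmx; last exact: ac_cst.
  apply: (ac_globally_lipschitz (K := (`|rot_gen e| + `|rot_gen e *m rot_gen e|) * `|T / 2|)) => s s'.
  apply: le_trans (rot_lipschitz _ _ _) _; rewrite -[leRHS]mulrA; apply: ler_wpM2l; first by rewrite addr_ge0.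
  have -> : - (T / 2) * s' + T / 2 * t - (- (T / 2) * s + T / 2 * t) = - ((T / 2) * (s' - s)) by ring.
  by rewrite normrN (normrM (T / 2)).
apply: (ae_itv_list (s := [::])) => s _ _; exists (T *: (frame x *m e)); first exact: is_derive_affine.
have -> : coframe (x + (T * s) *: (frame x *m e)) *m (T *: (frame x *m e)) = T *: e.
  by rewrite -(scalemx_frame_line x e (T * s) T) mulmxA coframeK mul1mx.
have D := is_derive_line (is_derive_rot J3 (- (T / 2) * s + T / 2 * t)).
apply: (is_derive_eq (is_derive_mulmx D (is_derive_cst w s (1 : R)))).
rewrite mulmx0 addr0 conn_form_rot_gen -(mul_gen_rot (rot_gen e)) -!scalemxAl scaleNr mulmxA //.
Qed.

(** The auxiliary curve is the horizontal line through [x] with velocity [T *: e];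
    on it the velocity has constant frame components, and transport is explicit. *)
Lemma rolling_lift_line conn x xh (A : 'M[R]_N) (T : R) e : levi_civita metric conn -> unit_horizontal e ->
  rolling_lift conn (x, xh, A) (frame x *m (T *: e))
    (frame x *m (T *: e), A *m (frame x *m (T *: e)),
     A *m frame x *m conn_form (T *: e) *m coframe x - A *m frame x *m (2^-1 *: bracket (frame x *m (T *: e)))).
Proof.
move=> lc ue; have J3 := rot_gen3 ue; have he := ue.1.
have XE : frame x *m (T *: e) = T *: (frame x *m e) by rewrite -scalemxAr.
rewrite !XE; pose c (s : R) : pt := x + (T * s) *: (frame x *m e).
have dc (t : R) : is_derive t (1 : R) c (T *: (frame x *m e)) by exact: is_derive_affine.
have c0 : c 0 = x by rewrite /c mulr0 scale0r addr0.
exists c, (fun t => frame x *m rot (rot_gen e) (T / 2 * t) *m coframe (c t)); split.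
- split=> [t|]; first by have [] := dc t.
  have -> : derive1 c = cst (T *: (frame x *m e)).
    by apply/funext => t; rewrite derive1E; have [_ ->] := dc t.
  by move=> t; exact: cvg_cst.
- by split.
- move=> t v; exists (fun s => frame (c s) *m (rot (rot_gen e) (- (T / 2) * s + T / 2 * t) *m (coframe (c t) *m v))).
  split.
  + apply: parallel_of_frame => //; last exact: frame_parallel_line.
    apply: (ac_globally_lipschitz (K := `|T *: (frame x *m e)|)) => s s'.
    rewrite /c opprD addrACA subrr add0r -scalerBl -mulrBr mulrC -scalerA normrZ mulrC //.
  + have -> : - (T / 2) * t + T / 2 * t = 0 by ring.
    by rewrite rot0 mul1mx mulmxA frameK mul1mx.
  + by rewrite mulr0 add0r c0 !mulmxA.
- have d1 : is_derive (0 : R) (1 : R) c (T *: (frame x *m e)) by [].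
  have d2 : is_derive (0 : R) (1 : R) (fun t : R => xh + t *: (A *m (T *: (frame x *m e))))
      (A *m (T *: (frame x *m e))).
    have := is_derive_affine xh (A *m (T *: (frame x *m e))) 1 0; rewrite scale1r.
    by congr is_derive; apply/funext => t; rewrite mul1r.
  have d3 : is_derive (0 : R) (1 : R) (fun t => A *m (frame x *m rot (rot_gen e) (T / 2 * t) *m coframe (c t)))
      (A *m frame x *m conn_form (T *: e) *m coframe x - A *m frame x *m (2^-1 *: bracket (T *: (frame x *m e)))).
    have D := is_derive_mulmx (is_derive_rot_line (frame x) (T / 2) 0 J3) (is_derive_coframe d1).
    apply: (is_derive_eq (is_derive_mulmx (is_derive_cst A (0 : R) (1 : R)) D)).
    rewrite mul0mx add0r mulr0 rot0 mulmx1 c0 mulmxN mulmxDr mulmxN -!(mulmxA A); congr (_ - _).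
    by rewrite mulmx_conn_form -scalemxAl.
  by apply/is_derive_pairP; split=> //; apply/is_derive_pairP; split.
Qed.

(** Polar coordinates; [e0] supplies a direction when [u = 0]. *)
Lemma horizontal_polar u e0 : horizontal u -> unit_horizontal e0 ->
  exists T e, unit_horizontal e /\ u = T *: e.
Proof.
move=> hu ue0; have [->|u0] := eqVneq u 0; first by exists 0, e0; rewrite scale0r.
have sE : (u^T *m u) 0 0 = \sum_i u i 0 ^+ 2.
  by rewrite mxE; apply: eq_bigr => i _; rewrite mxE.
have s0 : 0 < (u^T *m u) 0 0.
  rewrite sE lt_neqAle sumr_ge0 ?andbT => [|i _]; last exact: sqr_ge0.
  apply: contra u0; rewrite eq_sym psumr_eq0 => [/allP H|i _]; last exact: sqr_ge0.
  apply/eqP/colP => i; rewrite mxE; apply/eqP.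
  by have := H i (mem_index_enum i); rewrite /= sqrf_eq0.
pose T := Num.sqrt ((u^T *m u) 0 0).
have T0 : T != 0 by rewrite sqrtr_eq0 -ltNge.
exists T, (T^-1 *: u); split; last by rewrite scalerA divff // scale1r.
split; first exact: horizontalZ.
rewrite [(_ *: _)^T]linearZ /= -scalemxAl -scalemxAr scalerA -expr2 [u^T *m u]mx11_scalar.
rewrite scale_scalar_mx; congr (_%:M).
have <- : T ^+ 2 = (u^T *m u) 0 0 by rewrite sqr_sqrtr // ltW.
by rewrite -exprMn mulVf // expr1n.
Qed.

(** Back from the state to the configuration: A = C frame(x)^-1. *)
Definition unframe (s : config R m) : config R m := (s.1.1, s.1.2, s.2 *m coframe s.1.1).

Lemma steers_orbit conn (s0 s1 : config R m) e0 : levi_civita metric conn -> unit_horizontal e0 ->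
  steers s0 s1 -> orbit_R conn (unframe s0) (unframe s1).
Proof.
move=> lc ue0 [c [K [L [lip [c0 c1] so dc]]]].
have acc : abs_continuous 0 1 c by exact: ac_globally_lipschitz lip.
have acx : abs_continuous 0 1 (fun t => (c t).1.1) by do 2!apply: ac_fst.
exists (fun t => unframe (c t)); split.
- apply: ac_pair; first apply: ac_pair => //.
  + by apply: ac_snd; apply: ac_fst.
  + by apply: ac_mulmx; [exact: ac_snd|exact: ac_coframe].
- move=> t _; have [CC dC] := so t; split; rewrite /unframe /=.
    by rewrite trmx_mul -mulmxA (mulmxA _^T (c t).2) CC mul1mx metricE.
  by rewrite det_mulmx dC det_coframe mulr1 ltr01.
- apply: (ae_itv_list (s := L)) => t _ tL; have [u hu du] := dc t tL.
  have dx := is_derive_fst (is_derive_fst du).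
  have d : is_derive t (1 : R) (fun t => unframe (c t))
     (frame (c t).1.1 *m u, (c t).2 *m u,
       (c t).2 *m conn_form u *m coframe (c t).1.1 + (c t).2 *m - (2^-1 *: bracket (frame (c t).1.1 *m u))).
    apply/is_derive_pairP; split; last exact: is_derive_mulmx (is_derive_snd du) (is_derive_coframe dx).
    by apply/is_derive_pairP; split=> //; exact: is_derive_snd (is_derive_fst du).
  eexists; first exact: d.
  exists (frame (c t).1.1 *m u); first by apply/DeltaP; exists u.
  have [T [e [ue uE]]] := horizontal_polar hu ue0; rewrite uE.
  have := rolling_lift_line (c t).1.1 (c t).1.2 ((c t).2 *m coframe (c t).1.1) T lc ue.
  have E1 : (c t).2 *m coframe (c t).1.1 *m (frame (c t).1.1 *m (T *: e)) = (c t).2 *m (T *: e).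
    by rewrite -mulmxA (mulmxA (coframe (c t).1.1)) coframeK mul1mx.
  have E2 : (c t).2 *m coframe (c t).1.1 *m frame (c t).1.1 = (c t).2.
    by rewrite -mulmxA coframeK mulmx1.
  by rewrite E1 E2 mulmxN.
- by rewrite c0.
- by rewrite c1.
Qed.

Lemma orbit_full conn (q q1 : config R m) e0 : levi_civita metric conn -> unit_horizontal e0 ->
  (forall y C, SO R N C -> reach (0, y, C)) ->
  Q q -> Q q1 -> q.1.1 = q1.1.1 -> orbit_R conn q q1.
Proof.
move=> lc ue0 H Qq Qq1 E.
have U (p : config R m) : unframe (p.1.1, p.1.2, p.2 *m frame p.1.1) = p.
  by rewrite /unframe /= -mulmxA frameK mulmx1; case: p => -[].
have s1 : SO R N (q1.2 *m frame q.1.1) by rewrite E; exact: Q_frame.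
have := steers_orbit lc ue0 (steers_fiber q.1.1 q.1.2 q1.1.2 H (Q_frame Qq) s1).
by rewrite (U q) E (U q1).
Qed.

Lemma holonomy_R_full conn (q : config R m) e0 : levi_civita metric conn -> unit_horizontal e0 ->
  (forall y C, SO R N C -> reach (0, y, C)) -> Q q -> SE R N `<=` holonomy_R conn q.
Proof.
move=> lc ue0 H Qq a sa; split; first exact: sa.
apply: (orbit_full lc ue0 H Qq); last by rewrite /SE_act.
have [CC dC] := sa; have [AA dA] := Qq; split; rewrite /SE_act /=.
  by rewrite trmx_mul -mulmxA (mulmxA _^T a.2) CC mul1mx.
by rewrite det_mulmx dC mul1r.
Qed.

Lemma coframe_conjK x (D : 'M[R]_N) :
  coframe x *m (frame x *m D *m coframe x) *m frame x = D.
Proof. by rewrite !mulmxA coframeK mul1mx -mulmxA coframeK mulmx1. Qed.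

Lemma holonomy_full conn x (E : 'M[R]_N) : levi_civita metric conn ->
  (forall y C, SO R N C -> reach (0, y, C)) -> orthonormal_basis metric x E ->
  SO R N `<=` holonomy conn x E.
Proof.
move=> lc H oE S sS; apply/holonomyE => //.
have OO := orthonormal_change oE; have OO' := mulmx1C OO.
have sP : SO R N (coframe x *m E *m S *m (coframe x *m E)^T).
  by have := SO_conj (O := (coframe x *m E)^T) (A := S); rewrite trmxK; apply.
set D := coframe x *m E *m S *m _ in sP.
have sI : SO R N (1%:M : 'M[R]_N) by split; rewrite ?trmx1 ?mulmx1 ?det1.
have st := steers_fiber x 0 0 H sI (SO_tr sP).
exists (frame x *m D *m coframe x); first by have := steers_holonomy lc st; rewrite trmxK mulmx1.
by rewrite coframe_conjK /D orth_conjK.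
Qed.

End Lift.

(** * Rank two: everything is reached *)

Section General.
Context {R : realType}.

Lemma polar_angle (c s : R) : c ^+ 2 + s ^+ 2 = 1 -> exists t, cos t = c /\ sin t = s.
Proof.
move=> cs; have c1 : -1 <= c <= 1.
  by rewrite -ler_norml -(expr_le1 (n := 2)) // real_normK ?num_real // -cs lerDl sqr_ge0.
have sE : sin (acos c) = `|s|.
  by rewrite sin_acos // -cs addrC addKr sqrtr_sqr.
have [s0|s0] := leP 0 s.
  by exists (acos c); rewrite acosK // sE ger0_norm.
by exists (- acos c); rewrite cosN sinN acosK // sE ltr0_norm // opprK.
Qed.

Lemma polar (a b : R) : exists r t, [/\ a = r * cos t, b = r * sin t & r ^+ 2 = a ^+ 2 + b ^+ 2].
Proof.
pose r := Num.sqrt (a ^+ 2 + b ^+ 2).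
have r2 : r ^+ 2 = a ^+ 2 + b ^+ 2 by rewrite sqr_sqrtr // addr_ge0 // sqr_ge0.
have [r0|r0] := eqVneq r 0.
  exists 0, 0; rewrite !mul0r expr0n /=; move: r2; rewrite r0 expr0n /= => /esym/eqP.
  by rewrite paddr_eq0 ?sqr_ge0 // !sqrf_eq0 => /andP[/eqP -> /eqP ->]; rewrite expr0n addr0.
have [|t [ct st]] := @polar_angle (a / r) (b / r).
  by rewrite !expr_div_n -mulrDl -r2 divff // sqrf_eq0.
by exists r, t; rewrite ct st ![r * (_ / r)]mulrC !divfK.
Qed.

Lemma rot_mulmx n (J : 'M[R]_n) t (w : 'cV[R]_n) :
  rot J t *m w = w + sin t *: (J *m w) + (1 - cos t) *: (J *m (J *m w)).
Proof. by rewrite /rot !mulmxDl mul1mx -!scalemxAl mulmxA. Qed.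

Context {m : nat}.
Local Notation N := (m + vdim m)%N.
Local Notation pt := 'cV[R]_N.

Lemma dhE h : dh h = col_mx (delta_mx h 0) 0 :> pt.
Proof.
rewrite [LHS]hor_col; last exact: dh_hor.
by congr col_mx; apply/colP => i; rewrite !mxE (inj_eq (@lshift_inj _ _)).
Qed.

Lemma usubmx_dh h : usubmx (dh h : pt) = delta_mx h 0.
Proof. by rewrite dhE col_mxKu. Qed.

Lemma dh_dot h k : (dh h : pt)^T *m dh k = (h == k)%:R%:M.
Proof.
rewrite hor_dot; last exact: dh_hor.
rewrite !usubmx_dh trmx_delta mul_delta_mx_cond; by apply/matrixP => i j; rewrite !ord1; case: eqP => _; rewrite ?mulr1n ?mulr0n !mxE ?eqxx ?mul0rn.
Qed.

Lemma bracket_dv u p : bracket u *m dv p = 0 :> pt.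
Proof.
rewrite bracketC -[X in _ = X]oppr0; congr (- _).
have -> : bracket (dv p : pt) = bracket 0.
  by apply: bracket_hcoord => h; rewrite /hcoord !mxE eq_lrshift.
by rewrite linear0 mul0mx.
Qed.

End General.

Section Heisenberg.
Context {R : realType}.
Local Notation N := (2 + vdim 2)%N.
Local Notation pt := 'cV[R]_N.

Let h1 : 'I_2 := ord0.
Let h2 : 'I_2 := ord_max.
Let p : vpair 2 := exist (fun p : 'I_2 * 'I_2 => (p.2 < p.1)%N) (h2, h1) isT.
Let e1 : pt := dh h1.
Let e2 : pt := dh h2.
Let e3 : pt := dv p.
Let i1 : 'I_N := lshift (vdim 2) h1.
Let i2 : 'I_N := lshift (vdim 2) h2.
Let i3 : 'I_N := rshift 2 (vpair_idx p).

Lemma vpair2 (q : vpair 2) : q = p.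
Proof.
apply/val_inj; case: q => -[[a Ha] [b Hb]] /= H.
by congr (_, _); apply/val_inj => /=; case: a Ha H => [|[|]] //; case: b Hb => [|[|]].
Qed.

Lemma ord_heis (i : 'I_N) : [\/ i = i1, i = i2 | i = i3].
Proof.
case: (split_ordP i) => j ->.
  case: j => -[|[|]] // Hj; [apply: Or31|apply: Or32]; congr lshift; exact/val_inj.
by apply: Or33; rewrite -[j]idx_vpairK (vpair2 (idx_vpair j)).
Qed.

Lemma heis_basis (w : pt) : w = w i1 0 *: e1 + w i2 0 *: e2 + w i3 0 *: e3.
Proof.
apply/colP => i; rewrite !mxE.
have d12 : (i1 == i2) = false by rewrite (inj_eq (@lshift_inj _ _)).
by have [->|->|->] := ord_heis i; rewrite !eqxx ?eq_lrshift ?eq_rlshift ?(inj_eq (@lshift_inj _ _)) /=;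
  rewrite ?mulr1 ?mulr0 ?addr0 ?add0r.
Qed.

Lemma bracket_e2_e1 : bracket e2 *m e1 = e3.
Proof.
apply/colP => i; case: (split_ordP i) => j ->.
  by have := hcoord_bracket e2 e1 j; rewrite /hcoord => ->; rewrite mxE eq_lrshift.
rewrite bracketE -[j]idx_vpairK (vpair2 (idx_vpair j)) vpair_idxK /= /hcoord !mxE.
by rewrite !(inj_eq (@lshift_inj _ _)) /= !eqxx mulr1 mulr0 subr0.
Qed.

Lemma gen2_e1 : rot_gen e2 *m e1 = e3.
Proof.
rewrite rot_genE ?vert_mx_hor ?mul0mx ?col_mx0 ?addr0 ?bracket_e2_e1 //; exact: dh_hor.
Qed.

Lemma gen1_e2 : rot_gen e1 *m e2 = - e3.
Proof.
rewrite rot_genE ?vert_mx_hor ?mul0mx ?col_mx0 ?addr0 ?[bracket e1 *m e2]bracketC ?bracket_e2_e1 //; exact: dh_hor.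
Qed.

Lemma gen1_e3 : rot_gen e1 *m e3 = e2.
Proof.
rewrite rot_genE; last exact: dh_hor.
rewrite bracket_dv add0r vert_mx_dv usubmx_dh /= mulmxBl !mul_delta_mx_cond /= subr0 -dhE //.
Qed.

Lemma gen2_e3 : rot_gen e2 *m e3 = - e1.
Proof.
rewrite rot_genE; last exact: dh_hor.
rewrite bracket_dv add0r vert_mx_dv usubmx_dh /= mulmxBl !mul_delta_mx_cond /= sub0r.
by rewrite [e1]dhE opp_col_mx oppr0.
Qed.

Lemma unit_e1 : unit_horizontal e1. Proof. by split; [exact: dh_hor|rewrite dh_dot]. Qed.
Lemma unit_e2 : unit_horizontal e2. Proof. by split; [exact: dh_hor|rewrite dh_dot]. Qed.
Lemma dot12 : e1^T *m e2 = 0. Proof. by rewrite dh_dot /=; apply/matrixP => i j; rewrite !mxE mul0rn. Qed.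
Lemma dot21 : e2^T *m e1 = 0. Proof. by rewrite -[LHS]trmxK trmx_mul trmxK dot12 trmx0. Qed.

Let R1 := rot (rot_gen e1).
Let R2 := rot (rot_gen e2).

Lemma rot1_e1 t : R1 t *m e1 = e1. Proof. by apply: rot_fix; exact: dh_hor. Qed.
Lemma rot1_e2 t : R1 t *m e2 = cos t *: e2 - sin t *: e3.
Proof.
rewrite /R1 rot_mulmx gen1_e2 mulmxN gen1_e3; apply/colP => i; rewrite !mxE.
by move: (e2 i 0) (e3 i 0) => a b; ring.
Qed.
Lemma rot1_e3 t : R1 t *m e3 = cos t *: e3 + sin t *: e2.
Proof.
rewrite /R1 rot_mulmx gen1_e3 gen1_e2; apply/colP => i; rewrite !mxE.
by move: (e2 i 0) (e3 i 0) => a b; ring.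
Qed.
Lemma rot2_e1 t : R2 t *m e1 = cos t *: e1 + sin t *: e3.
Proof.
rewrite /R2 rot_mulmx gen2_e1 gen2_e3; apply/colP => i; rewrite !mxE.
by move: (e1 i 0) (e3 i 0) => a b; ring.
Qed.

Lemma SO_rot1 t : SO R N (R1 t). Proof. exact: rot_SO (rot_gen3 unit_e1) (rot_genT e1) t. Qed.
Lemma SO_rot2 t : SO R N (R2 t). Proof. exact: rot_SO (rot_gen3 unit_e2) (rot_genT e2) t. Qed.

Lemma reach_rot1 t : reach (0, 0, R1 t). Proof. exact: reach_rot unit_e1 unit_e2 dot12. Qed.
Lemma reach_rot2 t : reach (0, 0, R2 t). Proof. exact: reach_rot unit_e2 unit_e1 dot21. Qed.

Lemma e1E : e1 = delta_mx i1 0. Proof. by []. Qed.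
Lemma e2E : e2 = delta_mx i2 0. Proof. by []. Qed.
Lemma e3E : e3 = delta_mx i3 0. Proof. by []. Qed.

Lemma i1_neq_i2 : i1 != i2. Proof. by rewrite (inj_eq (@lshift_inj _ _)). Qed.
Lemma i1_neq_i3 : i1 != i3. Proof. by rewrite eq_lrshift. Qed.
Lemma i2_neq_i3 : i2 != i3. Proof. by rewrite eq_lrshift. Qed.

Lemma entry_dot (i : 'I_N) (w : pt) : ((delta_mx i 0 : pt)^T *m w) 0 0 = w i 0.
Proof. by rewrite trmx_delta -rowE mxE. Qed.

Lemma SO_dot (H : 'M[R]_N) (v w : pt) : SO R N H -> (H *m v)^T *m (H *m w) = v^T *m w.
Proof. by move=> [HH _]; rewrite trmx_mul -mulmxA (mulmxA H^T) HH mul1mx. Qed.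

(** The third axis is then preserved up to a factor, which the determinant
    shows to be 1. *)
Lemma SO_fix12 (H : 'M[R]_N) : SO R N H -> H *m e1 = e1 -> H *m e2 = e2 -> H = 1%:M.
Proof.
move=> HS H1 H2; have [HH dH] := HS.
pose g := (H *m e3) i3 0.
have H3 : H *m e3 = g *: e3.
  rewrite [LHS]heis_basis.
  have -> : (H *m e3) i1 0 = 0.
    rewrite -entry_dot -e1E -{1}H1 SO_dot // entry_dot e3E mxE.
    by rewrite (negPf i1_neq_i3).
  have -> : (H *m e3) i2 0 = 0.
    rewrite -entry_dot -e2E -{1}H2 SO_dot // entry_dot e3E mxE.
    by rewrite (negPf i2_neq_i3).
  by rewrite !scale0r !add0r.
pose d := \row_(j < N) (if j == i3 then g else 1).
have HD : H = diag_mx d.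
  apply: mulmx_ext => w; rewrite [in LHS](heis_basis w) !mulmxDr -!scalemxAr H1 H2 H3.
  apply/colP => i; rewrite mul_diag_mx !mxE.
  have [->|->|->] := ord_heis i; rewrite !eqxx ?(negPf i1_neq_i2) ?(negPf i1_neq_i3) ?(negPf i2_neq_i3);
    rewrite ?[i2 == i1]eq_sym ?[i3 == i1]eq_sym ?[i3 == i2]eq_sym ?(negPf i1_neq_i2) ?(negPf i1_neq_i3) ?(negPf i2_neq_i3) /=;
    ring.
have g1 : g = 1.
  move: dH; rewrite HD det_diag (bigD1 i3) //= big1 => [|j /negPf j3]; rewrite mxE ?eqxx ?mulr1 //.
  by rewrite j3.
apply: mulmx_ext => w; rewrite [in LHS](heis_basis w) !mulmxDr -!scalemxAr H1 H2 H3 g1 scale1r.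
by rewrite -heis_basis mul1mx.
Qed.

(** Euler angles: two rotations bring [e1] to its image under [C], and what remains is a
    rotation about [e1]. *)
Lemma reach_SO3 (C : 'M[R]_N) : SO R N C -> reach (0, 0, C).
Proof.
move=> CS; pose p1 := (C *m e1) i1 0; pose p2 := (C *m e1) i2 0; pose p3 := (C *m e1) i3 0.
have dotE (v w : pt) : (v^T *m w) 0 0 = v i1 0 * w i1 0 + v i2 0 * w i2 0 + v i3 0 * w i3 0.
  have trD (A B : pt) : (A + B)^T = A^T + B^T by rewrite linearD.
  have trZ k (A : pt) : (k *: A)^T = k *: A^T by rewrite linearZ.
  rewrite {1}(heis_basis v) !trD !trZ !mulmxDl -!scalemxAl.
  have ad (A B : 'M[R]_1) : (A + B) 0 0 = A 0 0 + B 0 0 by rewrite mxE.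
  have sc k (A : 'M[R]_1) : (k *: A) 0 0 = k * A 0 0 by rewrite mxE.
  by rewrite !ad !sc e1E e2E e3E !entry_dot.
have e1i : (e1 i1 0 = 1) * (e1 i2 0 = 0) * (e1 i3 0 = 0).
  by rewrite !mxE !eqxx [i2 == i1]eq_sym [i3 == i1]eq_sym (negPf i1_neq_i2) (negPf i1_neq_i3).
have e2i : (e2 i1 0 = 0) * (e2 i2 0 = 1) * (e2 i3 0 = 0).
  by rewrite !mxE !eqxx [i3 == i2]eq_sym (negPf i1_neq_i2) (negPf i2_neq_i3).
have pn : p1 ^+ 2 + p2 ^+ 2 + p3 ^+ 2 = 1.
  have := congr1 (fun M : 'M[R]_1 => M 0 0) (SO_dot e1 e1 CS).
  by rewrite !dotE !e1i -/p1 -/p2 -/p3 !expr2; lra.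
have [r [t [E3 E2 Er]]] := polar p3 p2.
have [|t2 [ct st]] := @polar_angle _ p1 r; first by rewrite Er; lra.
pose G := R1 t *m R2 t2; have GS : SO R N G := SO_mul (SO_rot1 t) (SO_rot2 t2).
have Ge1 : G *m e1 = C *m e1.
  rewrite /G -mulmxA rot2_e1 mulmxDr -!scalemxAr rot1_e1 rot1_e3 ct st [RHS]heis_basis -/p1 -/p2 -/p3 E2 E3.
  by rewrite scalerDr !scalerA addrAC -addrA.
pose D := G^T *m C; have DS : SO R N D := SO_mul (SO_tr GS) CS.
have De1 : D *m e1 = e1 by rewrite /D -mulmxA -Ge1 mulmxA GS.1 mul1mx.
have D1 : (D *m e2) i1 0 = 0.
  by rewrite -entry_dot -e1E -{1}De1 SO_dot // entry_dot e2i.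
have Dn : (D *m e2) i2 0 ^+ 2 + (- (D *m e2) i3 0) ^+ 2 = 1.
  have := congr1 (fun M : 'M[R]_1 => M 0 0) (SO_dot e2 e2 DS).
  by rewrite !dotE D1 !e2i !expr2; lra.
have [t3 [c3 s3]] := polar_angle Dn.
have De2 : D *m e2 = R1 t3 *m e2.
  by rewrite rot1_e2 c3 s3 [LHS]heis_basis D1 scale0r add0r scaleNr opprK.
have H1 : (R1 t3)^T *m D = 1%:M.
  apply: SO_fix12; first exact: SO_mul (SO_tr (SO_rot1 t3)) DS.
    by rewrite -mulmxA De1 -{1}(rot1_e1 t3) mulmxA (SO_rot1 t3).1 mul1mx.
  by rewrite -mulmxA De2 mulmxA (SO_rot1 t3).1 mul1mx.
have -> : C = R1 t *m R2 t2 *m R1 t3.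
  rewrite -/G -[R1 t3]mulmx1 -H1 (mulmxA (R1 t3)) (mulmx1C (SO_rot1 t3).1) mul1mx.
  by rewrite /D mulmxA (mulmx1C GS.1) mul1mx.
by apply: reach_rotM; [apply: reach_rotM; [exact: reach_rot1|exact: reach_rot2]|exact: reach_rot1].
Qed.

Lemma reach_full (y : pt) (C : 'M[R]_N) : SO R N C -> reach (0, y, C).
Proof.
move=> CS; apply: reach_rotated; last exact: reach_SO3.
have T1 q : reach (0, q *: e1, 1%:M).
  apply: (reach_displace q unit_e1 unit_e2 dot12 (reach_rot2 pi) _ (SO_rot2 pi)).
    exact: reach_SO3 (SO_tr (SO_rot2 pi)).
  by rewrite rot2_e1 cospi sinpi scale0r addr0 scaleN1r.
have T2 q : reach (0, q *: e2, 1%:M).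
  apply: (reach_displace q unit_e2 unit_e1 dot21 (reach_rot1 pi) _ (SO_rot1 pi)).
    exact: reach_SO3 (SO_tr (SO_rot1 pi)).
  by rewrite rot1_e2 cospi sinpi scale0r subr0 scaleN1r.
have T3 q : reach (0, q *: e3, 1%:M).
  have := reach_conj (reach_rot1 (pi / 2)) (reach_SO3 (SO_tr (SO_rot1 (pi / 2)))) (SO_rot1 (pi / 2)) (T2 (- q)).
  by rewrite -scalemxAr rot1_e2 cos_pihalf sin_pihalf scale0r sub0r scale1r scalerN scaleNr opprK.
by rewrite (heis_basis y); apply: reach_translationD; [apply: reach_translationD; [exact: T1|exact: T2]|exact: T3].
Qed.

End Heisenberg.

(** * The holonomy groups are proper exactly in rank at least three *)

Theorem corollary4p10 (R : realType) (m : nat) (hm : (2 <= m)%N)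
    (conn : 'cV[R]_(m + vdim m) -> 'I_(m + vdim m) -> 'M[R]_(m + vdim m))
    (hconn : levi_civita metric conn)
    (x : 'cV[R]_(m + vdim m)) (E : 'M[R]_(m + vdim m))
    (hE : orthonormal_basis metric x E)
    (q : config R m) (hq : Q q) :
  [/\ holonomy_R conn q `<=` SE R (m + vdim m),
      holonomy conn x E `<=` SO R (m + vdim m),
      holonomy_R conn q `<` SE R (m + vdim m) <-> (3 <= m)%N &
      holonomy conn x E `<` SO R (m + vdim m) <-> (3 <= m)%N].
Proof.
have subR : holonomy_R conn q `<=` SE R (m + vdim m) by move=> a [].
have sub := holonomy_SO hconn hE.
have full : ~~ (3 <= m)%N ->
    SE R (m + vdim m) `<=` holonomy_R conn q /\ SO R (m + vdim m) `<=` holonomy conn x E.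
  rewrite -ltnNge ltnS => m2.
  have {m2 hm} m2 : m = 2 by apply/eqP; rewrite eqn_leq m2 hm.
  move: conn hconn x E hE q hq {subR sub}; rewrite m2 => conn hconn x E hE q hq.
  split; first exact: (holonomy_R_full hconn (@unit_e1 R) (@reach_full R) hq).
  exact: holonomy_full hconn (@reach_full R) hE.
split=> //; split=> [[_ nsub]|m3].
- by apply: contra_notT nsub => /full[].
- split=> // sup; have [a aSE na] := holonomy_R_proper hconn m3 hq.
  exact: na (sup a aSE).
- by apply: contra_notT nsub => /full[].
- split=> // sup; have [S sS nS] := holonomy_proper hconn m3 hE.
  exact: nS (sup S sS).
Qed.
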